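(* Let $N\ge 1$ be an integer, let $u_0,v_0,w_1,w_2\in C_0(\mathbb{R}^N)$, $\sigma,\gamma>-1$, and $p,q>1$. Consider the Cauchy problem $$u_t-\Delta u=|v|^p+t^\sigma w_1(x),\quad v_t-\Delta v=|u|^q+t^\gamma w_2(x)\quad (x\in\mathbb{R}^N,\ t>0),\qquad (u(0,x),v(0,x))=(u_0(x),v_0(x)).$$ Then the following holds: (i) There exist $0<T<\infty$ and a unique mild solution $(u,v)\in C([0,T],C_0(\mathbb{R}^N)\times C_0(\mathbb{R}^N))$ to this problem. (ii) The solution $(u,v)$ can be extended to a maximal interval $[0,T_{\max})$, $0<T_{\max}\le\infty$. Moreover, if $T_{\max}<\infty$, then $$\lim_{t\to T_{\max}^-}\left(\|u\|_{L^\infty((0,t)\times\mathbb{R}^N)}+\|v\|_{L^\infty((0,t)\times\mathbb{R}^N)}\right)=\infty.$$ (iii) If, in addition, $u_0,v_0,w_1,w_2\in L^r(\mathbb{R}^N)$ for some $1\le r<\infty$, then $$u,v\in C([0,T_{\max}),C_0(\mathbb{R}^N)\cap L^r(\mathbb{R}^N)).$$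
   Context: $C_0(\mathbb{R}^N)$ denotes the set of all continuous (real-valued, possibly sign-changing) functions on $\mathbb{R}^N$ decaying to zero at infinity, with the supremum norm. $S(t)=e^{t\Delta}$ is the heat semigroup on $\mathbb{R}^N$. Mild solution: for $T>0$, a pair $(u,v)\in C([0,T],C_0(\mathbb{R}^N)\times C_0(\mathbb{R}^N))$ is a mild solution to the problem (on $[0,T]$) if for all $0\le t\le T$ $$u(t)=S(t)u_0+\int_0^t S(t-s)|v(s)|^p\,ds+\int_0^t s^\sigma S(t-s)w_1\,ds,$$ $$v(t)=S(t)v_0+\int_0^t S(t-s)|u(s)|^q\,ds+\int_0^t s^\gamma S(t-s)w_2\,ds.$$ The maximal existence time is $T_{\max}=\sup\{\tau>0:\ \text{there is a mild solution } (u,v) \text{ in } C([0,\tau],C_0(\mathbb{R}^N)\times C_0(\mathbb{R}^N))\}$. *)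

(* Defs.v *)
From HB Require Import structures.
From mathcomp Require Import all_boot all_order all_algebra.
From mathcomp Require Import all_classical all_reals all_analysis.

Set Implicit Arguments.
Unset Strict Implicit.
Unset Printing Implicit Defensive.

Import Order.TTheory GRing.Theory Num.Theory.
Import numFieldNormedType.Exports.

Local Open Scope classical_set_scope.
Local Open Scope ring_scope.

(* The sigma-algebra on R^n is generated by the coordinates (as the library
   does for tuples); over a realType it is the Borel sigma-algebra. *)
Fact rV_display : measure_display.
Proof. exact: default_measure_display. Qed.

Section measurable_rV.
Context {R : realType} (n : nat).

Let coord (i : 'I_n) (x : 'rV[R]_n) : measurableTypeR R := x ord0 i.

Let rV_set0 : g_sigma_preimage coord set0.
Proof. exact: sigma_algebra0. Qed.

Let rV_setC A : g_sigma_preimage coord A -> g_sigma_preimage coord (~` A).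
Proof. exact: sigma_algebraC. Qed.

Let rV_bigcup (F : (set 'rV[R]_n)^nat) :
  (forall i, g_sigma_preimage coord (F i)) ->
  g_sigma_preimage coord (\bigcup_i (F i)).
Proof. exact: sigma_algebra_bigcup. Qed.

HB.instance Definition _ :=
  @isMeasurable.Build rV_display 'rV[R]_n
    (g_sigma_preimage coord) rV_set0 rV_setC rV_bigcup.
End measurable_rV.

Section lebesgue_measure_rV.
Context {R : realType}.

Definition row_cons n (x : measurableTypeR R * 'rV[R]_n) : 'rV[R]_n.+1 :=
  \row_(i < n.+1) oapp (fun j => x.2 ord0 j) x.1 (unlift ord0 i).

Definition row_behead n (x : 'rV[R]_n.+1) : measurableTypeR R * 'rV[R]_n :=
  (x ord0 ord0, \row_(j < n) x ord0 (lift ord0 j)).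

Lemma row_consK n : cancel (@row_cons n) (@row_behead n).
Proof.
move=> [a b]; rewrite /row_behead !mxE unlift_none /=; congr pair.
by apply/rowP => j; rewrite !mxE liftK.
Qed.

Lemma measurable_coord n (i : 'I_n) :
  measurable_fun setT (fun x : 'rV[R]_n => x ord0 i : measurableTypeR R).
Proof.
move=> _ Y mY; rewrite setTI; apply: sub_sigma_algebra => /=.
rewrite -bigcup_seq/=; exists i => /=; first by rewrite mem_index_enum.
by exists Y => //; rewrite setTI.
Qed.

Lemma measurable_fun_coordP d (T : measurableType d) n (f : T -> 'rV[R]_n) :
  (forall i, measurable_fun setT (fun x => f x ord0 i : measurableTypeR R)) ->
  measurable_fun setT f.
Proof.
move=> mf; apply: (measurability (\big[setU/set0]_(i < n) preimage_set_system setT (fun x : 'rV[R]_n => x ord0 i : measurableTypeR R) measurable)) => //=.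
move=> _ [B mB <-].
move: mB; rewrite -bigcup_seq => -[i _ [Y mY <-]].
by rewrite setTI; exact: mf.
Qed.

Lemma measurable_row_cons n : measurable_fun setT (@row_cons n).
Proof.
apply: measurable_fun_coordP => i.
case: (unliftP ord0 i) => [j|] ->.
  rewrite (_ : (fun _ => _) = (fun x : 'rV[R]_n => x ord0 j) \o snd).
    by apply: measurableT_comp => //; exact: measurable_coord.
  by apply/funext => x /=; rewrite mxE liftK.
rewrite (_ : (fun _ => _) = fst)//.
by apply/funext => x /=; rewrite mxE unlift_none.
Qed.

Lemma measurable_row_behead n : measurable_fun setT (@row_behead n).
Proof.
apply/measurable_fun_pair => /=; first exact: measurable_coord.
apply: measurable_fun_coordP => i.
rewrite (_ : (fun _ => _) = (fun x : 'rV[R]_n.+1 => x ord0 (lift ord0 i))).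
  exact: measurable_coord.
by apply/funext => x /=; rewrite mxE.
Qed.

Section succ.
Local Open Scope ereal_scope.
Variables (n : nat) (mu : {sigma_finite_measure set 'rV[R]_n -> \bar R}).

Definition lebesgue_rVS : set 'rV[R]_n.+1 -> \bar R :=
  pushforward (@lebesgue_measure R \x mu) (@row_cons n).

Let lebesgue_rVS0 : lebesgue_rVS set0 = 0.
Proof. by rewrite /lebesgue_rVS /pushforward preimage_set0 measure0. Qed.

Let lebesgue_rVS_ge0 A : 0 <= lebesgue_rVS A.
Proof. exact: (measure_ge0 (@lebesgue_measure R \x mu)%E). Qed.

Let lebesgue_rVS_sigma_additive : semi_sigma_additive lebesgue_rVS.
Proof.
move=> F mF tF mUF; rewrite /lebesgue_rVS /pushforward preimage_bigcup.
have mrc A : measurable A -> measurable (@row_cons n @^-1` A).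
  by move=> mA; rewrite -[X in measurable X]setTI; exact: measurable_row_cons.
apply: measure_semi_sigma_additive.
- by move=> i; exact: mrc.
- apply/trivIsetP => /= i j _ _ ij; rewrite -preimage_setI.
  by move/trivIsetP : tF => /(_ _ _ _ _ ij) ->//; rewrite preimage_set0.
- by rewrite -preimage_bigcup; exact: mrc.
Qed.

HB.instance Definition _ := isMeasure.Build _ _ _ lebesgue_rVS
  lebesgue_rVS0 lebesgue_rVS_ge0 lebesgue_rVS_sigma_additive.

Let lebesgue_rVS_sigma_finite : sigma_finite setT lebesgue_rVS.
Proof.
have /sigma_finiteP[F [FT ndF Foo]] := sigma_finiteT (@lebesgue_measure R).
have /sigma_finiteP[G [GT ndG Goo]] := sigma_finiteT mu.
exists (fun k => @row_behead n @^-1` (F k `*` G k)).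
  rewrite -preimage_bigcup; apply/esym/seteqP; split => // x _ /=.
  have [i _ Fi] : (\bigcup_k F k) (row_behead x).1 by rewrite -FT.
  have [j _ Gj] : (\bigcup_k G k) (row_behead x).2 by rewrite -GT.
  exists (maxn i j) => //; split.
    by move: Fi; exact/subsetPset/ndF/leq_maxl.
  by move: Gj; exact/subsetPset/ndG/leq_maxr.
move=> k; have [mF Fk] := Foo k; have [mG Gk] := Goo k; split.
  rewrite -[X in measurable X]setTI.
  by apply: measurable_row_behead => //; exact: measurableX.
rewrite /lebesgue_rVS /pushforward -comp_preimage.
rewrite (_ : _ \o _ = id); last by apply/funext => x; exact: row_consK.
rewrite preimage_id [ltLHS](product_measure1E (@lebesgue_measure R) mu)//.
by rewrite lte_mul_pinfty// ge0_fin_numE.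
Qed.

HB.instance Definition _ := Measure_isSigmaFinite.Build _ _ _ lebesgue_rVS
  lebesgue_rVS_sigma_finite.

End succ.

(* Lebesgue measure on R^n: the n-fold product of the one-dimensional one. *)
Fixpoint lebesgue_rV n : {sigma_finite_measure set 'rV[R]_n -> \bar R} :=
  match n with
  | 0%N => [the {sigma_finite_measure set _ -> \bar R} of dirac (0 : 'rV[R]_0)]
  | n'.+1 =>
    [the {sigma_finite_measure set _ -> \bar R} of lebesgue_rVS (lebesgue_rV n')]
  end.

Lemma lebesgue_rV_box n (A : 'I_n -> set (measurableTypeR R)) :
  (forall i, measurable (A i)) ->
  lebesgue_rV n [set x : 'rV[R]_n | forall i, A i (x ord0 i)] =
  (\prod_(i < n) lebesgue_measure (A i))%E.
Proof.
elim: n A => [|n IH] A mA.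
  by rewrite big_ord0 /= /dirac indicE mem_set//; case.
rewrite big_ord_recl -IH//= /lebesgue_rVS /pushforward.
rewrite -(@product_measure1E _ _ _ _ R lebesgue_measure (lebesgue_rV n))//.
  congr (product_measure1 _ _ _); apply/seteqP; split => -[a b] /=.
    move=> H; split; first by have := H ord0; rewrite mxE unlift_none.
    by move=> i; have := H (lift ord0 i); rewrite mxE liftK.
  by move=> [Aa H] i; rewrite mxE; case: (unliftP ord0 i) => [j|] ->/=.
rewrite (_ : [set _ | _] = \bigcap_(i in [set` 'I_n])
    [set x : 'rV[R]_n | A (lift ord0 i) (x ord0 i)]); last first.
  by apply/seteqP; split => x /= H i; [move=> _|]; exact: H.
apply: fin_bigcap_measurable => // i _.
by rewrite -[X in measurable X]setTI; exact: (@measurable_coord n i).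
Qed.

End lebesgue_measure_rV.

Section heat_system.
Context {R : realType} {N : nat}.
Implicit Types (f : 'rV[R]_N -> R) (u v : R -> 'rV[R]_N -> R) (I : set R).

(* On 'rV[R]_N, `|x| is the maximum norm: it is equivalent to the Euclidean
   norm, so the condition at infinity does not depend on the choice. *)
Definition C0 : set ('rV[R]_N -> R) :=
  [set f | continuous f /\
    forall e : R, 0 < e -> exists M : R, forall x, M < `|x| -> `|f x| < e].

(* u \in C(I, C_0(R^N)): the topology of {uniform _ -> _} is that of the
   supremum norm. Values of u outside I are irrelevant. *)
Definition continuous_C0 I u : Prop :=
  (forall t, I t -> C0 (u t)) /\
  {within I, continuous (u : R -> {uniform 'rV[R]_N -> R})}.

(* u \in C(I, L^r(R^N)) *)
Definition continuous_Lr (r : R) I u : Prop :=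
  (forall t, I t -> u t \in Lfun (lebesgue_rV N) r%:E) /\
  forall t, I t ->
    ('N[lebesgue_rV N]_(r%:E)[EFin \o (u s \- u t)%R])%E
      @[s --> within I (nbhs t)] --> 0%E.

(* Gauss-Weierstrass kernel (4 pi t)^(-N/2) exp(-|x|^2 / (4t)), with |x| the
   Euclidean norm. *)
Definition heat_kernel (t : R) (x : 'rV[R]_N) : R :=
  (4 * pi * t) `^ (- (N%:R / 2)) *
  expR (- (\sum_(i < N) x ord0 i ^+ 2) / (4 * t)).

(* S(t) = e^{t Delta} for t >= 0 *)
Definition heat_semigroup (t : R) f : 'rV[R]_N -> R := fun x =>
  if t == 0 then f x
  else \int[lebesgue_rV N]_y (heat_kernel t (x - y) * f y).

Local Notation S := heat_semigroup.
Local Notation leb := (@lebesgue_measure R).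

Section solutions.
Variables (u0 v0 w1 w2 : 'rV[R]_N -> R) (sigma gamma p q : R).

(* The C_0(R^N)-valued integrals are evaluated pointwise in x. *)
Definition mild_solution (T : R) u v : Prop :=
  [/\ continuous_C0 `[0, T] u, continuous_C0 `[0, T] v &
   forall t, 0 <= t <= T -> forall x,
     u t x = S t u0 x
       + \int[leb]_(s in `[0, t]) S (t - s) (fun y => `|v s y| `^ p) x
       + \int[leb]_(s in `[0, t]) (s `^ sigma * S (t - s) w1 x)
     /\
     v t x = S t v0 x
       + \int[leb]_(s in `[0, t]) S (t - s) (fun y => `|u s y| `^ q) x
       + \int[leb]_(s in `[0, t]) (s `^ gamma * S (t - s) w2 x)].

Definition Tmax : \bar R :=
  ereal_sup [set tau%:E | tau in
    [set tau : R | 0 < tau /\ exists u v, mild_solution tau u v]].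

Definition maximal_interval : set R := [set t | 0 <= t /\ (t%:E < Tmax)%E].

(* (u, v) is a mild solution on [0, Tmax) *)
Definition maximal_solution u v : Prop :=
  forall tau : R, 0 < tau -> (tau%:E < Tmax)%E -> mild_solution tau u v.

End solutions.

(* || u ||_{L^oo((0,t) x R^N)} *)
Definition Loo_norm (t : R) u : \bar R :=
  ('N[mrestr (leb \x lebesgue_rV N)
        (measurableX (measurable_itv `]0%R, t[) measurableT)]_+oo
     [EFin \o (fun z => u z.1 z.2)])%E.

End heat_system.

(* Main.v *)
Require Import Defs.
From HB Require Import structures.
From mathcomp Require Import all_boot all_order all_algebra.
From mathcomp Require Import all_classical all_reals all_analysis.
From mathcomp Require Import measurable_realfun ess_sup_inf.
From mathcomp Require Import ring lra.

(** Local existence, maximal continuation and persistence of L^r integrability for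
    a weakly coupled system of two heat equations.

    The mild equations are of Volterra type in C_0: u is a linear part, built from
    the data, plus the Duhamel integral of |v|^p, and symmetrically for v. If the
    powers are cut off at a level M they become globally Lipschitz (trunc_pow), and
    since the heat flow contracts the sup norm, the Duhamel operator is a
    1/2-contraction for the weighted norm sup_t e^(-2Lt) |u(t)| on every time
    interval (nonlin_contraction). Hence the truncated system has a unique global
    solution (volterra_exists, volterra_unique), which is a mild solution as long as
    it stays below M. Conversely a mild solution on [0, T] is bounded and solves the
    system truncated at any level above its bound (mild_volterra), which gives
    uniqueness.

    Existence and continuation are then two instances of one remark: truncate one
    unit above the initial data, respectively above a bound K valid on [0, T); the
    global solution of that truncated system agrees with the given one before T, and
    by continuity it stays below the truncation a little longer (local_existence,
    continuation). The Volterra equation is thus always posed from time 0, and nothing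
    is restarted at time T. If the solution were bounded on
    [0, Tmax) it would continue past Tmax; so it exceeds every level A, on an open
    set by continuity, and the essential supremum over (0, t) is at least A
    (blow_up).

    For the estimates the heat semigroup is written as a Gaussian average of
    f(x + sqrt t z) (heat_semigroupE). Its continuity in t and x, and the decay of
    the result at infinity, follow from those of f once the Gaussian tail is
    discarded (norm_gaussE_split).

    For persistence of L^r, let z be one of the components on [0, T], where it is
    bounded, so that the nonlinearity is at most a multiple of the other component.
    Young's inequality under the averages shows that the functions |z|^r satisfy a
    linear Volterra inequality whose source has bounded integral
    (power_subsolution). They lie below the Picard iterates of the linear equation,
    up to an error tending to 0 (subsolution_le_picard); the heat flow preserves
    integrals, so the iterates are bounded in L^1 (mass_picard_le), and Fatou's lemma
    gives the L^r bound (power_mass_bounded). For continuity in time, |z(s) - z(t)|^r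
    tends to 0 uniformly as s tends to t and is dominated by functions of s and t
    that converge uniformly and whose integrals converge; a variant of Scheffe's
    lemma concludes (scheffe_le, power_mass_continuous). *)

Set Implicit Arguments.
Unset Strict Implicit.
Unset Printing Implicit Defensive.

Import Order.TTheory GRing.Theory Num.Theory.
Import numFieldNormedType.Exports.

Local Open Scope classical_set_scope.
Local Open Scope ring_scope.

(** * Measurability on R^n *)

Section measurability_rV.
Context {R : realType}.

Lemma coord_le_norm n (x : 'rV[R]_n) i : `|x ord0 i| <= `|x|.
Proof.
rewrite [leRHS]/Num.norm /= mx_normrE.
by apply/bigmax_geP; right => /=; exists (ord0, i).
Qed.

Lemma norm_rV_lt n (x : 'rV[R]_n) (e : R) : 0 < e ->
  (forall i, `|x ord0 i| < e) -> `|x| < e.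
Proof.
move=> e0 h; rewrite [ltLHS]/Num.norm /= mx_normrE.
by apply/bigmax_ltP; split => //= -[i j] _; rewrite ord1; exact: h.
Qed.

Lemma measurable_ball_rV n (x : 'rV[R]_n) (e : R) : 0 < e -> measurable (ball x e).
Proof.
move=> e0.
rewrite (_ : ball x e = \bigcap_(i in [set` 'I_n])
    [set y : 'rV[R]_n | ball (x ord0 i) e (y ord0 i)]).
  apply: fin_bigcap_measurable => // i _; rewrite -[X in measurable X]setTI.
  exact: (@measurable_coord R n i measurableT _ (open_measurable (ball_open (x ord0 i) e))).
rewrite -ball_normE; apply/seteqP; split => y /=.
  move=> xy i _; rewrite -ball_normE/= (le_lt_trans _ xy)//.
  by have := coord_le_norm (x - y) i; rewrite !mxE.
move=> H; apply: norm_rV_lt => // i; rewrite !mxE.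
by have := H i isT; rewrite /= -ball_normE.
Qed.

Lemma rat_rV_near n (x : 'rV[R]_n) (e : R) : 0 < e ->
  exists k : 'rV[rat]_n, ball x e (map_mx ratr k).
Proof.
move=> e0.
have /choice[f Hf] (i : 'I_n) : exists q : rat, `|x ord0 i - ratr q| < e.
  have /rat_in_itvoo[q] : x ord0 i - e < x ord0 i + e by lra.
  by rewrite in_itv/= => h; exists q; rewrite distrC ltr_distl.
exists (\row_i f i); rewrite -ball_normE/=; apply: norm_rV_lt => // i.
by rewrite !mxE.
Qed.

(** The coordinate sigma-algebra is the Borel one because the countably many
    balls of rational centre and radius form a basis of the topology. *)
Lemma open_measurable_rV n (U : set 'rV[R]_n) : open U -> measurable U.
Proof.
move=> oU.
pose I := ('rV[rat]_n * nat)%type.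
pose B (i : I) : set 'rV[R]_n := ball (map_mx ratr i.1 : 'rV[R]_n) i.2.+1%:R^-1.
pose F (i : I) := if `[< B i `<=` U >] then B i else set0.
have -> : U = \bigcup_i F i.
  apply/seteqP; split => [x Ux|x [i _]]; last first.
    by rewrite /F; case: ifPn => // /asboolP; apply.
  have /nbhs_ballP[e /= e0 eU] : nbhs x U by apply: open_nbhs_nbhs.
  have e20 : 0 < e / 2 by rewrite divr_gt0.
  have [m me] : exists m : nat, m.+1%:R^-1 < e / 2.
    by have [m _ /(_ _ (leqnn _))/=] := near_infty_natSinv_lt (PosNum e20); exists m.
  have m0 : 0 < m.+1%:R^-1 :> R by rewrite invr_gt0.
  have [k xk] := rat_rV_near x m0.
  exists (k, m) => //; rewrite /F asboolT; first exact: ball_sym.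
  move=> y By; apply: eU; apply: (@le_ball _ _ _ (m.+1%:R^-1 + m.+1%:R^-1)).
    by rewrite (splitr e) lerD// ltW.
  exact: ball_triangle xk By.
apply: countable_bigcupT_measurable; first exact: countableP.
move=> i; rewrite /F; case: ifP => // _.
by apply: measurable_ball_rV; rewrite invr_gt0.
Qed.

Lemma continuous_measurable_rV n (f : 'rV[R]_n -> R) :
  continuous f -> measurable_fun setT f.
Proof.
move=> /continuousP cf; apply: (measurability _ (RGenOpens.measurableE R)).
move=> _ [_ [a [b ->] <-]]; rewrite setTI; apply: open_measurable_rV.
exact/cf/interval_open.
Qed.

Lemma continuous_row_behead n : continuous (fun x : 'rV[R]_n.+1 =>
  (x ord0 ord0, \row_(j < n) x ord0 (lift ord0 j)) : R * 'rV[R]_n).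
Proof.
move=> x U /nbhs_ballP[e /= e0 eU]; apply/nbhs_ballP; exists e => //= y.
rewrite -ball_normE/= => xy; apply: eU; split => /=; rewrite -ball_normE/=.
  by apply: le_lt_trans xy; have := coord_le_norm (x - y) ord0; rewrite !mxE.
apply: norm_rV_lt => // i; rewrite !mxE.
by apply: le_lt_trans xy; have := coord_le_norm (x - y) (lift ord0 i); rewrite !mxE.
Qed.

(** A product R x R^n is R^{n+1} up to the measurable homeomorphism row_cons,
    so its Borel and product sigma-algebras also agree. *)
Lemma continuous_measurable_prod n (f : R * 'rV[R]_n -> R) :
  continuous f -> measurable_fun setT (f : measurableTypeR R * 'rV[R]_n -> R).
Proof.
move=> cf.
rewrite (_ : f = (f \o @row_behead R n) \o @row_cons R n); last first.
  by apply/funext => x; rewrite /= row_consK.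
apply: measurableT_comp; last exact: measurable_row_cons.
apply: continuous_measurable_rV => x.
exact: (continuous_comp (@continuous_row_behead n x) (cf _)).
Qed.

End measurability_rV.

(** * Integration on R^n: Tonelli and affine changes of variables *)

Section integration_rV.
Context {R : realType}.
Local Notation leb := (@lebesgue_measure R).
Local Open Scope ereal_scope.

Lemma ge0_integral_rVS n (f : 'rV[R]_n.+1 -> \bar R) :
  measurable_fun setT f -> (forall x, 0 <= f x) ->
  \int[lebesgue_rV n.+1]_x f x =
  \int[leb]_a \int[lebesgue_rV n]_b f (row_cons (a, b)).
Proof.
move=> mf f0.
transitivity (\int[leb \x lebesgue_rV n]_x (f \o @row_cons R n) x).
  by rewrite -(ge0_integral_pushforward (@measurable_row_cons R n) (leb \x lebesgue_rV n)%E measurableT).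
rewrite fubini_tonelli1// => [|x].
  by apply: measurableT_comp => //; exact: measurable_row_cons.
exact: f0.
Qed.

(** The scaled image of Lebesgue measure under z |-> x + c z agrees with Lebesgue
    measure on intervals, hence everywhere by uniqueness. *)
Lemma ge0_integral_affine (x c : R) (f : R -> \bar R) : (0 < c)%R ->
  measurable_fun setT f -> (forall z, 0 <= f z) ->
  c%:E * \int[leb]_z f (x + c * z)%R = \int[leb]_z f z.
Proof.
move=> c0 mf f0.
pose phi := (fun z => x + c * z)%R : measurableTypeR R -> measurableTypeR R.
have mphi : measurable_fun setT phi.
  by apply: measurable_funD => //; exact: measurable_funM.
pose mu : {measure set (measurableTypeR R) -> \bar R} :=
  measure_function_pushforward__canonical__measure_function_Measure leb mphi.
pose cn := NngNum (ltW c0).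
transitivity (\int[mscale cn mu]_z f z).
  rewrite ge0_integral_mscale//; congr (_ * _).
  by rewrite (ge0_integral_pushforward mphi leb measurableT mf (fun y _ => f0 y)) preimage_setT.
apply: eq_measure_integral => A mA _; apply/esym/lebesgue_measure_unique => //.
move=> _ [[a b] _ <-] /=; rewrite /mscale/= /mu/= /pushforward.
rewrite (_ : phi @^-1` _ = `](a - x) / c, (b - x) / c]%classic)%R; last first.
  apply/seteqP; split => z; rewrite /= !in_itv/= ltr_pdivrMr// ler_pdivlMr// /phi.
    by move=> /andP[? ?]; apply/andP; split; lra.
  by move=> /andP[? ?]; apply/andP; split; lra.
rewrite !lebesgue_measure_itv/= !lte_fin ltr_pM2r ?invr_gt0// ltrD2r.
case: ifPn => _; last by rewrite mule0.
by rewrite -!EFinB -EFinM; congr EFin; field; rewrite gt_eqF.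
Qed.

Lemma row_cons_affine n (x : 'rV[R]_n.+1) (c a : R) (b : 'rV[R]_n) :
  (x + c *: row_cons (a, b) =
   row_cons (x ord0 ord0 + c * a, \row_j x ord0 (lift ord0 j) + c *: b))%R.
Proof.
apply/rowP => i; rewrite !mxE; case: (unliftP ord0 i) => [j|] ->/=.
  by rewrite !mxE.
by [].
Qed.

Lemma measurable_affine_rV n (x : 'rV[R]_n) (c : R) :
  measurable_fun setT (fun z : 'rV[R]_n => x + c *: z)%R.
Proof.
apply: measurable_fun_coordP => i.
under eq_fun do rewrite !mxE.
apply: measurable_funD => //; apply: measurable_funM => //.
exact: measurable_coord.
Qed.

Lemma ge0_integral_affine_rV n (x : 'rV[R]_n) (c : R) (f : 'rV[R]_n -> \bar R) :
  (0 < c)%R -> measurable_fun setT f -> (forall z, 0 <= f z) ->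
  (c ^+ n)%:E * \int[lebesgue_rV n]_z f (x + c *: z)%R = \int[lebesgue_rV n]_z f z.
Proof.
move=> c0; elim: n x f => [|n IH] x f mf f0.
  rewrite expr0 mul1e; apply: eq_integral => z _.
  by congr f; apply/rowP; case.
have mfa : measurable_fun setT (fun z : 'rV[R]_n.+1 => f (x + c *: z)%R).
  by apply: measurableT_comp => //; exact: measurable_affine_rV.
have mrc (a : R) : measurable_fun setT (fun b : 'rV[R]_n => row_cons (a, b)).
  apply: (@measurableT_comp _ _ _ _ _ _ (@row_cons R n)) => //.
  exact: measurable_row_cons.
have mg : measurable_fun setT (fun a => \int[lebesgue_rV n]_b f (row_cons (a, b))).
  apply: (@measurable_fun_fubini_tonelli_F _ _ _ _ _ (lebesgue_rV n)
    (f \o @row_cons R n)) => [|z]; last exact: f0.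
  by apply: measurableT_comp => //; exact: measurable_row_cons.
rewrite !ge0_integral_rVS//.
pose F a := \int[lebesgue_rV n]_b f (row_cons (a, b)).
have F0 a : 0 <= F a by exact: integral_ge0.
(* The n-dimensional change of variables is made first, inside the integral over
   the first coordinate. *)
transitivity ((c ^+ n.+1)%:E * \int[leb]_a (((c ^+ n)^-1)%:E * F (x ord0 ord0 + c * a)%R)).
  congr (_ * _); apply: eq_integral => a _.
  rewrite /F -(IH (\row_j x ord0 (lift ord0 j))
    (fun b => f (row_cons ((x ord0 ord0 + c * a)%R, b))))//; last first.
    exact: (measurableT_comp mf (mrc _)).
  rewrite muleA -EFinM mulVf ?mul1e; last by rewrite expf_neq0// gt_eqF.
  by apply: eq_integral => b _; rewrite row_cons_affine.
have cn0 : (0 < c ^+ n)%R by rewrite exprn_gt0.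
rewrite ge0_integralZl//; last 2 first.
- apply: (@measurableT_comp _ _ _ _ _ _ F) => //.
  by apply: measurable_funD => //; exact: measurable_funM.
- by rewrite lee_fin invr_ge0 ltW.
rewrite muleA -EFinM exprS mulfK ?gt_eqF//.
exact: ge0_integral_affine.
Qed.

End integration_rV.

(** * The Gaussian kernel *)

Section gaussian.
Context {R : realType}.

Lemma heat_kernel_gt0 n t (z : 'rV[R]_n) : 0 < t -> 0 < heat_kernel t z.
Proof.
move=> t0; rewrite mulr_gt0// ?expR_gt0//.
by rewrite powR_gt0// mulr_gt0// mulr_gt0// pi_gt0.
Qed.

Lemma continuous_heat_kernel n t : continuous (heat_kernel t : 'rV[R]_n -> R).
Proof.
have csum : continuous (fun x : 'rV[R]_n => \sum_(i < n) x ord0 i ^+ 2).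
  apply: continuous_big => [|i _]; first exact: add_continuous.
  move=> x; apply: (@continuous_comp _ _ _ (fun x : 'rV[R]_n => x ord0 i) (fun y => y ^+ 2)).
    exact: coord_continuous.
  exact: exprn_continuous.
pose h (x : 'rV[R]_n) := - (\sum_(i < n) x ord0 i ^+ 2).
have ch : continuous (fun x => h x / (4 * t)).
  move=> x; apply: (@continuousM R _ h (fun=> (4 * t)^-1) x); last exact: cst_continuous.
  by apply: (@continuousN R) => //; exact: csum.
move=> x.
apply: (@continuousM R _ (fun=> (4 * pi * t) `^ (- (n%:R / 2)))
  (fun x => expR (h x / (4 * t))) x); first exact: cst_continuous.
by apply: (@continuous_comp _ _ _ _ expR); [exact: ch|exact: continuous_expR].
Qed.

Lemma measurable_heat_kernel n t : measurable_fun setT (heat_kernel t : 'rV[R]_n -> R).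
Proof. by apply: continuous_measurable_rV; exact: continuous_heat_kernel. Qed.

(** At time 1 the kernel is a product of normal densities of variance 2, so its
    total mass can be computed one coordinate at a time. *)
Lemma heat_kernel1_row_cons n (a : R) (b : 'rV[R]_n) :
  heat_kernel 1 (row_cons (a, b)) =
  normal_pdf 0 (Num.sqrt 2) a * heat_kernel 1 b.
Proof.
have pi0 := pi_gt0 R.
rewrite normal_pdfE; last by rewrite sqrtr_eq0 -ltNge.
rewrite /heat_kernel /normal_peak /normal_fun !sqr_sqrtr// subr0 !mulr1.
rewrite big_ord_recl mxE unlift_none /=.
under eq_bigr do rewrite mxE liftK /=.
set S := (\sum_(i < n) _).
have -> : - (a ^+ 2 + S) / 4 = - a ^+ 2 / 4 + - S / 4 by ring.
have -> : - (n.+1%:R / 2) = - 2^-1 + - (n%:R / 2) :> R by rewrite -natr1; field.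
have -> : 2 * pi *+ 2 = 4 * pi :> R by ring.
have -> : 2 *+ 2 = 4 :> R by ring.
rewrite expRD powRD; last by apply/implyP => _; rewrite mulf_neq0// gt_eqF.
rewrite [in X in X * _ * _ = _]powRN powR12_sqrt; last by rewrite mulr_ge0// ltW.
by ring.
Qed.

Lemma integral_heat_kernel1 n :
  (\int[lebesgue_rV n]_z (heat_kernel 1 (z : 'rV[R]_n))%:E = 1)%E.
Proof.
have mk m : measurable_fun setT (fun z : 'rV[R]_m => (heat_kernel 1 z)%:E).
  by apply/measurable_EFinP; exact: measurable_heat_kernel.
have k0 m (z : 'rV[R]_m) : (0 <= (heat_kernel 1 z)%:E)%E.
  by rewrite lee_fin ltW// heat_kernel_gt0.
elim: n => [|n IH].
  rewrite /= integral_dirac//; last exact: mk.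
  rewrite diracT mul1e /heat_kernel big_ord0 oppr0 !mul0r.
  by rewrite oppr0 powRr0 expR0 mulr1.
rewrite ge0_integral_rVS//.
under eq_integral => a _.
  under eq_integral do rewrite heat_kernel1_row_cons EFinM.
  rewrite ge0_integralZl//=; [|exact: mk|by rewrite lee_fin normal_pdf_ge0].
  rewrite IH mule1.
  over.
exact: integral_normal_pdf.
Qed.

End gaussian.

Section gaussian_expectation.
Context {R : realType} {N : nat}.
Implicit Types phi psi : 'rV[R]_N -> R.
Local Notation mu := (lebesgue_rV N).

(** Expectation under the law with density heat_kernel 1, that is N independent
    centred normal variables of variance 2. *)
Definition gaussE phi := \int[mu]_z (heat_kernel 1 z * phi z).

Lemma integrable_heat_kernel1 : mu.-integrable setT (fun z : 'rV[R]_N => (heat_kernel 1 z)%:E).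
Proof.
apply/integrableP; split; first by apply/measurable_EFinP; exact: measurable_heat_kernel.
under eq_integral do rewrite gee0_abs ?lee_fin ?ltW ?heat_kernel_gt0//.
by rewrite integral_heat_kernel1 ltry.
Qed.

Lemma integrable_gauss phi (M : R) : measurable_fun setT phi ->
  (forall z, `|phi z| <= M) ->
  mu.-integrable setT (EFin \o (fun z => heat_kernel 1 z * phi z)).
Proof.
move=> mphi phiM.
apply: (@le_integrable _ _ _ _ _ _ _ (fun z => (M * heat_kernel 1 z)%:E)) => //.
- apply/measurable_EFinP; apply: measurable_funM => //.
  exact: measurable_heat_kernel.
- move=> z _ /=; rewrite lee_fin !normrM mulrC ler_wpM2r//.
  by rewrite (le_trans (phiM z))// ler_norm.
- under eq_fun do rewrite EFinM.
  by apply: integrableZl => //; exact: integrable_heat_kernel1.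
Qed.

Lemma gaussEB phi psi (M K : R) : measurable_fun setT phi -> measurable_fun setT psi ->
  (forall z, `|phi z| <= M) -> (forall z, `|psi z| <= K) ->
  gaussE (phi \- psi) = gaussE phi - gaussE psi.
Proof.
move=> mphi mpsi phiM psiM; rewrite /gaussE -RintegralB//.
- by apply: eq_Rintegral => z _; rewrite mulrBr.
- exact: integrable_gauss phiM.
- exact: integrable_gauss psiM.
Qed.

Lemma le_gaussE phi psi (M K : R) : measurable_fun setT phi -> measurable_fun setT psi ->
  (forall z, `|phi z| <= M) -> (forall z, `|psi z| <= K) ->
  (forall z, phi z <= psi z) -> gaussE phi <= gaussE psi.
Proof.
move=> mphi mpsi phiM psiM le; apply: le_Rintegral => //.
- exact: integrable_gauss phiM.
- exact: integrable_gauss psiM.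
- by move=> z _; rewrite ler_wpM2l// ltW// heat_kernel_gt0.
Qed.

Lemma gaussE_cst c : gaussE (fun=> c) = c.
Proof.
rewrite /gaussE RintegralZr//; last exact: integrable_heat_kernel1.
by rewrite /Rintegral integral_heat_kernel1 mul1r.
Qed.

Lemma norm_gaussE_le phi M : measurable_fun setT phi ->
  (forall z, `|phi z| <= M) -> `|gaussE phi| <= M.
Proof.
move=> mphi phiM.
have cM z : `|(fun=> M) z : R| <= `|M| by [].
rewrite ler_norml; apply/andP; split.
  rewrite -[leLHS](gaussE_cst (- M)).
  apply: (le_gaussE (M := `|M|) (K := M)) => //; first by move=> z; rewrite normrN.
  by move=> z; have := phiM z; rewrite ler_norml => /andP[].
rewrite -[leRHS](gaussE_cst M).
apply: (le_gaussE (M := M) (K := `|M|)) => //.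
by move=> z; have := phiM z; rewrite ler_norml => /andP[].
Qed.

Lemma measurable_norm_rV : measurable_fun setT (fun z : 'rV[R]_N => `|z|).
Proof. by apply: continuous_measurable_rV; exact: norm_continuous. Qed.

Lemma measurable_norm_gt A : measurable [set z : 'rV[R]_N | A < `|z|].
Proof.
rewrite (_ : [set _ | _] = (fun z : 'rV[R]_N => `|z|) @^-1` `]A, +oo[); last first.
  by apply/seteqP; split => z; rewrite /= in_itv/= andbT.
by rewrite -[X in measurable X]setTI; exact: measurable_norm_rV.
Qed.

(** Dominated convergence, as the indicators of the exteriors of growing balls
    tend to 0. *)
Lemma gauss_tail (e : R) : 0 < e -> exists2 A, 0 < A &
  gaussE \1_[set z | A < `|z|] <= e.
Proof.
move=> e0.
pose f n (z : 'rV[R]_N) := (heat_kernel 1 z * \1_[set z | n.+1%:R < `|z|] z)%:E.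
have mf n : measurable_fun setT (f n).
  apply/measurable_EFinP; apply: measurable_funM.
    exact: measurable_heat_kernel.
  by apply: measurable_indic; exact: measurable_norm_gt.
have /fine_cvgP[_] : (\int[mu]_z f n z)%E @[n --> \oo] --> (0:R)%:E.
  rewrite (_ : 0%:E = \int[mu]_z (cst 0 z))%E; last by rewrite integral0.
  apply: (@dominated_cvg _ _ _ mu setT measurableT f (cst 0%E) (fun z => (heat_kernel 1 z)%:E)) => //.
  - move=> z _; apply: cvg_near_cst.
    near=> n; rewrite /f indicE memNset ?mulr0//=; apply/negP; rewrite -leNgt.
    rewrite (@le_trans _ _ n%:R)// ?ler_nat//.
    by near: n; exact: nbhs_infty_ger.
  - exact: integrable_heat_kernel1.
  - move=> n z _; rewrite /f /= lee_fin normrM (gtr0_norm (heat_kernel_gt0 z ltr01)).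
    rewrite ler_piMr//; first by rewrite ltW// heat_kernel_gt0.
    by rewrite indicE; case: (_ \in _); rewrite ?normr1 ?normr0.
move=> /cvgrPdist_le /(_ _ e0)[n _ /(_ _ (leqnn n))] /=.
rewrite sub0r normrN => h; exists n.+1%:R => //.
by apply: le_trans h; exact: ler_norm.
Unshelve. all: by end_near. Qed.

(** All continuity and decay estimates for the heat flow come from this splitting
    into a ball that carries almost all the Gaussian mass and a negligible tail. *)
Lemma norm_gaussE_split phi M d e A : measurable_fun setT phi ->
  0 <= d -> (forall z, `|phi z| <= M) -> (forall z, `|z| <= A -> `|phi z| <= d) ->
  gaussE \1_[set z : 'rV[R]_N | A < `|z|] <= e ->
  `|gaussE phi| <= d + M * e.
Proof.
move=> mphi d0 phiM phid tail.
have M0 : 0 <= M by rewrite (le_trans _ (phiM 0)).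
have mI : measurable_fun setT (\1_[set z : 'rV[R]_N | A < `|z|] : _ -> R).
  by apply: measurable_indic; exact: measurable_norm_gt.
have I1 z : `|\1_[set z : 'rV[R]_N | A < `|z|] z : R| <= 1.
  by rewrite indicE; case: (_ \in _); rewrite ?normr1 ?normr0.
pose psi (z : 'rV[R]_N) : R := d - - M * \1_[set z : 'rV[R]_N | A < `|z|] z.
have mpsi : measurable_fun setT psi.
  by apply: measurable_funB => //; exact: measurable_funM.
have MI z : `|- M * \1_[set z : 'rV[R]_N | A < `|z|] z| <= M.
  by rewrite normrM normrN (ger0_norm M0) ler_piMr.
have psiM z : `|psi z| <= d + M.
  by rewrite (le_trans (ler_normB _ _))// lerD// ger0_norm.
have le z : `|phi z| <= psi z.
  rewrite /psi indicE mulNr opprK; have [zA|zA] := leP `|z| A.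
    rewrite memNset ?mulr0 ?addr0 ?phid//=.
    by apply/negP; rewrite -leNgt.
  by rewrite mem_set//= mulr1 (le_trans (phiM z))// lerDr.
have -> : d + M * e = d - - M * e by ring.
have : gaussE psi <= d - - M * e.
  rewrite /psi [leLHS](gaussEB (phi := fun=> d) (M := d) (K := M)) => //; last 2 first.
  - by apply: measurable_funM.
  - by move=> _; rewrite ger0_norm.
  rewrite gaussE_cst lerB// /gaussE; under eq_Rintegral do rewrite mulrCA.
  rewrite RintegralZl//; last exact: (integrable_gauss mI I1).
  by rewrite ler_wnM2l ?oppr_le0.
apply: le_trans; rewrite ler_norml; apply/andP; split.
  rewrite lerNl -[leLHS]sub0r -(gaussE_cst 0).
  rewrite -(gaussEB (M := 0) (K := M))//; last by rewrite normr0.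
  apply: (le_gaussE (M := M) (K := d + M)) => //.
  + by apply: measurable_funB.
  + by move=> z; rewrite /= sub0r normrN.
  + by move=> z; rewrite /= sub0r (le_trans _ (le z))// -normrN ler_norm.
by apply: (le_gaussE (M := M) (K := d + M)) => // z; rewrite (le_trans _ (le z))// ler_norm.
Qed.

End gaussian_expectation.

(** * The heat semigroup as a Gaussian average *)

Section affine_change.
Context {R : realType}.
Local Open Scope ereal_scope.

Lemma integral_affine_rV n (x : 'rV[R]_n) (c : R) (f : 'rV[R]_n -> \bar R) :
  (0 < c)%R -> measurable_fun setT f ->
  \int[lebesgue_rV n]_z ((c ^+ n)%:E * f (x + c *: z)%R) = \int[lebesgue_rV n]_z f z.
Proof.
move=> c0 mf.
have cn0 : (0 <= c ^+ n)%R by rewrite exprn_ge0// ltW.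
have maff (g : 'rV[R]_n -> \bar R) : measurable_fun setT g ->
    measurable_fun setT (fun z : 'rV[R]_n => g (x + c *: z)%R).
  by move=> mg; apply: measurableT_comp => //; exact: measurable_affine_rV.
have ge0 (g : 'rV[R]_n -> \bar R) : measurable_fun setT g -> (forall z, 0 <= g z) ->
    \int[lebesgue_rV n]_z ((c ^+ n)%:E * g (x + c *: z)%R) = \int[lebesgue_rV n]_z g z.
  move=> mg g0; rewrite -[RHS](ge0_integral_affine_rV x c0 mg g0).
  by rewrite ge0_integralZl//; exact: maff.
rewrite integralE [RHS]integralE -(ge0 f^\+)//; last exact: measurable_funepos.
rewrite -(ge0 f^\-)//; last exact: measurable_funeneg.
pose fa z := f (x + c *: z)%R.
rewrite (ge0_funeposM fa cn0) (ge0_funenegM fa cn0).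
by congr (_ - _); apply: eq_integral => z _; rewrite ?funeposE ?funenegE.
Qed.
End affine_change.

Section heat_flow.
Context {R : realType} {N : nat}.
Implicit Types (f : 'rV[R]_N -> R).

(** The convolution with the heat kernel after the substitution y = x + sqrt t z:
    the Gaussian weight no longer depends on t, so regularity in time and in space
    are both read off from f. As Num.sqrt vanishes on negative numbers, the
    formula also extends the flow by the identity to t <= 0. *)
Definition heat (t : R) f : 'rV[R]_N -> R :=
  fun x => gaussE (fun z => f (x + Num.sqrt t *: z)).

Lemma heat_le0 t f x : t <= 0 -> heat t f x = f x.
Proof.
move=> t0; rewrite /heat ler0_sqrtr// -[RHS](@gaussE_cst R N); congr gaussE.
by apply/funext => z; rewrite scale0r addr0.
Qed.

Lemma heat_kernel_scale t (z : 'rV[R]_N) : 0 < t ->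
  Num.sqrt t ^+ N * heat_kernel t (- (Num.sqrt t *: z)) = heat_kernel 1 z.
Proof.
move=> t0; have pi0 := pi_gt0 R; rewrite /heat_kernel mulr1 mulrA; congr (_ * _).
  rewrite powRM ?ltW// ?mulr_gt0// mulrCA -[RHS]mulr1; congr (_ * _).
  rewrite -powR12_sqrt ?ltW// -powR_mulrn ?powR_ge0// -powRrM -powRD.
    by rewrite mulrC subrr powRr0.
  by rewrite mulrC subrr eqxx/= gt_eqF.
congr expR; rewrite mulr1.
under eq_bigr do rewrite !mxE sqrrN exprMn sqr_sqrtr ?ltW//.
by rewrite -mulr_sumr; field; rewrite gt_eqF.
Qed.

Lemma heat_semigroupE t f x : 0 <= t -> continuous f ->
  heat_semigroup t f x = heat t f x.
Proof.
move=> t0 cf; rewrite /heat_semigroup; have [->|tn0] := eqVneq t 0.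
  by rewrite heat_le0.
have {}t0 : 0 < t by rewrite lt_neqAle eq_sym tn0.
rewrite /heat /gaussE /Rintegral; congr fine.
rewrite -(@integral_affine_rV _ _ x (Num.sqrt t)) ?sqrtr_gt0//.
  apply: eq_integral => z _; rewrite -EFinM; congr EFin.
  by rewrite opprD addNKr mulrA heat_kernel_scale.
apply/measurable_EFinP; apply: measurable_funM; last exact: continuous_measurable_rV.
apply: continuous_measurable_rV => y.
apply: (@continuous_comp 'rV[R]_N 'rV[R]_N R (fun y => x - y) (heat_kernel t) y).
  by apply: (@continuousB R 'rV[R]_N 'rV[R]_N (fun=> x) id) => //; exact: cst_continuous.
exact: continuous_heat_kernel.
Qed.

End heat_flow.

(** * The space C_0 and curves in it *)

Section compact_uniform.
Context {R : realType}.

(** The covering argument shared by Heine-Cantor (P d x: d is a modulus of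
    continuity at x), boundedness (1/d is a bound) and uniform decay (1/d is a
    radius). *)
Lemma compact_uniform (V : normedModType R) (K : set V) (P : R -> V -> Prop) :
  compact K -> (forall d d' x, 0 < d' -> d' <= d -> P d x -> P d' x) ->
  (forall x, K x -> exists2 d, 0 < d & forall x', `|x' - x| < d -> P d x') ->
  exists2 d, 0 < d & forall x, K x -> P d x.
Proof.
move=> /compact_near_coveringP cK Pmono Ploc.
have near_P : \forall d \near (0:R)^'+, K `<=` P d.
  apply: cK => x Kx; have [d d0 Pd] := Ploc _ Kx.
  exists (ball x d, [set d' | 0 < d' <= d]); last first.
    move=> [x' d'] [/= xx' /andP[d'0 d'd]]; apply: Pmono d'0 d'd _.
    by apply: Pd; rewrite distrC; move: xx'; rewrite -ball_normE.
  split => /=; first exact: nbhsx_ballx.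
  near=> d'; apply/andP; split.
    by near: d'; exact: nbhs_right_gt.
  by near: d'; exact: nbhs_right_le.
near (0:R)^'+ => d; exists d; first by near: d; exact: nbhs_right_gt.
by move=> x Kx; apply: (near near_P d).
Unshelve. all: by end_near. Qed.

Lemma continuousP_dist (V W : normedModType R) (f : V -> W) :
  continuous f <->
  forall x e, 0 < e -> exists2 d, 0 < d & forall y, `|y - x| < d -> `|f y - f x| <= e.
Proof.
split => [cf x e e0|H x].
  have /cvgrPdist_le /(_ e e0) /nbhs_ballP[d d0 hd] := cf x.
  by exists d => // y yx; rewrite distrC; apply: hd; rewrite -ball_normE/= distrC.
apply/cvgrPdist_le => e e0; have [d d0 hd] := H x e e0.
apply/nbhs_ballP; exists d => // y; rewrite -ball_normE/= => xy.
by rewrite distrC; apply: hd; rewrite distrC.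
Qed.

Lemma compact_closed_ball_rV n (A : R) : compact [set x : 'rV[R]_n | `|x| <= A].
Proof.
apply: bounded_closed_compact.
  by exists A; split; [exact: num_real|move=> B AB x /= xA; rewrite (le_trans xA)// ltW].
rewrite (_ : [set _ | _] = (fun x : 'rV[R]_n => `|x|) @^-1` [set r | r <= A])//.
by apply: preimage_closed => [x _|]; [exact: norm_continuous|exact: closed_le].
Qed.

End compact_uniform.

Section C0_theory.
Context {R : realType} {N : nat}.
Implicit Types (f g : 'rV[R]_N -> R).

Lemma C0_continuous f : C0 f -> continuous f. Proof. by case. Qed.

Lemma C0_decay f e : C0 f -> 0 < e ->
  exists2 A, 0 < A & forall x, A < `|x| -> `|f x| <= e.
Proof.
move=> [_ /[apply]] [M hM]; exists (`|M| + 1); first by rewrite ltr_wpDl.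
move=> x Mx; apply/ltW/hM; apply: le_lt_trans Mx.
by rewrite (le_trans (ler_norm M))// lerDl.
Qed.

Lemma C0_bounded f : C0 f -> exists2 M, 0 < M & forall x, `|f x| <= M.
Proof.
move=> f0; have [A A0 fA] := C0_decay f0 ltr01.
have [d d0 fd] : exists2 d, 0 < d & forall x, `|x| <= A -> `|f x| <= d^-1.
  apply: (compact_uniform (P := fun d x => `|f x| <= d^-1)
    (compact_closed_ball_rV (n := N) (A := A))).
    by move=> d d' x d'0 d'd /le_trans; apply; rewrite lef_pV2// posrE (lt_le_trans d'0).
  move=> x xA; have /continuousP_dist /(_ x 1 ltr01)[d d0 hd] := C0_continuous f0.
  have fx0 : 0 < `|f x| + 1 by rewrite ltr_wpDl.
  have d'0 : 0 < Num.min d (`|f x| + 1)^-1 by rewrite lt_min d0 invr_gt0.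
  exists (Num.min d (`|f x| + 1)^-1) => // y; rewrite {1}lt_min => /andP[yd _].
  apply: (@le_trans _ _ (`|f x| + 1)).
    by rewrite -lerBlDl (le_trans (lerB_dist _ _))// hd.
  by rewrite -[leLHS]invrK lef_pV2 ?posrE ?invr_gt0// ge_min lexx orbT.
exists (d^-1 + 1); first by rewrite addr_gt0// invr_gt0.
move=> x; have [xA|Ax] := leP `|x| A.
  by rewrite (le_trans (fd _ xA))// lerDl.
by rewrite (le_trans (fA _ Ax))// lerDr invr_ge0 ltW.
Qed.

(** Compactness handles the ball of radius A + 1; two points at distance less than
    1, one of them outside that ball, both lie where f is below e / 2. *)
Lemma C0_unif_continuous f e : C0 f -> 0 < e ->
  exists2 d, 0 < d & forall x y, `|x - y| < d -> `|f x - f y| <= e.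
Proof.
move=> f0 e0; have e20 : 0 < e / 2 by rewrite divr_gt0.
have [A A0 fA] := C0_decay f0 e20.
have [d d0 hd] : exists2 d, 0 < d & forall x, `|x| <= A + 1 ->
    forall y, `|x - y| < d -> `|f x - f y| <= e.
  apply: (compact_uniform (P := fun d x => forall y, `|x - y| < d -> `|f x - f y| <= e)
    (compact_closed_ball_rV (n := N) (A := A + 1))).
    by move=> d d' x d'0 d'd H y yd; apply: H; exact: lt_le_trans d'd.
  move=> x xA; have /continuousP_dist /(_ x _ e20)[d d0 hd] := C0_continuous f0.
  exists (d / 2); first by rewrite divr_gt0.
  move=> x' x'x y yx'; rewrite (splitr e) (le_trans (ler_distD (f x) _ _))// lerD//.
    by apply: hd; rewrite (lt_trans x'x)// ltr_pdivrMr// ltr_pMr// ltr1n.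
  rewrite distrC; apply: hd; rewrite (le_lt_trans (ler_distD x' _ _))//.
  by rewrite (splitr d) ltrD// distrC.
exists (Num.min d 1); first by rewrite lt_min d0 ltr01.
move=> x y; rewrite lt_min => /andP[xyd xy1].
have [xA|Ax] := leP `|x| (A + 1); first exact: hd.
rewrite (le_trans (ler_normB _ _))// (splitr e) lerD// fA//.
  by rewrite (le_lt_trans _ Ax)// lerDl.
have := lerB_dist x y; move: Ax xy1; set a := `|x|; set b := `|y|; set c := `|x - y|.
by lra.
Qed.

Lemma C0_comp f (phi : R -> R) : C0 f -> continuous phi -> phi 0 = 0 -> C0 (phi \o f).
Proof.
move=> f0 cphi phi0; split.
  move=> x; apply: continuous_comp; [exact: C0_continuous|exact: cphi].
move=> e e0; have /continuousP_dist /(_ 0 (e / 2))[|d d0 hd] := cphi.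
  by rewrite divr_gt0.
have [A A0 fA] := C0_decay f0 (divr_gt0 d0 (ltr0n R 2)).
exists A => x /fA fx; apply: (@le_lt_trans _ _ (e / 2)).
  have := hd (f x); rewrite phi0 !subr0; apply.
  by rewrite (le_lt_trans fx)// ltr_pdivrMr// ltr_pMr// ltr1n.
by rewrite ltr_pdivrMr// ltr_pMr// ltr1n.
Qed.

Lemma C0_uniform_limit f : (forall e, 0 < e -> exists2 g, C0 g &
  forall x, `|f x - g x| <= e) -> C0 f.
Proof.
move=> H; split.
  apply/continuousP_dist => x e e0.
  have e30 : 0 < e / 3 by rewrite divr_gt0.
  have [g g0 fg] := H _ e30.
  have /continuousP_dist /(_ x _ e30)[d d0 hd] := C0_continuous g0.
  exists d => // y yx; have := hd _ yx; have := fg x; have := fg y.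
  by rewrite !ler_norml; lra.
move=> e e0; have e30 : 0 < e / 3 by rewrite divr_gt0.
have [g g0 fg] := H _ e30; have [A A0 gA] := C0_decay g0 e30.
exists A => x /gA; have := fg x; rewrite !ler_norml ltr_norml; lra.
Qed.

Lemma C0_cst0 : C0 (fun _ : 'rV[R]_N => 0 : R).
Proof.
by split; [exact: cst_continuous|move=> e e0; exists 0 => x _; rewrite normr0].
Qed.

Lemma C0_lin (a b : R) f g : C0 f -> C0 g -> C0 (fun x => a * f x + b * g x).
Proof.
move=> f0 g0; split.
  move=> x; apply: (@continuousD _ _ _ (fun x => a * f x) (fun x => b * g x)).
    by apply: (@continuousM R _ (fun=> a) f); [exact: cst_continuous|exact: C0_continuous].
  by apply: (@continuousM R _ (fun=> b) g); [exact: cst_continuous|exact: C0_continuous].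
move=> e e0; pose c := e / (`|a| + `|b| + 1).
have d0 : 0 < `|a| + `|b| + 1 by rewrite ltr_wpDl// addr_ge0.
have c0 : 0 < c by rewrite divr_gt0.
have [A A0 fA] := C0_decay f0 c0; have [B B0 gB] := C0_decay g0 c0.
exists (Num.max A B) => x; rewrite gt_max => /andP[/fA fx /gB gx].
apply: (@le_lt_trans _ _ ((`|a| + `|b|) * c)).
  by rewrite (le_trans (ler_normD _ _))// !normrM mulrDl lerD// ler_wpM2l.
by rewrite /c mulrCA gtr_pMr// ltr_pdivrMr// mul1r ltrDl.
Qed.

End C0_theory.

Section curves.
Context {R : realType} {N : nat}.
Implicit Types (h : R -> 'rV[R]_N -> R).

(** Curves in C_0 parametrised by the whole line, so that no relative
    topology on a time interval has to be carried around. *)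
Definition C0_curve h := (forall t, C0 (h t)) /\
  forall t e, 0 < e -> exists2 d, 0 < d &
    forall s, `|s - t| < d -> forall x, `|h s x - h t x| <= e.

Lemma C0_curve_cst (f : 'rV[R]_N -> R) : C0 f -> C0_curve (fun=> f).
Proof.
by move=> f0; split => // t e e0; exists 1 => // s _ x; rewrite subrr normr0 ltW.
Qed.

Lemma C0_curve_bounded h T : C0_curve h ->
  exists2 M, 0 < M & forall s, 0 <= s <= T -> forall x, `|h s x| <= M.
Proof.
move=> [h0 ch].
have [d d0 hd] : exists2 d, 0 < d & forall s : R, `[0, T]%classic s -> forall x, `|h s x| <= d^-1.
  apply: (compact_uniform (P := fun d s => forall x, `|h s x| <= d^-1)
      (@segment_compact R 0 T)).
    move=> d d' s d'0 d'd H x; apply: le_trans (H x) _.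
    by rewrite lef_pV2// posrE (lt_le_trans d'0).
  move=> s _; have [M M0 hM] := C0_bounded (h0 s).
  have [d d0 hd] := ch s 1 ltr01.
  have M10 : 0 < M + 1 by rewrite addr_gt0.
  have d'0 : 0 < Num.min d (M + 1)^-1 by rewrite lt_min d0 invr_gt0.
  exists (Num.min d (M + 1)^-1) => // s'; rewrite {1}lt_min => /andP[sd _] x.
  apply: (@le_trans _ _ (M + 1)).
    by have := hd _ sd x; have := hM x; rewrite !ler_norml; lra.
  by rewrite -[leLHS]invrK lef_pV2 ?posrE ?invr_gt0// ge_min lexx orbT.
by exists d^-1; rewrite ?invr_gt0// => s sT x; apply: hd; rewrite /= in_itv.
Qed.

Lemma C0_curve_equicontinuous h T e : C0_curve h -> 0 < e ->
  exists2 d, 0 < d & forall s, 0 <= s <= T ->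
    forall x y, `|x - y| < d -> `|h s x - h s y| <= e.
Proof.
move=> [h0 ch] e0; have e30 : 0 < e / 3 by rewrite divr_gt0.
have [d d0 hd] : exists2 d, 0 < d & forall s : R, `[0, T]%classic s ->
    forall x y, `|x - y| < d -> `|h s x - h s y| <= e.
  apply: (compact_uniform (P := fun d s => forall x y, `|x - y| < d -> `|h s x - h s y| <= e)
      (@segment_compact R 0 T)).
    by move=> d d' s d'0 d'd H x y yd; apply: H; exact: lt_le_trans d'd.
  move=> s _; have [d1 d10 hd1] := C0_unif_continuous (h0 s) e30.
  have [d d0 hd] := ch s _ e30.
  exists (Num.min d d1); first by rewrite lt_min d0.
  move=> s'; rewrite lt_min => /andP[sd _] x y; rewrite lt_min => /andP[_ xy].
  by have := hd _ sd x; have := hd _ sd y; have := hd1 _ _ xy; rewrite !ler_norml; lra.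
by exists d => // s sT; apply: hd; rewrite /= in_itv.
Qed.

Lemma C0_curve_tight h T e : C0_curve h -> 0 < e ->
  exists2 A, 0 < A & forall s, 0 <= s <= T ->
    forall x, A < `|x| -> `|h s x| <= e.
Proof.
move=> [h0 ch] e0; have e20 : 0 < e / 2 by rewrite divr_gt0.
have [d d0 hd] : exists2 d, 0 < d & forall s : R, `[0, T]%classic s ->
    forall x, d^-1 < `|x| -> `|h s x| <= e.
  apply: (compact_uniform (P := fun d s => forall x, d^-1 < `|x| -> `|h s x| <= e)
      (@segment_compact R 0 T)).
    move=> d d' s d'0 d'd H x xd; apply: H; apply: le_lt_trans xd.
    by rewrite lef_pV2// posrE (lt_le_trans d'0).
  move=> s _; have [A A0 hA] := C0_decay (h0 s) e20.
  have [d d0 hd] := ch s _ e20.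
  have d'0 : 0 < Num.min d A^-1 by rewrite lt_min d0 invr_gt0.
  exists (Num.min d A^-1) => // s'; rewrite {1}lt_min => /andP[sd _] x xA.
  have /hA : A < `|x|.
    apply: le_lt_trans xA.
    by rewrite -[leLHS]invrK lef_pV2 ?posrE ?invr_gt0// ge_min lexx orbT.
  by have := hd _ sd x; rewrite !ler_norml; lra.
by exists d^-1; rewrite ?invr_gt0// => s sT; apply: hd; rewrite /= in_itv.
Qed.

Lemma C0_curve_continuous2 h : C0_curve h ->
  continuous (fun z : R * 'rV[R]_N => h z.1 z.2).
Proof.
move=> [h0 ch]; apply/continuousP_dist => -[t x] e e0.
have e20 : 0 < e / 2 by rewrite divr_gt0.
have [d d0 hd] := ch t _ e20.
have [d1 d10 hd1] := C0_unif_continuous (h0 t) e20.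
exists (Num.min d d1); first by rewrite lt_min d0.
move=> [s y] /=; rewrite [`|_ - _|]/Num.norm/= gt_max !lt_min.
move=> /andP[/andP[sd _] /andP[_ yd]].
by have := hd _ sd y; have := hd1 _ _ yd; rewrite !ler_norml; lra.
Qed.

Lemma C0_curve_continuous h x : C0_curve h -> continuous (h ^~ x).
Proof.
move=> [_ ch]; apply/continuousP_dist => t e e0.
by have [d d0 hd] := ch t e e0; exists d => // s st; exact: hd.
Qed.

Lemma C0_curve_lin (a b : R) h g : C0_curve h -> C0_curve g ->
  C0_curve (fun t x => a * h t x + b * g t x).
Proof.
move=> [h0 ch] [g0 cg]; split=> [t|t e e0]; first exact: C0_lin.
pose c := e / (`|a| + `|b| + 1).
have d0 : 0 < `|a| + `|b| + 1 by rewrite ltr_wpDl// addr_ge0.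
have c0 : 0 < c by rewrite divr_gt0.
have [d1 d10 hd] := ch t c c0; have [d2 d20 gd] := cg t c c0.
exists (Num.min d1 d2); first by rewrite lt_min d10.
move=> s; rewrite lt_min => /andP[/hd hs /gd gs] x.
apply: (@le_trans _ _ ((`|a| + `|b|) * c)).
  rewrite (_ : _ - _ = a * (h s x - h t x) + b * (g s x - g t x)); last by ring.
  by rewrite (le_trans (ler_normD _ _))// !normrM mulrDl lerD// ler_wpM2l.
by rewrite /c mulrCA ler_piMr//; [exact: ltW|rewrite ler_pdivrMr// mul1r lerDl].
Qed.

(** The Lipschitz bound makes superposition by phi continuous for the sup norm,
    and phi 0 = 0 preserves the decay at infinity. *)
Lemma C0_curve_lipschitz (phi : R -> R) L h : (forall a b, `|phi a - phi b| <= L * `|a - b|) ->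
  phi 0 = 0 -> C0_curve h -> C0_curve (fun t x => phi (h t x)).
Proof.
move=> lphi phi0 [h0 ch].
have L0 : 0 <= L.
  by have := le_trans (normr_ge0 _) (lphi 1 0); rewrite subr0 normr1 mulr1.
have L10 : 0 < L + 1 by rewrite ltr_wpDl.
split => [t|t e e0].
  apply: (C0_comp (phi := phi)) => //; apply/continuousP_dist => x e e0.
  exists (e / (L + 1)); first by rewrite divr_gt0.
  move=> y yx; rewrite (le_trans (lphi _ _))//.
  rewrite (@le_trans _ _ ((L + 1) * (e / (L + 1))))//; last by rewrite mulrC divfK// gt_eqF.
  by apply: ler_pM => //; [rewrite lerDl|exact: ltW].
have [d d0 hd] := ch t (e / (L + 1)) (divr_gt0 e0 L10).
exists d => // s st x; rewrite (le_trans (lphi _ _))//.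
rewrite (@le_trans _ _ ((L + 1) * (e / (L + 1))))//; last by rewrite mulrC divfK// gt_eqF.
by apply: ler_pM => //; [rewrite lerDl|exact: hd].
Qed.

(** The approximating curve may depend on the time t around which the
    approximation holds, so that approximation on bounded time intervals suffices. *)
Lemma C0_curve_uniform_limit h : (forall e t, 0 < e -> exists g d, [/\ C0_curve g, 0 < d &
  forall s, `|s - t| < d -> forall x, `|h s x - g s x| <= e]) -> C0_curve h.
Proof.
move=> H; split => [t|t e e0].
  apply: C0_uniform_limit => e e0; have [g [d [[g0 _] d0 hg]]] := H e t e0.
  by exists (g t) => // x; apply: hg; rewrite subrr normr0.
have e30 : 0 < e / 3 by rewrite divr_gt0.
have [g [d [[_ cg] d0 hg]]] := H _ t e30; have [c c0 hc] := cg t _ e30.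
exists (Num.min d c); first by rewrite lt_min d0.
move=> s; rewrite lt_min => /andP[sd sc] x.
have tt : `|t - t| < d by rewrite subrr normr0.
by have := hg _ sd x; have := hg _ tt x; have := hc _ sc x; rewrite !ler_norml; lra.
Qed.

End curves.

(** * The heat flow of a curve *)

Lemma sqrt_dist (R : rcfType) (t s : R) : `|Num.sqrt t - Num.sqrt s| <= Num.sqrt `|t - s|.
Proof.
wlog st : t s / s <= t.
  move=> H; have [/H//|/ltW ts] := leP s t.
  by rewrite distrC (distrC t); exact: H.
rewrite ger0_norm ?subr_ge0 ?ler_wsqrtr// ger0_norm ?subr_ge0//.
have [s0|s0] := leP s 0.
  by rewrite (ler0_sqrtr s0) subr0 ler_wsqrtr// lerDl oppr_ge0.
rewrite lerBlDr -ler_sqr ?nnegrE ?addr_ge0 ?sqrtr_ge0//.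
have t0 : 0 <= t by rewrite (le_trans (ltW s0)).
rewrite sqrrD !sqr_sqrtr ?subr_ge0 ?(ltW s0)//.
by rewrite addrAC subrK lerDl mulrn_wge0// mulr_ge0// sqrtr_ge0.
Qed.

Section heat_estimates.
Context {R : realType} {N : nat}.
Implicit Types (f g : 'rV[R]_N -> R).

Lemma measurable_shift f t (x : 'rV[R]_N) : continuous f ->
  measurable_fun setT (fun z : 'rV[R]_N => f (x + Num.sqrt t *: z)).
Proof.
move=> cf; apply: (@measurableT_comp _ _ _ _ _ _ f).
  exact: continuous_measurable_rV.
exact: measurable_affine_rV.
Qed.

Lemma norm_heat_le f t x M : continuous f -> (forall y, `|f y| <= M) ->
  `|heat t f x| <= M.
Proof. by move=> cf fM; apply: norm_gaussE_le => [|z]; [exact: measurable_shift|]. Qed.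

Lemma le_heat f g t x : C0 f -> C0 g -> (forall y, f y <= g y) ->
  heat t f x <= heat t g x.
Proof.
move=> f0 g0 fg.
have [M _ fM] := C0_bounded f0; have [K _ gK] := C0_bounded g0.
by apply: (le_gaussE (M := M) (K := K)) => // ;
  apply: measurable_shift; exact: C0_continuous.
Qed.

Lemma heatB f g t x : C0 f -> C0 g ->
  heat t (f \- g) x = heat t f x - heat t g x.
Proof.
move=> f0 g0.
have [M _ fM] := C0_bounded f0; have [K _ gK] := C0_bounded g0.
by rewrite /heat -(gaussEB (M := M) (K := K))//; apply: measurable_shift; exact: C0_continuous.
Qed.

Lemma heat_dist f g t x M : C0 f -> C0 g -> (forall y, `|f y - g y| <= M) ->
  `|heat t f x - heat t g x| <= M.
Proof.
move=> f0 g0 fgM; rewrite -heatB//; apply: norm_heat_le => //.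
by move=> y; apply: continuousB; exact: C0_continuous.
Qed.

(** For |z| <= A the two Gaussian averages evaluate f at points within distance c of
    each other. *)
Lemma heat_osc f M d e A c t t' (x x' : 'rV[R]_N) : continuous f ->
  0 <= d -> (forall y, `|f y| <= M) ->
  (forall y y', `|y - y'| < c -> `|f y - f y'| <= d) ->
  gaussE \1_[set z : 'rV[R]_N | A < `|z|] <= e ->
  `|x - x'| + `|Num.sqrt t - Num.sqrt t'| * A < c ->
  `|heat t f x - heat t' f x'| <= d + (M + M) * e.
Proof.
move=> cf d0 fM fd Ae xc.
rewrite /heat -(gaussEB (M := M) (K := M))//; last 2 first.
- exact: measurable_shift.
- exact: measurable_shift.
apply: (norm_gaussE_split (A := A)) => //.
- by apply: measurable_funB; exact: measurable_shift.
- by move=> z; rewrite (le_trans (ler_normB _ _))// lerD.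
move=> z zA; apply: fd; apply: le_lt_trans xc.
rewrite opprD addrACA -scalerBl (le_trans (ler_normD _ _))// lerD2l normrZ.
by rewrite ler_wpM2l.
Qed.

(** Since the square root is uniformly continuous, one modulus serves for all times
    t, including t = 0 where the kernel is singular. *)
Lemma heat_curve_equicontinuous h T e : C0_curve h -> 0 < e ->
  exists2 d, 0 < d & forall s, 0 <= s <= T -> forall t t' (x x' : 'rV[R]_N),
    `|t - t'| < d -> `|x - x'| < d -> `|heat t (h s) x - heat t' (h s) x'| <= e.
Proof.
move=> ch e0; have e20 : 0 < e / 2 by rewrite divr_gt0.
have [M M0 hM] := C0_curve_bounded T ch.
have [c c0 hc] := C0_curve_equicontinuous T ch e20.
have [A A0 hA] := @gauss_tail R N _ (divr_gt0 e20 (addr_gt0 M0 M0)).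
have cA0 : 0 < c / 2 / A by rewrite !divr_gt0.
exists (Num.min (c / 2) ((c / 2 / A) ^+ 2)).
  by rewrite lt_min divr_gt0//= exprn_gt0.
move=> s sT t t' x x'; rewrite !lt_min => /andP[_ tt'] /andP[xx' _].
have -> : e = e / 2 + (M + M) * (e / 2 / (M + M)) 
  by rewrite [X in _ + X]mulrC divfK ?gt_eqF ?addr_gt0// -splitr.
apply: (heat_osc (C0_continuous (ch.1 s)) (ltW e20) (hM _ sT) (hc _ sT) hA).
rewrite (splitr c) ltrD// -ltr_pdivlMr//.
rewrite (le_lt_trans (sqrt_dist _ _))// -(ger0_norm (ltW cA0)) -(sqrtr_sqr (c / 2 / A)).
by rewrite ltr_sqrt// exprn_gt0.
Qed.

(** Up to time S the flow moves the Gaussian ball of radius A by at most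
    sqrt S * A. *)
Lemma heat_curve_tight h T S e : C0_curve h -> 0 < e ->
  exists2 A, 0 < A & forall s, 0 <= s <= T -> forall t (x : 'rV[R]_N), t <= S ->
    A < `|x| -> `|heat t (h s) x| <= e.
Proof.
move=> ch e0; have e20 : 0 < e / 2 by rewrite divr_gt0.
have [M M0 hM] := C0_curve_bounded T ch.
have [B B0 hB] := C0_curve_tight T ch e20.
have [A A0 hA] := @gauss_tail R N _ (divr_gt0 e20 M0).
exists (B + Num.sqrt S * A); first by rewrite ltr_wpDr// mulr_ge0// ?sqrtr_ge0// ltW.
move=> s sT t x tS xA.
have -> : e = e / 2 + M * (e / 2 / M) by field; rewrite gt_eqF.
apply: (norm_gaussE_split (A := A)) => //.
- exact: measurable_shift (C0_continuous (ch.1 s)).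
- exact: ltW.
- by move=> z; exact: hM.
move=> z zA; apply: hB => //.
have h1 : Num.sqrt t * `|z| <= Num.sqrt S * A.
  by apply: ler_pM => //; rewrite ?sqrtr_ge0// ler_wsqrtr.
have := lerB_dist x (- (Num.sqrt t *: z)).
rewrite opprK normrN normrZ (ger0_norm (sqrtr_ge0 _)).
by move: xA h1; set a := `|x|; set b := `|x + _|; lra.
Qed.

Lemma C0_heat f t : C0 f -> C0 (heat t f).
Proof.
move=> f0; have cf := C0_curve_cst f0; have z0 : 0 <= (0:R) <= 0 by rewrite lexx.
split.
  apply/continuousP_dist => x e e0.
  have [d d0 hd] := heat_curve_equicontinuous 0 cf e0.
  by exists d => // y yx; apply: (hd 0 z0 t t y x _ yx); rewrite subrr normr0.
move=> e e0; have [A A0 hA] := heat_curve_tight 0 t cf (divr_gt0 e0 (ltr0n R 2)).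
exists A => x xA; apply: le_lt_trans (hA 0 z0 _ _ (lexx _) xA) _.
by rewrite ltr_pdivrMr// ltr_pMr// ltr1n.
Qed.

Lemma C0_curve_heat (h : R -> 'rV[R]_N -> R) (theta : R -> R) : C0_curve h -> continuous theta ->
  C0_curve (fun s => heat (theta s) (h s)).
Proof.
move=> ch /continuousP_dist ctheta; split => [t|t e e0]; first exact: C0_heat (ch.1 t).
have e20 : 0 < e / 2 by rewrite divr_gt0.
have [d d0 hd] := ch.2 t _ e20.
have [c c0 hc] := heat_curve_equicontinuous 0 (C0_curve_cst (ch.1 t)) e20.
have [b b0 hb] := ctheta t _ (divr_gt0 c0 (ltr0n R 2)).
exists (Num.min d b); first by rewrite lt_min d0.
move=> s; rewrite lt_min => /andP[/hd sd /hb sb] x.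
rewrite (le_trans (ler_distD (heat (theta s) (h t) x) _ _))// (splitr e) lerD//.
  exact: heat_dist (ch.1 s) (ch.1 t) sd.
apply: (hc 0); rewrite ?lexx ?subrr ?normr0//.
by rewrite (le_lt_trans sb)// ltr_pdivrMr// ltr_pMr// ltr1n.
Qed.

End heat_estimates.

(** * Duhamel integrals *)

Section weights.
Context {R : realType}.
Local Notation leb := (@lebesgue_measure R).
Implicit Types (k g : R -> R) (A : set (measurableTypeR R)).

(** The time weights of the Duhamel integrals: 1 for the nonlinear term, s^sigma
    for the forcing. *)
Definition weight k := [/\ forall s, 0 <= k s, measurable_fun setT k &
  forall T, leb.-integrable `[0, T] (EFin \o k)].

Lemma weight_integrableM k g A M : measurable A -> (forall s, 0 <= k s) ->
  leb.-integrable A (EFin \o k) -> measurable_fun A g ->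
  (forall s, A s -> `|g s| <= M) ->
  leb.-integrable A (EFin \o (fun s => k s * g s)).
Proof.
move=> mA k0 ik mg gM.
apply: (@le_integrable _ (measurableTypeR R) R leb A mA _ (fun s => M%:E * (EFin \o k) s)%E).
- apply/measurable_EFinP; apply: measurable_funM => //.
  by have /measurable_int/measurable_EFinP := ik.
- move=> s As /=; rewrite lee_fin !normrM mulrC ler_wpM2r//.
  by rewrite (le_trans (gM _ As))// ler_norm.
- exact: integrableZl.
Qed.

Lemma weight_integral_le k g A M : measurable A -> (forall s, 0 <= k s) ->
  leb.-integrable A (EFin \o k) -> measurable_fun A g ->
  (forall s, A s -> `|g s| <= M) ->
  `|\int[leb]_(s in A) (k s * g s)| <= M * \int[leb]_(s in A) k s.
Proof.
move=> mA k0 ik mg gM.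
have ikg := weight_integrableM mA k0 ik mg gM.
rewrite (le_trans (le_normr_Rintegral mA ikg))// -RintegralZl//.
apply: le_Rintegral => //.
- exact: (integrable_abse ikg).
- exact: (integrableZl mA M ik).
- by move=> s As; rewrite normrM ger0_norm// mulrC ler_wpM2r// gM.
Qed.

(** Absolute continuity of the integral of k. *)
Lemma weight_small k T e : weight k -> 0 < e -> exists2 d, 0 < d &
  forall t' t, 0 <= t' -> t' <= t -> t <= T -> t - t' < d ->
  \int[leb]_(s in `]t', t]) k s <= e.
Proof.
move=> [k0 mk ik] e0.
have ikT : leb.-integrable setT (EFin \o (k \_ `[0, T])).
  by rewrite -restrict_EFin; apply/(integrable_mkcond _ _).1.
have [d [d0 hd]] := integral_normr_continuous ikT e0.
exists d => // t' t t'0 t't tT ttd.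
have lt_d : (leb `]t', t]%classic < d%:E)%E.
  rewrite lebesgue_measure_itv/= lte_fin; by case: ifP.
rewrite ltW//; apply: le_lt_trans (hd _ _ lt_d) => //.
rewrite (@eq_Rintegral _ _ _ leb _ (fun s => `|(k \_ `[0, T]) s|))// => s.
rewrite inE/= in_itv/= => /andP[t's st]; rewrite patchE mem_set ?ger0_norm//=.
by rewrite in_itv/= (le_trans st tT) andbT (le_trans t'0)// ltW.
Qed.

Lemma weight_integral_mono k t T : weight k -> t <= T ->
  \int[leb]_(s in `[0, t]) k s <= \int[leb]_(s in `[0, T]) k s.
Proof.
move=> [k0 mk ik] tT; rewrite /Rintegral fine_le//.
- exact: integrable_fin_num (ik t).
- exact: integrable_fin_num (ik T).
- apply: ge0_subset_integral => //.
  + by apply/measurable_EFinP; exact: measurable_funTS.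
  + by move=> s _; rewrite lee_fin.
  + by apply: subset_itvl; rewrite bnd_simp.
Qed.

Lemma weight_cst1 : weight (fun=> 1).
Proof.
split => // T; apply: measurable_bounded_integrable => //=.
- rewrite lebesgue_measure_itv/=; case: ifP => _; rewrite ?ltry//.
- exact/bounded_cst.
Qed.

Lemma continuous_at_powR (a x : R) : 0 < x -> {for x, continuous (fun s : R => s `^ a)}.
Proof.
move=> x0; apply: differentiable_continuous; apply/derivable1_diffP.
by apply: derivable_powR; rewrite in_itv/= x0.
Qed.

Lemma integral_powR_le (sigma a T : R) : -1 < sigma -> 0 < a -> a < T ->
  (\int[leb]_(s in `[a, T]) (s `^ sigma)%:E <= (T `^ (sigma + 1) / (sigma + 1))%:E)%E.
Proof.
move=> s1 a0 aT; have s10 : 0 < sigma + 1 by rewrite -ltrBlDr sub0r.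
pose F (x : R) := (sigma + 1)^-1 * x `^ (sigma + 1).
have dF (x : R) : 0 < x -> is_derive x 1 F (x `^ sigma).
  move=> x0; rewrite /F.
  have := @is_derive1_powR R (sigma + 1) x x0; rewrite addrK => H.
  by apply: (is_derive_eq (is_deriveZ (sigma + 1)^-1 H)); rewrite /GRing.scale/= mulrA mulVf ?gt_eqF// mul1r.
have cF (x : R) : 0 < x -> {for x, continuous F}.
  move=> x0; apply: differentiable_continuous; apply/derivable1_diffP.
  by case: (dF x x0).
rewrite (@continuous_FTC2 R (fun s => s `^ sigma) F a T aT).
- rewrite -EFinB lee_fin /F (mulrC (T `^ _)) gerBl.
  by rewrite mulr_ge0 ?powR_ge0// invr_ge0 ltW.
- apply: continuous_in_subspaceT => x; rewrite inE/= in_itv/= => /andP[ax _].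
  by apply: continuous_at_powR; rewrite (lt_le_trans a0).
- split.
  + move=> x; rewrite in_itv/= => /andP[ax _].
    by case: (dF x (lt_trans a0 ax)).
  + by apply: cvg_at_right_filter; exact: cF.
  + by apply: cvg_at_left_filter; apply: cF; exact: lt_trans aT.
- move=> x; rewrite in_itv/= => /andP[ax _].
  by rewrite derive1E; case: (dF x (lt_trans a0 ax)).
Qed.

(** Monotone convergence along the intervals [b / (n + 2), b], on which the
    primitive s^(sigma + 1) / (sigma + 1) is smooth; it stays bounded as the
    interval approaches 0 because sigma > -1. *)
Lemma weight_powR (sigma : R) : -1 < sigma -> weight (fun s : R => s `^ sigma).
Proof.
move=> s1; have mp : measurable_fun setT (fun s : R => s `^ sigma) by exact: measurable_powR.
split => // [s|T]; first exact: powR_ge0.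
pose b := `|T| + 1; have b0 : 0 < b by rewrite ltr_wpDl.
have Tb : T <= b by rewrite (le_trans (ler_norm T))// lerDl.
apply: (@integrableS _ _ _ leb `[0, b]) => //.
  by apply: subset_itvl; rewrite bnd_simp.
apply/integrableP; split; first by apply/measurable_EFinP; exact: measurable_funTS.
under eq_integral do rewrite /= ger0_norm ?powR_ge0//.
rewrite -integral_itv_obnd_cbnd; last by apply/measurable_EFinP; exact: measurable_funTS.
pose F n : set (measurableTypeR R) := `[b / n.+2%:R, b]%classic.
have bn n : 0 < b / n.+2%:R by rewrite divr_gt0.
have -> : `]0, b]%classic = \bigcup_n F n.
  apply/seteqP; split => x; rewrite /F/= in_itv/=; last first.
    by move=> [n _]; rewrite /= in_itv/= => /andP[nx ->]; rewrite (lt_le_trans _ nx).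
  move=> /andP[x0 xb]; exists (Num.truncn (b / x)) => //=; rewrite in_itv/= xb andbT.
  rewrite ler_pdivrMr// mulrC -ler_pdivrMr//.
  by rewrite (le_trans (ltW (truncnS_gt _)))// ler_nat.
have cvgF : (\int[leb]_(s in F i) (s `^ sigma)%:E)%E @[i --> \oo] -->
    (\int[leb]_(s in \bigcup_i F i) (s `^ sigma)%:E)%E.
  apply: ge0_nondecreasing_set_cvg_integral.
  - move=> n m nm; apply/subsetPset; apply: subset_itvr; rewrite bnd_simp.
    by rewrite ler_pM2l// lef_pV2 ?posrE// ler_nat.
  - by move=> n; exact: measurable_itv.
  - by move=> n; apply/measurable_EFinP; exact: measurable_funTS.
  - by move=> n s _; rewrite lee_fin powR_ge0.
rewrite -(cvg_lim _ cvgF)//.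
apply: (@le_lt_trans _ _ (b `^ (sigma + 1) / (sigma + 1))%:E); last exact: ltry.
apply: lime_le; first by apply/cvg_ex; exists (\int[leb]_(s in \bigcup_i F i) (s `^ sigma)%:E)%E.
apply: nearW => n; apply: integral_powR_le => //.
by rewrite ltr_pdivrMr// ltr_pMr// ltr1n.
Qed.

End weights.

Section duhamel.
Context {R : realType} {N : nat}.
Local Notation leb := (@lebesgue_measure R).
Implicit Types (k : R -> R) (h g : R -> 'rV[R]_N -> R).

Definition duhamel k h (t : R) (x : 'rV[R]_N) : R :=
  \int[leb]_(s in `[0, t]) (k s * heat (t - s) (h s) x).

Lemma C0_curve_heat_back h t : C0_curve h -> C0_curve (fun s => heat (t - s) (h s)).
Proof.
move=> ch; apply: C0_curve_heat => //.
by move=> s; apply: (@continuousB _ R R (fun=> t) id) => //; exact: cst_continuous.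
Qed.

Lemma measurable_heat_back h t x (A : set (measurableTypeR R)) : C0_curve h ->
  measurable_fun A (fun s => heat (t - s) (h s) x).
Proof.
move=> ch; apply: measurable_funTS; apply: continuous_measurable_fun.
exact: C0_curve_continuous (C0_curve_heat_back t ch).
Qed.

Lemma integrable_duhamel k h t x b : weight k -> C0_curve h ->
  leb.-integrable `[0, b] (EFin \o (fun s => k s * heat (t - s) (h s) x)).
Proof.
move=> [k0 mk ik] ch; have [M M0 hM] := C0_curve_bounded b ch.
apply: (@weight_integrableM _ _ _ _ M) => //; first exact: measurable_heat_back.
move=> s; rewrite /= in_itv/= => sb; apply: norm_heat_le; last exact: hM.
exact: C0_continuous (ch.1 s).
Qed.

Lemma duhamel_le0 k h t x : t <= 0 -> duhamel k h t x = 0.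
Proof.
move=> t0; rewrite /duhamel; have [->|tn0] := eqVneq t 0.
  by rewrite set_itv1 Rintegral_set1.
rewrite set_itv_ge ?Rintegral_set0// bnd_simp -ltNge lt_neqAle tn0.
exact: t0.
Qed.

(** The heat flow contracts the sup norm, so a pointwise-in-time distance m of the
    sources is simply integrated. *)
Lemma duhamel_dist k h g t x m : weight k -> C0_curve h -> C0_curve g ->
  continuous m -> (forall s, 0 <= s <= t -> forall y, `|h s y - g s y| <= m s) ->
  leb.-integrable `[0, t] (EFin \o (fun s => k s * m s)) ->
  `|duhamel k h t x - duhamel k g t x| <= \int[leb]_(s in `[0, t]) (k s * m s).
Proof.
move=> wk ch cg cm hgm im; have [k0 mk ik] := wk.
rewrite /duhamel -RintegralB//; [|exact: integrable_duhamel|exact: integrable_duhamel].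
have id : leb.-integrable `[0, t]
    (EFin \o (fun s => k s * heat (t - s) (h s) x - k s * heat (t - s) (g s) x)).
  by apply: (integrableB _ (integrable_duhamel t x t wk ch) (integrable_duhamel t x t wk cg)).
rewrite (le_trans (le_normr_Rintegral _ id))//.
apply: le_Rintegral => //; first exact: (integrable_abse id).
move=> s; rewrite /= in_itv/= => st.
rewrite -mulrBr normrM ger0_norm// ler_wpM2l//.
exact: heat_dist (ch.1 s) (cg.1 s) (hgm s st).
Qed.

Lemma le_duhamel k h g t x : weight k -> C0_curve h -> C0_curve g ->
  (forall s, 0 <= s <= t -> forall y, h s y <= g s y) ->
  duhamel k h t x <= duhamel k g t x.
Proof.
move=> wk ch cg hg; have [k0 mk ik] := wk.
apply: le_Rintegral => //; [exact: integrable_duhamel|exact: integrable_duhamel|].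
move=> s; rewrite /= in_itv/= => st; rewrite ler_wpM2l//.
exact: le_heat (ch.1 s) (cg.1 s) (hg s st).
Qed.

Lemma duhamel_split k h t t' x : weight k -> C0_curve h -> 0 <= t' -> t' <= t ->
  duhamel k h t x = \int[leb]_(s in `[0, t']) (k s * heat (t - s) (h s) x) +
    \int[leb]_(s in `]t', t]) (k s * heat (t - s) (h s) x).
Proof.
move=> wk ch t'0 t't.
rewrite -(@Rintegral_itvB _ _ (BLeft 0) (BRight t) t'); rewrite ?bnd_simp//.
  by rewrite addrC subrK.
exact: integrable_duhamel.
Qed.

(** Over ]t', t] the weight has little mass; over [0, t'] the two integrands differ
    little because the heat flow is equicontinuous. *)
Lemma duhamel_osc k h T e : weight k -> C0_curve h -> 0 < e ->
  exists2 d, 0 < d & forall t t' x x', 0 <= t' -> t' <= t -> t <= T ->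
    t - t' < d -> `|x - x'| < d -> `|duhamel k h t x - duhamel k h t' x'| <= e.
Proof.
move=> wk ch e0; have [k0 mk ik] := wk.
have [M M0 hM] := C0_curve_bounded T ch.
have e20 : 0 < e / 2 by rewrite divr_gt0.
have [d1 d10 hd1] := weight_small T wk (divr_gt0 e20 M0).
pose kT := \int[leb]_(s in `[0, T]) k s + 1.
have kT0 : 0 < kT by rewrite ltr_wpDl// Rintegral_ge0.
have [d2 d20 hd2] := heat_curve_equicontinuous T ch (divr_gt0 e20 kT0).
exists (Num.min d1 d2); first by rewrite lt_min d10.
move=> t t' x x' t'0 t't tT; rewrite !lt_min => /andP[tt1 tt2] /andP[_ xx'].
have sT s : 0 <= s -> s <= t -> 0 <= s <= T.
  by move=> s0 st; rewrite s0 (le_trans st).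
rewrite (duhamel_split _ wk ch t'0 t't) [X in _ + _ - X]/duhamel addrAC.
rewrite -RintegralB//; [|exact: integrable_duhamel|exact: integrable_duhamel].
rewrite (le_trans (ler_normD _ _))// (splitr e) lerD//; last first.
  apply: (@le_trans _ _ (M * \int[leb]_(s in `]t', t]) k s)); last first.
    by rewrite mulrC -ler_pdivlMr//; exact: hd1.
  apply: weight_integral_le => //.
  - apply: (@integrableS _ _ _ leb `[0, t]) => //.
    by apply: subset_itvr; rewrite bnd_simp.
  - exact: measurable_heat_back.
  - move=> s; rewrite /= in_itv/= => /andP[t's st].
    apply: norm_heat_le; first exact: C0_continuous (ch.1 s).
    by apply: hM; apply: sT => //; rewrite (le_trans t'0)// ltW.
under eq_Rintegral do rewrite -mulrBr.
apply: (@le_trans _ _ (e / 2 / kT * \int[leb]_(s in `[0, t']) k s)); last first.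
  rewrite -mulrA ler_piMr//; first exact: ltW.
  rewrite mulrC ler_pdivrMr// mul1r.
  by rewrite (le_trans (weight_integral_mono wk (le_trans t't tT)))// lerDl.
apply: weight_integral_le => //.
- apply: measurable_funB; exact: measurable_heat_back.
- move=> s; rewrite /= in_itv/= => /andP[s0 st'].
  apply: hd2 => //; first by rewrite sT// (le_trans st').
  by rewrite opprB addrA subrK ger0_norm ?subr_ge0.
Qed.

Lemma duhamel_tight k h T e : weight k -> C0_curve h -> 0 < e ->
  exists2 A, 0 < A & forall t x, 0 <= t <= T -> A < `|x| -> `|duhamel k h t x| <= e.
Proof.
move=> wk ch e0; have [k0 mk ik] := wk.
pose kT := \int[leb]_(s in `[0, T]) k s + 1.
have kT0 : 0 < kT by rewrite ltr_wpDl// Rintegral_ge0.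
have [A A0 hA] := heat_curve_tight T T ch (divr_gt0 e0 kT0).
exists A => // t x /andP[t0 tT] xA.
apply: (@le_trans _ _ (e / kT * \int[leb]_(s in `[0, t]) k s)).
  apply: weight_integral_le => //; first exact: measurable_heat_back.
  move=> s; rewrite /= in_itv/= => /andP[s0 st].
  apply: hA => //; first by rewrite s0 (le_trans st).
  by rewrite (le_trans _ tT)// gerBl.
rewrite -mulrA ler_piMr//; first exact: ltW.
rewrite mulrC ler_pdivrMr// mul1r.
by rewrite (le_trans (weight_integral_mono wk tT))// lerDl.
Qed.

(** Together with duhamel_osc for nonnegative times, this gives continuity on the
    whole line, since t |-> max(t, 0) is 1-Lipschitz. *)
Lemma duhamel_max0 k h t : duhamel k h t = duhamel k h (Num.max t 0).
Proof.
apply/funext => x; have [t0|t0] := leP t 0; last by [].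
by rewrite !duhamel_le0.
Qed.

Lemma C0_curve_duhamel k h : weight k -> C0_curve h -> C0_curve (duhamel k h).
Proof.
move=> wk ch; split => [t|t e e0].
  have [t0|t0] := leP t 0.
    rewrite (_ : duhamel k h t = fun=> 0); first exact: C0_cst0.
    by apply/funext => x; rewrite duhamel_le0.
  split.
    apply/continuousP_dist => x e e0.
    have [d d0 hd] := duhamel_osc t wk ch e0.
    by exists d => // y yx; apply: hd; rewrite ?subrr// ltW.
  move=> e e0; have [A A0 hA] := duhamel_tight t wk ch (divr_gt0 e0 (ltr0n R 2)).
  exists A => x xA; apply: le_lt_trans (hA t x _ xA) _; first by rewrite (ltW t0) lexx.
  by rewrite ltr_pdivrMr// ltr_pMr// ltr1n.
have [d d0 hd] := duhamel_osc (`|t| + 1) wk ch e0.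
exists (Num.min d 1); first by rewrite lt_min d0 ltr01.
move=> s; rewrite lt_min => /andP[sd s1] x.
rewrite duhamel_max0 [X in _ - X x]duhamel_max0.
have tT : Num.max t 0 <= `|t| + 1 by rewrite ge_max !ler_wpDr// ler_norm.
have sT : Num.max s 0 <= `|t| + 1.
  rewrite ge_max addr_ge0// andbT; have := ler_norm t.
  by move: s1; rewrite ltr_norml; lra.
have m0 (a : R) : 0 <= Num.max a 0 by rewrite le_max lexx orbT.
have lip (a b : R) : a <= b -> Num.max b 0 - Num.max a 0 <= `|a - b|.
  move=> ab; rewrite distrC ger0_norm ?subr_ge0//.
  by case: (leP b 0) => b0; case: (leP a 0) => a0; lra.
have mono (a b : R) : a <= b -> Num.max a 0 <= Num.max b 0.
  by move=> ab; rewrite ge_max !le_max ab lexx orbT.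
have [st|/ltW ts] := leP s t.
  rewrite distrC; apply: hd => //; [exact: mono| |by rewrite subrr normr0].
  exact: le_lt_trans (lip _ _ st) _.
apply: hd => //; [exact: mono| |by rewrite subrr normr0].
by rewrite (le_lt_trans (lip _ _ ts))// distrC.
Qed.

End duhamel.

(** * Volterra equations with a Lipschitz nonlinearity *)

Section real_lemmas.
Context {R : realType}.
Local Notation leb := (@lebesgue_measure R).

Lemma expR_ge1 (x : R) : 0 <= x -> 1 <= expR x.
Proof. by rewrite -[1]expR0 ler_expR. Qed.

Lemma geometric_small (c e : R) : 0 < e -> exists n, c / 2 ^+ n <= e.
Proof.
move=> e0; exists (Num.truncn (c / e)).+1.
rewrite ler_pdivrMr ?exprn_gt0// mulrC -ler_pdivrMr//.
rewrite (le_trans (ltW (truncnS_gt _)))// -natrX ler_nat.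
exact/ltnW/ltn_expl.
Qed.

Lemma geometric_cauchy_limit (a : nat -> R) c :
  (forall n m, (n <= m)%N -> `|a m - a n| <= c / 2 ^+ n) ->
  exists l, forall n, `|l - a n| <= c / 2 ^+ n.
Proof.
move=> ha.
have ca : cvg (a @ \oo).
  apply/cauchy_cvgP/cauchy_ballP => e e0.
  have [n cn] := geometric_small c (divr_gt0 e0 (ltr0n R 3)).
  exists (a @` [set m | (n <= m)%N], a @` [set m | (n <= m)%N]).
    by split; exists n => // m nm /=; exists m.
  move=> [_ _] [/= [m1 nm1 <-] [m2 nm2 <-]]; rewrite -ball_normE/=.
  have := ha _ _ nm1; have := ha _ _ nm2; rewrite !ler_norml ltr_norml; lra.
exists (lim (a @ \oo)) => n.
have cd : (fun m => `|a m - a n|) @ \oo --> `|lim (a @ \oo) - a n|.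
  by apply: cvg_norm; apply: cvgB => //; exact: cvg_cst.
rewrite -(cvg_lim _ cd)//; apply: limr_le; first by apply/cvg_ex; eexists; exact: cd.
by exists n => // m /=; exact: ha.
Qed.

Lemma continuous_expR_scale (c l : R) : continuous (fun s => c * expR (l * s)).
Proof.
move=> x; apply: (@continuousM R R (fun=> c) (fun s => expR (l * s))).
  exact: cst_continuous.
apply: (@continuous_comp _ _ _ (fun s : R => l * s) expR); last exact: continuous_expR.
exact: mulrl_continuous.
Qed.

Lemma integrable_expR_scale (c l t : R) :
  leb.-integrable `[0, t] (EFin \o (fun s => 1 * (c * expR (l * s)))).
Proof.
apply: (@continuous_compact_integrable R (fun s => 1 * (c * expR (l * s)))).
  exact: segment_compact.
apply: continuous_subspaceT => x.
by under eq_fun do rewrite mul1r; exact: continuous_expR_scale.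
Qed.

Lemma integral_expR_scale_le (c l t : R) : 0 <= c -> 0 < l -> 0 <= t ->
  \int[leb]_(s in `[0, t]) (1 * (c * expR (l * s))) <= c / l * expR (l * t).
Proof.
move=> c0 l0; rewrite le_eqVlt => /predU1P[<-|t0].
  by rewrite set_itv1 Rintegral_set1 mulr_ge0 ?expR_ge0// divr_ge0// ltW.
have dF (x : R) : is_derive x 1 (fun s => c / l * expR (l * s)) (c * expR (l * x)).
  have dl : is_derive x 1 (fun s : R => l * s) l.
    by apply: is_derive_eq; rewrite /GRing.scale/= mulr1.
  have := @is_derive1_comp R expR (fun s : R => l * s) x _ _ _ dl.
  move=> H.
  apply: (is_derive_eq (is_deriveZ (c / l) (H _ (is_derive_expR _)))).
  by rewrite /GRing.scale/=; field; rewrite gt_eqF.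
have cF := @continuous_expR_scale (c / l) l.
under eq_Rintegral do rewrite mul1r.
rewrite /Rintegral (@continuous_FTC2 R _ (fun s => c / l * expR (l * s)) 0 t)//.
- by rewrite -EFinB/= gerBl mulr_ge0 ?expR_ge0// divr_ge0// ltW.
- by apply: continuous_subspaceT => x; exact: continuous_expR_scale.
- split.
  + by move=> x _; case: (dF x).
  + by apply: cvg_at_right_filter; exact: cF.
  + by apply: cvg_at_left_filter; exact: cF.
- by move=> x _; rewrite derive1E; case: (dF x).
Qed.

End real_lemmas.

Section volterra.
Context {R : realType} {N : nat}.
Local Notation V := (duhamel (fun=> (1:R))).
Variables (phi : bool -> R -> R) (L : R).
Hypothesis L0 : 0 < L.
Hypothesis lip : forall b x y, `|phi b x - phi b y| <= L * `|x - y|.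
Hypothesis phi0 : forall b, phi b 0 = 0.
Implicit Types (A u w : bool -> R -> 'rV[R]_N -> R).

(** The two unknowns of the system are indexed by a boolean, so that each
    statement about the coupled equations is made once. *)
Definition nonlin u b (s : R) (y : 'rV[R]_N) := phi b (u (~~ b) s y).

Definition volterra A T u := forall b t, 0 <= t <= T -> forall x,
  u b t x = A b t x + V (nonlin u b) t x.

Lemma C0_curve_nonlin u b : (forall b, C0_curve (u b)) -> C0_curve (nonlin u b).
Proof. by move=> cu; apply: (C0_curve_lipschitz (lip b) (phi0 b)). Qed.

(** In the norm sup_t e^(-2Lt) |u(t)| the Duhamel term is a 1/2-contraction on
    any time interval. *)
Lemma nonlin_contraction u w c t b x : (forall b, C0_curve (u b)) ->
  (forall b, C0_curve (w b)) -> 0 <= c -> 0 <= t ->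
  (forall b s y, 0 <= s <= t -> `|u b s y - w b s y| <= c * expR (2 * L * s)) ->
  `|V (nonlin u b) t x - V (nonlin w b) t x| <= c / 2 * expR (2 * L * t).
Proof.
move=> cu cw c0 t0 uw.
have uwt s : 0 <= s <= t -> forall y,
    `|nonlin u b s y - nonlin w b s y| <= L * c * expR (2 * L * s).
  move=> st y; rewrite (le_trans (lip _ _ _))// -mulrA ler_wpM2l ?(ltW L0)//.
  exact: uw.
have := @duhamel_dist R N (fun=> 1) _ _ t x _ weight_cst1 (C0_curve_nonlin b cu)
  (C0_curve_nonlin b cw) (@continuous_expR_scale R (L * c) (2 * L)) uwt
  (integrable_expR_scale _ _ _).
move=> /le_trans; apply.
rewrite (le_trans (integral_expR_scale_le _ _ _))//.
- by rewrite mulr_ge0// ltW.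
- by rewrite mulr_gt0.
- by rewrite ler_wpM2r ?expR_ge0// le_eqVlt; apply/orP; left; apply/eqP; field; rewrite gt_eqF.
Qed.

(** Starting from any common bound c, n applications of the contraction bound the
    difference by c 2^-n e^(2Lt). *)
Lemma volterra_unique A T u w : (forall b, C0_curve (u b)) -> (forall b, C0_curve (w b)) ->
  volterra A T u -> volterra A T w ->
  forall b t, 0 <= t <= T -> forall x, u b t x = w b t x.
Proof.
move=> cu cw eu ew.
have [c c0 hc] : exists2 c, 0 < c & forall b s y, 0 <= s <= T -> `|u b s y - w b s y| <= c.
  have [M1 M10 h1] := C0_curve_bounded T (cu true).
  have [M2 M20 h2] := C0_curve_bounded T (cu false).
  have [M3 M30 h3] := C0_curve_bounded T (cw true).
  have [M4 M40 h4] := C0_curve_bounded T (cw false).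
  exists (M1 + M2 + (M3 + M4)); first by rewrite !addr_gt0.
  move=> b s y sT; rewrite (le_trans (ler_normB _ _))//.
  have := h1 s sT y; have := h2 s sT y; have := h3 s sT y; have := h4 s sT y.
  by case: b; lra.
have key n b t x : 0 <= t <= T ->
    `|u b t x - w b t x| <= c / 2 ^+ n * expR (2 * L * t).
  elim: n b t x => [|n IH] b t x tT.
    rewrite expr0 divr1 (le_trans (hc _ _ _ tT))// ler_peMr ?(ltW c0)//.
    by apply: expR_ge1; case/andP: tT => t0 _; rewrite mulr_ge0// mulr_ge0// ltW.
  rewrite eu// ew// opprD addrACA subrr add0r exprSr invfM mulrA.
  have /andP[t0 t_T] := tT.
  apply: nonlin_contraction => //; first by rewrite divr_ge0 ?ltW// exprn_gt0.
  by move=> b' s y /andP[s0 st]; apply: IH; rewrite s0 (le_trans st).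
move=> b t tT x; apply/eqP; rewrite -subr_eq0 -normr_eq0 eq_le normr_ge0 andbT.
apply/ler_addgt0Pl => e e0; rewrite addr0.
have [n cn] := geometric_small (c * expR (2 * L * t)) e0.
by rewrite (le_trans (key n b t x tT))// mulrAC.
Qed.

Fixpoint picard A n : bool -> R -> 'rV[R]_N -> R :=
  if n is n'.+1 then fun b t x => 1 * A b t x + 1 * V (nonlin (picard A n') b) t x
  else A.

Lemma picardS A n b t x :
  picard A n.+1 b t x = A b t x + V (nonlin (picard A n) b) t x.
Proof. by rewrite /= !mul1r. Qed.

Lemma C0_curve_picard A n b : (forall b, C0_curve (A b)) -> C0_curve (picard A n b).
Proof.
move=> cA; elim: n b => [|n IH] b //=; apply: C0_curve_lin => //.
by apply: C0_curve_duhamel; [exact: weight_cst1|exact: C0_curve_nonlin].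
Qed.

(** The increments of the iteration decay like 2^-n in the weighted norm, at a rate
    that does not depend on T. *)
Lemma picard_cauchy A T : (forall b, C0_curve (A b)) ->
  exists c, forall n m b t x, (n <= m)%N -> t <= T ->
    `|picard A m b t x - picard A n b t x| <= c / 2 ^+ n.
Proof.
move=> cA.
have cP n b := @C0_curve_picard A n b cA.
have [M1 M10 h1] := C0_curve_bounded T (C0_curve_duhamel weight_cst1 (C0_curve_nonlin true cA)).
have [M2 M20 h2] := C0_curve_bounded T (C0_curve_duhamel weight_cst1 (C0_curve_nonlin false cA)).
pose c := M1 + M2; have c0 : 0 < c by rewrite addr_gt0.
have step n b t x : 0 <= t <= T ->
    `|picard A n.+1 b t x - picard A n b t x| <= c / 2 ^+ n * expR (2 * L * t).
  elim: n b t x => [|n IH] b t x tT; have /andP[t0 t_T] := tT.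
    rewrite expr0 divr1 picardS addrAC subrr add0r.
    rewrite (@le_trans _ _ c)//.
      case: b; first by rewrite (le_trans (h1 _ tT x))// lerDl ltW.
      by rewrite (le_trans (h2 _ tT x))// lerDr ltW.
    rewrite ler_peMr ?(ltW c0)//.
    by apply: expR_ge1; rewrite mulr_ge0// mulr_ge0// ltW.
  rewrite !picardS opprD addrACA subrr add0r.
  rewrite exprSr invfM mulrA.
  apply: nonlin_contraction => //; first by rewrite divr_ge0 ?ltW// exprn_gt0.
  by move=> b' s y /andP[s0 st]; apply: IH; rewrite s0 (le_trans st).
have step' n b t x : t <= T ->
    `|picard A n.+1 b t x - picard A n b t x| <= c * expR (2 * L * `|T|) / 2 ^+ n.
  move=> tT; have [t0|/ltW t0] := leP 0 t.
    rewrite (le_trans (step _ _ _ _ _))// ?t0// mulrAC ler_wpM2r//.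
    rewrite ler_wpM2l ?(ltW c0)// ler_expR ler_wpM2l ?mulr_ge0 ?(ltW L0)//.
    by rewrite (le_trans tT)// ler_norm.
  (* For negative times the Duhamel terms vanish and the iteration is stationary. *)
  have PA k : picard A k b t x = A b t x.
    by case: k => // k; rewrite picardS duhamel_le0// addr0.
  rewrite !PA subrr normr0 divr_ge0 ?exprn_ge0// mulr_ge0 ?expR_ge0//.
  exact: ltW.
pose c' := c * expR (2 * L * `|T|).
have c'0 : 0 <= c' by rewrite mulr_ge0 ?expR_ge0// ltW.
exists (c' * 2) => n m b t x /subnKC <- tT.
(* Telescoping sum of the increments, in closed form so that the induction on k
   goes through. *)
have geo k : `|picard A (n + k) b t x - picard A n b t x| <=
    c' * 2 / 2 ^+ n - c' * 2 / 2 ^+ (n + k).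
  elim: k => [|k IH]; first by rewrite addn0 !subrr normr0.
  rewrite addnS (le_trans (ler_distD (picard A (n + k) b t x) _ _))//.
  have := step' (n + k)%N b t x tT; rewrite -/c' => hs.
  have -> : c' * 2 / 2 ^+ n - c' * 2 / 2 ^+ (n + k).+1 =
      c' / 2 ^+ (n + k) + (c' * 2 / 2 ^+ n - c' * 2 / 2 ^+ (n + k)).
    rewrite exprSr; field.
    by rewrite !expf_neq0.
  exact: lerD.
by rewrite (le_trans (geo _))// gerBl divr_ge0 ?exprn_ge0// mulr_ge0.
Qed.

(** The convergence is geometric on every interval ]-oo, T], so the limit is a
    global solution. *)
Lemma volterra_exists A : (forall b, C0_curve (A b)) ->
  exists2 u, (forall b, C0_curve (u b)) & forall T, volterra A T u.
Proof.
move=> cA; have cP n b := @C0_curve_picard A n b cA.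
have /choice[u' hu'] : forall z : bool * R * 'rV[R]_N, exists l, exists c, forall n,
    `|l - picard A n z.1.1 z.1.2 z.2| <= c / 2 ^+ n.
  move=> [[b t] x] /=; have [c hc] := picard_cauchy t cA.
  have [l hl] := @geometric_cauchy_limit R (fun n => picard A n b t x) c
    (fun n m nm => hc n m b t x nm (lexx _)).
  by exists l, c.
pose u b t x := u' (b, t, x).
have hu T : exists c, forall n b t x, t <= T ->
    `|u b t x - picard A n b t x| <= c / 2 ^+ n.
  have [c hc] := picard_cauchy T cA; exists c => n b t x tT.
  have [c' hc'] := hu' (b, t, x).
  apply/ler_addgt0Pl => e e0; have [m cm] := geometric_small c' e0.
  rewrite (le_trans (ler_distD (picard A (n + m) b t x) _ _))// lerD//; last first.
    by apply: hc => //; rewrite leq_addr.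
  have := hc' (n + m)%N; rewrite /= -/(u b t x) => /le_trans; apply.
  apply: le_trans cm; have c'0 : 0 <= c'.
    by have := hc' 0%N; rewrite expr0 divr1; apply: le_trans.
  rewrite ler_wpM2l// lef_pV2 ?posrE ?exprn_gt0//.
  by rewrite ler_eXn2l ?ltr1n// leq_addl.
have cu b : C0_curve (u b).
  apply: C0_curve_uniform_limit => e t e0; have [c hc] := hu (`|t| + 1).
  have [n cn] := geometric_small c e0.
  exists (picard A n b), 1; split => // s st x; apply: le_trans cn; apply: hc.
  by move: st; have := ler_norm t; rewrite ltr_norml; lra.
exists u => // T b t /andP[t0 tT] x; have [c hc] := hu T.
apply/eqP; rewrite -subr_eq0 -normr_eq0 eq_le normr_ge0 andbT.
have c0 : 0 <= c.
  by have := hc 0%N b t x tT; rewrite expr0 divr1; apply: le_trans.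
apply/ler_addgt0Pl => e e0; rewrite addr0.
pose K := c + c * expR (2 * L * t).
have [n Kn] := geometric_small K e0; apply: le_trans Kn.
have -> : u b t x - (A b t x + V (nonlin u b) t x) =
    (u b t x - picard A n.+1 b t x) +
    (V (nonlin (picard A n) b) t x - V (nonlin u b) t x).
  rewrite picardS; move: (V _ t x) (V _ t x) (A b t x) (u b t x) => a1 a2 a3 a4.
  by ring.
rewrite (le_trans (ler_normD _ _))// /K mulrDl lerD//.
  rewrite (le_trans (hc _ _ _ _ _))// ler_wpM2l// lef_pV2 ?posrE ?exprn_gt0//.
  by rewrite ler_eXn2l ?ltr1n.
have c2n : 0 <= c / 2 ^+ n by rewrite divr_ge0// exprn_ge0.
rewrite (le_trans (nonlin_contraction (c := c / 2 ^+ n) b x _ _ _ _ _))//.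
  move=> b' s y /andP[s0 st]; rewrite distrC.
  rewrite (le_trans (hc _ _ _ _ (le_trans st tT)))// ler_peMr//.
  by apply: expR_ge1; rewrite mulr_ge0// mulr_ge0// ltW.
rewrite -[leRHS]mulrAC ler_wpM2r ?expR_ge0// ler_pdivrMr// ler_peMr//.
by rewrite ler1n.
Qed.

End volterra.

(** * Truncation and mild solutions *)

Section truncation.
Context {R : realType}.

(** Cutting the argument at M turns the power into a globally Lipschitz
    function without changing it on [-M, M]. *)
Definition trunc_pow (M p y : R) := Num.min `|y| M `^ p.

(** Mean value theorem, with derivative p x^(p - 1) bounded by its value at M; the
    case a = 0, an end point at which the power is not smooth, is direct. *)
Lemma powR_lipschitz (p M a b : R) : 1 <= p -> 0 <= a -> a <= b -> b <= M ->
  b `^ p - a `^ p <= p * M `^ (p - 1) * (b - a).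
Proof.
move=> p1 a0 ab bM.
have p0 : 0 < p by rewrite (lt_le_trans _ p1).
have M0 : 0 <= M by rewrite (le_trans a0)// (le_trans ab).
have mono (c : R) : 0 <= c -> c <= M -> c `^ (p - 1) <= M `^ (p - 1).
  by move=> c0 cM; apply: ge0_ler_powR; rewrite ?nnegrE// subr_ge0.
move: ab; rewrite le_eqVlt => /predU1P[->|ab]; first by rewrite !subrr mulr0.
move: a0; rewrite le_eqVlt => /predU1P[a0|a0].
  rewrite -a0 powR0 ?gt_eqF// !subr0.
  have b0 : 0 < b by rewrite a0.
  have -> : b `^ p = b `^ (p - 1) * b.
    by rewrite -[X in _ * X]powRr1 ?ltW// -powRD ?subrK// gt_eqF ?implybT.
  rewrite ler_wpM2r ?(ltW b0)//.
  by rewrite (le_trans (mono _ (ltW b0) bM))// ler_peMl ?powR_ge0// ltW.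
have dpow (x : R) : x \in `]a, b[ -> is_derive x 1 (fun s : R => s `^ p) (p * x `^ (p - 1)).
  rewrite in_itv/= => /andP[ax _]; apply: is_derive1_powR; exact: lt_trans ax.
have [|c + ->] := MVT ab dpow.
  apply: continuous_in_subspaceT => x; rewrite inE/= in_itv/= => /andP[ax _].
  by apply: continuous_at_powR; rewrite (lt_le_trans a0).
rewrite in_itv/= => /andP[ac cb].
rewrite ler_wpM2r ?subr_ge0 ?(ltW ab)// ler_wpM2l ?(ltW p0)// mono//.
  by rewrite ltW// (lt_trans a0).
by rewrite (le_trans (ltW cb)).
Qed.

Lemma trunc_pow_lipschitz (M p x y : R) : 0 <= M -> 1 <= p ->
  `|trunc_pow M p x - trunc_pow M p y| <= p * M `^ (p - 1) * `|x - y|.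
Proof.
move=> M0 p1; wlog xy : x y / `|x| <= `|y|.
  move=> H; have [/H//|/ltW/H] := leP `|x| `|y|.
  by rewrite distrC (distrC y).
have mxy : Num.min `|x| M <= Num.min `|y| M.
  by rewrite le_min !ge_min xy lexx orbT.
rewrite distrC ger0_norm; last first.
  rewrite subr_ge0; apply: ge0_ler_powR => //; rewrite ?nnegrE ?le_min ?normr_ge0//.
  by rewrite (le_trans _ p1).
have m0 : 0 <= Num.min `|x| M by rewrite le_min normr_ge0.
have mM : Num.min `|y| M <= M by rewrite ge_min lexx orbT.
rewrite (le_trans (powR_lipschitz p1 m0 mxy mM))// ler_wpM2l//.
  by rewrite mulr_ge0 ?powR_ge0// (le_trans _ p1).
rewrite distrC (le_trans _ (lerB_dist y x))//.
by case: (leP `|y| M) => yM; case: (leP `|x| M) => xM; lra.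
Qed.

Lemma trunc_pow0 (M p : R) : 0 <= M -> 0 < p -> trunc_pow M p 0 = 0.
Proof. by move=> M0 p0; rewrite /trunc_pow normr0 min_l// powR0// gt_eqF. Qed.

Lemma trunc_powE (M p y : R) : `|y| <= M -> trunc_pow M p y = `|y| `^ p.
Proof. by move=> yM; rewrite /trunc_pow min_l. Qed.

End truncation.
Section within_continuity.
Context {R : realType} {N : nat}.
Implicit Types (I : set R) (u h : R -> 'rV[R]_N -> R).

Lemma within_uniform_continuousP I u :
  {within I, continuous (u : R -> {uniform 'rV[R]_N -> R})} <->
  forall t, I t -> forall e, 0 < e -> exists2 d, 0 < d &
    forall s, I s -> `|s - t| < d -> forall x, `|u s x - u t x| <= e.
Proof.
split => [cu t It e e0|H t].
  have /(_ [set g | forall x, `|g x - u t x| <= e])/= := cu t.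
  have unif : nbhs (u t : {uniform 'rV[R]_N -> R}) [set g | forall x, `|g x - u t x| <= e].
    apply/uniform_nbhs; exists [set xy | ball xy.1 e xy.2]; split.
      exact: entourage_ball (PosNum e0).
    move=> g /= H x; have := H x Logic.I.
    by rewrite -ball_normE/= distrC => /ltW.
  move=> /(_ unif).
  rewrite /nbhs/= -nbhs_subspace_in// => /nbhs_ballP[d /= d0 hd].
  by exists d => // s Is st x; apply: hd => //; rewrite -ball_normE/= distrC.
have [It|It] := pselect (I t); last first.
  by move=> P /nbhs_singleton Pt; rewrite /nbhs/= -nbhs_subspace_out//= => _ ->.
move=> P /uniform_nbhs[E [/=]]; rewrite -entourage_ballE => -[e /= e0 eE] EP.
rewrite /nbhs/= -nbhs_subspace_in//.
have [d d0 hd] := H t It _ (divr_gt0 e0 (ltr0n R 2)).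
apply/nbhs_ballP; exists d => // s st Is; apply: EP => x _.
apply: eE => /=; rewrite -ball_normE/= distrC.
rewrite (le_lt_trans (hd s Is _ x))//.
  by move: st; rewrite -ball_normE/= distrC.
by rewrite ltr_pdivrMr// ltr_pMr// ltr1n.
Qed.

(** Composition with clamp T freezes a curve given on [0, T] at its end values, which
    makes it a curve on the whole line. *)
Definition clamp (T t : R) := Num.max 0 (Num.min t T).

Lemma clamp_id T t : 0 <= t <= T -> clamp T t = t.
Proof. by move=> /andP[t0 tT]; rewrite /clamp min_l// max_r. Qed.

Lemma clamp_itv T t : 0 <= T -> 0 <= clamp T t <= T.
Proof.
by move=> T0; rewrite /clamp le_max lexx/= ge_max T0/= ge_min lexx orbT.
Qed.

Lemma clamp_dist T s t : `|clamp T s - clamp T t| <= `|s - t|.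
Proof.
have lipmax (a b : R) : `|Num.max 0 a - Num.max 0 b| <= `|a - b|.
  have h1 := ler_norm (a - b); have := ler_norm (b - a); rewrite distrC => h2.
  by case: (leP 0 a) => ?; case: (leP 0 b) => ?; rewrite ler_norml; lra.
have lipmin (a b : R) : `|Num.min a T - Num.min b T| <= `|a - b|.
  have h1 := ler_norm (a - b); have := ler_norm (b - a); rewrite distrC => h2.
  by case: (leP a T) => ?; case: (leP b T) => ?; rewrite ler_norml; lra.
exact: le_trans (lipmax _ _) (lipmin _ _).
Qed.

Lemma continuous_C0_clamp T u : 0 <= T -> continuous_C0 `[0, T] u ->
  C0_curve (fun t => u (clamp T t)).
Proof.
move=> T0 [u0 /within_uniform_continuousP cu].
have ct t : `[0, T]%classic (clamp T t) by rewrite /= in_itv; exact: clamp_itv.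
split => [t|t e e0]; first exact: u0.
have [d d0 hd] := cu _ (ct t) e e0; exists d => // s st x.
by apply: hd => //; exact: le_lt_trans (clamp_dist _ _ _) st.
Qed.

Lemma C0_curve_continuous_C0 I u h : C0_curve h -> (forall t, I t -> u t = h t) ->
  continuous_C0 I u.
Proof.
move=> [h0 ch] uh; split => [t It|]; first by rewrite uh.
apply/within_uniform_continuousP => t It e e0; have [d d0 hd] := ch t e e0.
by exists d => // s Is st x; rewrite !uh//; exact: hd.
Qed.

End within_continuity.

Section mild.
Context {R : realType} {N : nat}.
Local Notation leb := (@lebesgue_measure R).
Variables (u0 v0 w1 w2 : 'rV[R]_N -> R).
Hypotheses (hu0 : C0 u0) (hv0 : C0 v0) (hw1 : C0 w1) (hw2 : C0 w2).
Variables (sigma gamma p q : R).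
Hypotheses (hsigma : -1 < sigma) (hgamma : -1 < gamma) (hp : 1 < p) (hq : 1 < q).
Local Notation mild := (mild_solution u0 v0 w1 w2 sigma gamma p q).
Implicit Types (u v : R -> 'rV[R]_N -> R) (T : R).

Definition expo (b : bool) := if b then p else q.
Definition forcing_expo (b : bool) := if b then sigma else gamma.
Definition initial (b : bool) := if b then u0 else v0.
Definition forcing (b : bool) := if b then w1 else w2.

(** The contribution of the data, that is the mild solution of the problem without
    the nonlinear terms; the factors 1 match the linear combinations of C0_curve_lin. *)
Definition linear_part (b : bool) (t : R) (x : 'rV[R]_N) :=
  1 * heat t (initial b) x +
  1 * duhamel (fun s => s `^ forcing_expo b) (fun=> forcing b) t x.

Lemma weight_forcing b : weight (fun s : R => s `^ forcing_expo b).
Proof. by apply: weight_powR; case: b. Qed.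

Lemma C0_initial b : C0 (initial b). Proof. by case: b. Qed.
Lemma C0_forcing b : C0 (forcing b). Proof. by case: b. Qed.
Lemma expo_gt1 b : 1 < expo b. Proof. by case: b. Qed.

Lemma C0_curve_heat_cst (f : 'rV[R]_N -> R) : C0 f -> C0_curve (fun t => heat t f).
Proof. by move=> f0; apply: (C0_curve_heat (C0_curve_cst f0)) => x; exact: cvg_id. Qed.

Lemma C0_curve_linear_part b : C0_curve (linear_part b).
Proof.
apply: C0_curve_lin; first exact: C0_curve_heat_cst (C0_initial b).
by apply: C0_curve_duhamel; [exact: weight_forcing|exact: C0_curve_cst (C0_forcing b)].
Qed.

Definition pair_curve T u v (b : bool) (t : R) := (if b then u else v) (clamp T t).

Definition tpow M (b : bool) := trunc_pow M (expo b).

(** A common Lipschitz constant of the two truncated powers; the summand 1 keeps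
    it positive at M = 0. *)
Definition lipc M := p * M `^ (p - 1) + q * M `^ (q - 1) + 1.

Lemma lipc_gt0 M : 0 < lipc M.
Proof.
have p0 := lt_trans ltr01 hp; have q0 := lt_trans ltr01 hq.
by rewrite ltr_wpDl// addr_ge0// mulr_ge0 ?powR_ge0// ltW.
Qed.

Lemma tpow_lipschitz M : 0 <= M ->
  forall b x y, `|tpow M b x - tpow M b y| <= lipc M * `|x - y|.
Proof.
move=> M0 b x y.
have p0 := lt_trans ltr01 hp; have q0 := lt_trans ltr01 hq.
rewrite (le_trans (trunc_pow_lipschitz _ _ M0 (ltW (expo_gt1 b))))// ler_wpM2r//.
have h1 : 0 <= p * M `^ (p - 1) by rewrite mulr_ge0 ?powR_ge0// ltW.
have h2 : 0 <= q * M `^ (q - 1) by rewrite mulr_ge0 ?powR_ge0// ltW.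
by rewrite /lipc; case: b => /=; lra.
Qed.

Lemma tpow0 M : 0 <= M -> forall b, tpow M b 0 = 0.
Proof. by move=> M0 b; rewrite /tpow trunc_pow0// (lt_trans _ (expo_gt1 b)). Qed.

(** The bridge between the two formulations: below the truncation level M, the
    right-hand side of the mild equation is that of the truncated Volterra
    equation. *)
Lemma mild_rhsE M (z : bool -> R -> 'rV[R]_N -> R) u b t x : 0 <= t -> 0 <= M ->
  (forall b, C0_curve (z b)) ->
  (forall s, 0 <= s <= t -> u s = z (~~ b) s) ->
  (forall s y, 0 <= s <= t -> `|u s y| <= M) ->
  heat_semigroup t (initial b) x
    + \int[leb]_(s in `[0, t]) heat_semigroup (t - s) (fun y => `|u s y| `^ expo b) x
    + \int[leb]_(s in `[0, t]) (s `^ forcing_expo b * heat_semigroup (t - s) (forcing b) x) =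
  linear_part b t x + duhamel (fun=> 1) (nonlin (tpow M) z b) t x.
Proof.
move=> t0 M0 cz uz uM.
rewrite heat_semigroupE//; last exact: C0_continuous (C0_initial b).
rewrite /linear_part !mul1r -addrA -[RHS]addrA; congr (_ + _).
rewrite addrC; congr (_ + _); apply: eq_Rintegral => s;
  rewrite inE/= in_itv/= => /andP[s0 st].
  by rewrite heat_semigroupE ?subr_ge0//; exact: C0_continuous (C0_forcing b).
have st' : 0 <= s <= t by rewrite s0.
rewrite mul1r (_ : (fun y => _) = nonlin (tpow M) z b s); last first.
  by apply/funext => y; rewrite /nonlin -uz// /tpow trunc_powE// uM.
rewrite heat_semigroupE ?subr_ge0//.
apply: C0_continuous.
exact: (C0_curve_nonlin (tpow_lipschitz M0) (tpow0 M0) b cz).1.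
Qed.

Lemma mild_volterra M T u v : 0 <= T -> 0 <= M -> mild T u v ->
  (forall b s y, 0 <= s <= T -> `|pair_curve T u v b s y| <= M) ->
  volterra (tpow M) linear_part T (pair_curve T u v).
Proof.
move=> T0 M0 [cu cv e] bM b t tT x; have /andP[t0 t_T] := tT.
have sT s : 0 <= s <= t -> 0 <= s <= T.
  by move=> /andP[-> /=] /le_trans; apply.
have cz b' : C0_curve (pair_curve T u v b').
  by case: b'; exact: continuous_C0_clamp.
rewrite -(mild_rhsE (z := pair_curve T u v) (u := if b then v else u) x t0 M0)//.
- rewrite {1}/pair_curve clamp_id//; have [eu ev] := e t tT x.
  by case: b {bM}; [exact: eu|exact: ev].
- by move=> s /sT sT'; rewrite /pair_curve clamp_id//; case: b.
- move=> s y /sT sT'; have := bM (~~ b) s y sT'.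
  by rewrite /pair_curve clamp_id//; case: (b).
Qed.

Lemma volterra_mild M T (z : bool -> R -> 'rV[R]_N -> R) u v : 0 <= M ->
  (forall b, C0_curve (z b)) -> volterra (tpow M) linear_part T z ->
  (forall b s y, 0 <= s <= T -> `|z b s y| <= M) ->
  (forall s, 0 <= s <= T -> u s = z true s) ->
  (forall s, 0 <= s <= T -> v s = z false s) -> mild T u v.
Proof.
move=> M0 cz ez zM uz vz.
split.
- apply: C0_curve_continuous_C0 (cz true) _ => t; rewrite /= in_itv/=; exact: uz.
- apply: C0_curve_continuous_C0 (cz false) _ => t; rewrite /= in_itv/=; exact: vz.
- move=> t tT x; have /andP[t0 t_T] := tT.
  have sT s : 0 <= s <= t -> 0 <= s <= T.
    by move=> /andP[-> /=] /le_trans; apply.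
  split.
    rewrite uz// ez//; apply/esym; apply: (@mild_rhsE M z v true t x) => //.
    + by move=> s /sT; exact: vz.
    + by move=> s y /sT sT'; rewrite vz// zM.
  rewrite vz// ez//; apply/esym; apply: (@mild_rhsE M z u false t x) => //.
  + by move=> s /sT; exact: uz.
  + by move=> s y /sT sT'; rewrite uz// zM.
Qed.

Lemma mild_bounded T u v : 0 <= T -> mild T u v ->
  exists2 M, 0 < M & forall b s y, 0 <= s <= T -> `|pair_curve T u v b s y| <= M.
Proof.
move=> T0 [cu cv _].
have [M M0 hM] := C0_curve_bounded T (continuous_C0_clamp T0 cu).
have [K K0 hK] := C0_curve_bounded T (continuous_C0_clamp T0 cv).
exists (M + K); first exact: addr_gt0.
move=> [] s y sT; rewrite /pair_curve.
  by rewrite (le_trans (hM s sT y))// lerDl ltW.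
by rewrite (le_trans (hK s sT y))// lerDr ltW.
Qed.

Lemma C0_curve_pair T u v b : 0 <= T -> mild T u v -> C0_curve (pair_curve T u v b).
Proof. by move=> T0 [cu cv _]; case: b; exact: continuous_C0_clamp. Qed.

(** Two mild solutions on [0, T] are bounded, hence solve the same Volterra equation
    truncated at a common level. *)
Lemma mild_unique T u v u' v' : mild T u v -> mild T u' v' ->
  forall t, 0 <= t <= T -> u t = u' t /\ v t = v' t.
Proof.
move=> m m' t tT; have T0 : 0 <= T by case/andP: tT; exact: le_trans.
have [M M0 hM] := mild_bounded T0 m; have [K K0 hK] := mild_bounded T0 m'.
have MK0 : 0 <= M + K by rewrite addr_ge0// ltW.
have b1 b s y : 0 <= s <= T -> `|pair_curve T u v b s y| <= M + K.
  by move=> sT; rewrite (le_trans (hM b s y sT))// lerDl ltW.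
have b2 b s y : 0 <= s <= T -> `|pair_curve T u' v' b s y| <= M + K.
  by move=> sT; rewrite (le_trans (hK b s y sT))// lerDr ltW.
have e := volterra_unique (lipc_gt0 (M + K)) (tpow_lipschitz MK0) (tpow0 MK0)
  (fun b => C0_curve_pair b T0 m) (fun b => C0_curve_pair b T0 m')
  (mild_volterra T0 MK0 m b1) (mild_volterra T0 MK0 m' b2).
by split; apply/funext => x; [have := e true t tT x|have := e false t tT x];
  rewrite /pair_curve clamp_id.
Qed.

Lemma mild_sub T T' u v u' v' : mild T u v -> T' <= T ->
  (forall t, 0 <= t <= T' -> u' t = u t /\ v' t = v t) -> mild T' u' v'.
Proof.
move=> [[u_0 cu] [v_0 cv] e] T'T uv.
have sT s : 0 <= s <= T' -> 0 <= s <= T.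
  by move=> /andP[-> /=] /le_trans; apply.
split.
- split => [t|]; rewrite /= ?in_itv/=.
    by move=> tT; have [-> _] := uv _ tT; apply: u_0; rewrite /= in_itv/= sT.
  apply/within_uniform_continuousP => t; rewrite /= in_itv/= => tT ep ep0.
  have [|d d0 hd] := (within_uniform_continuousP _ _).1 cu t _ ep ep0.
    by rewrite /= in_itv/= sT.
  exists d => // s; rewrite /= in_itv/= => s_T st x.
  have [-> _] := uv _ tT; have [-> _] := uv _ s_T.
  by apply: hd => //; rewrite /= in_itv/= sT.
- split => [t|]; rewrite /= ?in_itv/=.
    by move=> tT; have [_ ->] := uv _ tT; apply: v_0; rewrite /= in_itv/= sT.
  apply/within_uniform_continuousP => t; rewrite /= in_itv/= => tT ep ep0.
  have [|d d0 hd] := (within_uniform_continuousP _ _).1 cv t _ ep ep0.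
    by rewrite /= in_itv/= sT.
  exists d => // s; rewrite /= in_itv/= => s_T st x.
  have [_ ->] := uv _ tT; have [_ ->] := uv _ s_T.
  by apply: hd => //; rewrite /= in_itv/= sT.
- move=> t tT x; have [eu ev] := e t (sT _ tT) x.
  have st s : s \in `[0, t]%classic -> 0 <= s <= T'.
    rewrite inE/= in_itv/= => /andP[-> st]; rewrite (le_trans st)//.
    by case/andP: tT.
  have Iv : \int[leb]_(s in `[0, t]) heat_semigroup (t - s) (fun y => `|v' s y| `^ p) x =
      \int[leb]_(s in `[0, t]) heat_semigroup (t - s) (fun y => `|v s y| `^ p) x.
    by apply: eq_Rintegral => s /st/uv[_ ->].
  have Iu : \int[leb]_(s in `[0, t]) heat_semigroup (t - s) (fun y => `|u' s y| `^ q) x =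
      \int[leb]_(s in `[0, t]) heat_semigroup (t - s) (fun y => `|u s y| `^ q) x.
    by apply: eq_Rintegral => s /st/uv[-> _].
  have [ut vt] := uv _ tT.
  have mid (a b b' c : R) : b = b' -> a + b + c = a + b' + c by move=> ->.
  rewrite ut vt; split.
    by apply: (etrans eu); apply: mid; exact: esym Iv.
  by apply: (etrans ev); apply: mid; exact: esym Iu.
Qed.

End mild.

(** * Local existence, continuation and the maximal solution *)

Section maximal.
Context {R : realType} {N : nat}.
Variables (u0 v0 w1 w2 : 'rV[R]_N -> R).
Hypotheses (hu0 : C0 u0) (hv0 : C0 v0) (hw1 : C0 w1) (hw2 : C0 w2).
Variables (sigma gamma p q : R).
Hypotheses (hsigma : -1 < sigma) (hgamma : -1 < gamma) (hp : 1 < p) (hq : 1 < q).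
Local Notation mild := (mild_solution u0 v0 w1 w2 sigma gamma p q).
Local Notation Tm := (Tmax u0 v0 w1 w2 sigma gamma p q).
Local Notation maximal := (maximal_solution u0 v0 w1 w2 sigma gamma p q).
Local Notation linpart := (linear_part u0 v0 w1 w2 sigma gamma).
Local Notation tp := (tpow p q).
Implicit Types (u v : R -> 'rV[R]_N -> R) (T : R).

Let uniq := @mild_unique R N u0 v0 w1 w2 hu0 hv0 hw1 hw2 sigma gamma p q hp hq.
Let linC0 := C0_curve_linear_part hu0 hv0 hw1 hw2 hsigma hgamma.

Lemma truncated_solution M : 0 <= M -> exists2 z : bool -> R -> 'rV[R]_N -> R,
  (forall b, C0_curve (z b)) & forall T, volterra (tp M) linpart T z.
Proof.
move=> M0; exact: (volterra_exists (lipc_gt0 hp hq M) (tpow_lipschitz hp hq M0)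
  (tpow0 hp hq M0) linC0).
Qed.

(** The global solution of the equation truncated one unit above the initial data
    starts strictly below the truncation, and stays there for a short time by
    continuity. *)
Lemma local_existence : exists2 T, 0 < T & exists u v, mild T u v.
Proof.
have [M1 M10 hM1] := C0_bounded hu0; have [M2 M20 hM2] := C0_bounded hv0.
pose M := M1 + M2 + 1; have M0 : 0 <= M by rewrite /M; lra.
have [z cz ez] := truncated_solution M0.
have z0 b x : `|z b 0 x| <= M1 + M2.
  have -> : z b 0 x = initial u0 v0 b x.
    have t00 : 0 <= (0:R) <= 0 by rewrite lexx.
    rewrite (ez 0 b 0 t00 x) /linear_part !duhamel_le0// heat_le0//.
    by rewrite mul1r mulr0 !addr0.
  case: b; first by rewrite (le_trans (hM1 x))// lerDl ltW.
  by rewrite (le_trans (hM2 x))// lerDr ltW.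
have [d1 d10 hd1] := (cz true).2 0 1 ltr01.
have [d2 d20 hd2] := (cz false).2 0 1 ltr01.
pose d := Num.min d1 d2 / 2.
have d0 : 0 < d by rewrite divr_gt0// lt_min d10.
have dd : d < Num.min d1 d2.
  by rewrite ltr_pdivrMr// ltr_pMr ?ltr1n// lt_min d10.
exists d => //; exists (z true), (z false).
apply: (volterra_mild hu0 hv0 hw1 hw2 hp hq M0 cz (ez d)) => // b s y /andP[s0 sd].
have : `|z b s y - z b 0 y| <= 1.
  have sdd : `|s - 0| < Num.min d1 d2 by rewrite subr0 ger0_norm// (le_lt_trans sd).
  move: sdd; rewrite lt_min => /andP[sd1 sd2].
  by case: b {z0}; [exact: hd1|exact: hd2].
move=> h; have := z0 b y; rewrite /M => h'.
by rewrite -[X in `|X|](subrK (z b 0 y)) (le_trans (ler_normD _ _))// addrC lerD.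
Qed.

(** Continuation: a bounded solution on [0, T) extends beyond T. The solution
    of the equation truncated one unit above the bound is global, agrees with
    the given one before T, and by continuity stays below the truncation for a
    little while after T. *)
Lemma continuation T K u v : 0 < T -> (forall t, 0 < t -> t < T -> mild t u v) ->
  (forall t x, 0 <= t < T -> `|u t x| <= K /\ `|v t x| <= K) ->
  exists2 T', T < T' & exists u' v', mild T' u' v'.
Proof.
move=> T0 muv bK.
have K0 : 0 <= K.
  by have [h _] := bK 0 0 (introT andP (conj (lexx _) T0)); exact: le_trans h.
have M0 : 0 <= K + 1 by rewrite addr_ge0.
have [z cz ez] := truncated_solution M0.
have zK b t x : 0 <= t < T -> `|z b t x| <= K.
  move=> /andP[t0 tT]; pose s := (t + T) / 2.
  have ts : t < s by rewrite /s; lra.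
  have sT : s < T by rewrite /s; lra.
  have s0 : 0 < s by exact: le_lt_trans ts.
  have ms := muv s s0 sT.
  have bs b' r y : 0 <= r <= s -> `|pair_curve s u v b' r y| <= K + 1.
    move=> rs; rewrite /pair_curve clamp_id//.
    have rT : 0 <= r < T by case/andP: rs => -> /= rs; exact: le_lt_trans sT.
    have [h1 h2] := bK r y rT.
    by case: b'; [rewrite (le_trans h1)// lerDl|rewrite (le_trans h2)// lerDl].
  have := volterra_unique (lipc_gt0 hp hq (K + 1)) (tpow_lipschitz hp hq M0)
    (tpow0 hp hq M0) cz (fun b => C0_curve_pair b (ltW s0) ms) (ez s)
    (mild_volterra hu0 hv0 hw1 hw2 hp hq (ltW s0) M0 ms bs).
  have ts' : 0 <= t <= s by rewrite t0 ltW.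
  move=> /(_ b t ts' x) ->; rewrite /pair_curve clamp_id//.
  have tT' : 0 <= t < T by rewrite t0.
  by have [h1 h2] := bK t x tT'; case: b.
have e20 : 0 < 1 / 2 :> R by lra.
have [d1 d10 hd1] := (cz true).2 T _ e20.
have [d2 d20 hd2] := (cz false).2 T _ e20.
pose d := Num.min (Num.min d1 d2) T.
have d0 : 0 < d by rewrite !lt_min d10 d20.
have hd b s y : `|s - T| < d -> `|z b s y - z b T y| <= 1 / 2.
  rewrite !lt_min -andbA => /and3P[s1 s2 _].
  by case: b; [exact: hd1|exact: hd2].
have dT : d <= T by rewrite ge_min lexx orbT.
have zM b s y : 0 <= s <= T + d / 2 -> `|z b s y| <= K + 1.
  move=> /andP[s0 sd]; have [sT|Ts] := ltP s T.
    by rewrite (le_trans (zK _ _ _ _)) ?s0// lerDl.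
  pose r := T - d / 2.
  have rT : 0 <= r < T by rewrite /r; apply/andP; split; lra.
  have h1 : `|r - T| < d by rewrite /r ltr_norml; apply/andP; split; lra.
  have h2 : `|s - T| < d by rewrite ltr_norml; apply/andP; split; lra.
  have := hd b r y h1; have := hd b s y h2; have := zK b r y rT.
  by rewrite !ler_norml; lra.
exists (T + d / 2); first by rewrite ltrDl divr_gt0.
exists (z true), (z false).
exact: (volterra_mild hu0 hv0 hw1 hw2 hp hq M0 cz (ez (T + d / 2)) zM).
Qed.

Lemma mild_le_Tmax T u v : 0 < T -> mild T u v -> (T%:E <= Tm)%E.
Proof. by move=> T0 m; apply: ereal_sup_ubound; exists T => //; split => //; exists u, v. Qed.

Lemma lt_Tmax_mild t : (t%:E < Tm)%E -> exists2 T, t < T & 0 < T /\ exists u v, mild T u v.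
Proof.
move=> /ereal_sup_gt[_ [T [T0 m] <-]]; rewrite lte_fin => tT.
by exists T.
Qed.

Lemma Tmax_gt0 : (0 < Tm)%E.
Proof.
have [T T0 [u [v m]]] := local_existence.
by apply: lt_le_trans (mild_le_Tmax T0 m); rewrite lte_fin.
Qed.

(** A mild solution on the closed interval [0, T] is bounded, so it can be continued;
    hence the supremum Tmax is not attained. *)
Lemma mild_lt_Tmax T u v : 0 < T -> mild T u v -> (T%:E < Tm)%E.
Proof.
move=> T0 m; have [K K0 hK] := mild_bounded (ltW T0) m.
have [t t0 tT|t x /andP[t0 tT]|T' TT' [u' [v' m']]] := @continuation T K u v T0.
- by apply: (mild_sub m (ltW tT)) => s _.
- have tT' : 0 <= t <= T by rewrite t0 ltW.
  have := hK true t x tT'; have := hK false t x tT'.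
  by rewrite /pair_curve clamp_id.
apply: lt_le_trans (mild_le_Tmax (lt_trans T0 TT') m').
by rewrite lte_fin.
Qed.

(** For each t < Tmax some mild solution reaches past t; its value at t is taken, and
    uniqueness makes all these choices consistent. *)
Lemma maximal_extension T u v : 0 < T -> mild T u v ->
  exists U V, maximal U V /\ forall t, 0 <= t <= T -> U t = u t /\ V t = v t.
Proof.
move=> T0 m.
have /choice[f hf] : forall t : R, exists z : R * (R -> 'rV[R]_N -> R) * (R -> 'rV[R]_N -> R),
    (t%:E < Tm)%E -> t < z.1.1 /\ mild z.1.1 z.1.2 z.2.
  move=> t; have [tT|tT] := boolP (t%:E < Tm)%E; last first.
    by exists (0, u, v).
  by have [T' tT' [T'0 [u' [v' m']]]] := lt_Tmax_mild tT; exists (T', u', v').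
pose U t := (f t).1.2 t; pose V t := (f t).2 t.
have agree T' u' v' t : mild T' u' v' -> (t%:E < Tm)%E -> 0 <= t <= T' ->
    U t = u' t /\ V t = v' t.
  move=> m' tTm /andP[t0 tT']; have [tf mf] := hf t tTm.
  pose s := Num.min (f t).1.1 T'.
  have ms : mild s u' v' by apply: (mild_sub m') => //; rewrite ge_min lexx orbT.
  have mfs : mild s (f t).1.2 (f t).2 by apply: (mild_sub mf) => //; rewrite ge_min lexx.
  by apply: (uniq mfs ms); rewrite t0 le_min tT' ltW.
exists U, V; split.
  move=> tau tau0 tauT; have [T' tT' [T'0 [u' [v' m']]]] := lt_Tmax_mild tauT.
  apply: (mild_sub m' (ltW tT')) => t /andP[t0 ttau].
  apply: (agree T') => //; last by rewrite t0 (le_trans ttau)// ltW.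
  by apply: le_lt_trans tauT; rewrite lee_fin.
move=> t /andP[t0 tT]; apply: (agree T) => //; last by rewrite t0.
by apply: le_lt_trans (mild_lt_Tmax T0 m); rewrite lee_fin.
Qed.

End maximal.

Section essential_sup.
Context {R : realType} {N : nat}.
Local Notation leb := (@lebesgue_measure R).

Lemma lebesgue_rV_ball_gt0 n (x : 'rV[R]_n) (e : R) : 0 < e ->
  (0 < lebesgue_rV n (ball x e))%E.
Proof.
move=> e0.
pose J i : set (measurableTypeR R) := `]x ord0 i - e, x ord0 i + e[%classic.
rewrite (_ : ball x e = [set y : 'rV[R]_n | forall i, J i (y ord0 i)]).
  rewrite (lebesgue_rV_box (A := J)); last by move=> i; exact: measurable_itv.
  elim/big_ind: _ => [|a b|i _]; [exact: lte01|exact: mule_gt0|].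
  rewrite lebesgue_measure_itv/= lte_fin ifT; last by lra.
  by rewrite -EFinB lte_fin; lra.
rewrite -ball_normE; apply/seteqP; split => y /=.
  move=> xy i; rewrite /J/= in_itv/= -ltr_distl distrC (le_lt_trans _ xy)//.
  by have := coord_le_norm (x - y) i; rewrite !mxE.
move=> H; apply: norm_rV_lt => // i; rewrite !mxE.
by have := H i; rewrite /J/= in_itv/= -ltr_distl distrC.
Qed.

(** A continuous function cannot exceed its essential supremum: the set where it
    does would contain a box, which has positive measure. *)
Lemma Loo_norm_ge (u : R -> 'rV[R]_N -> R) (A s t d : R) (x : 'rV[R]_N) :
  0 <= s -> 0 < d -> s + d <= t ->
  (forall r y, s < r < s + d -> `|x - y| < d -> A < `|u r y|) ->
  (A%:E <= Loo_norm t u)%E.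
Proof.
move=> s0 d0 sdt hA.
rewrite /Loo_norm unlock.
set mu := mrestr _ _.
pose B : set (measurableTypeR R * 'rV[R]_N) := `]s, s + d[%classic `*` ball x d.
have mB : measurable B by apply: measurableX => //; exact: measurable_ball_rV.
have muB : (0 < mu B)%E.
  rewrite /mu /mrestr (_ : B `&` _ = B); last first.
    apply/seteqP; split => [z []//|[r y] [/=]]; rewrite in_itv/= => /andP[sr rd] xy.
    split; first by split => //=; rewrite in_itv/= sr.
    split => //=; rewrite in_itv/=; apply/andP; split.
      exact: le_lt_trans sr.
    exact: lt_le_trans sdt.
  rewrite product_measure1E//; last exact: measurable_ball_rV.
  have leb0 : (0 < leb `]s, (s + d)%R[%classic)%E.
    by rewrite lebesgue_measure_itv/= lte_fin ltrDl d0 -EFinB lte_fin; lra.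
  exact: mule_gt0 leb0 (lebesgue_rV_ball_gt0 x d0).
have muT : (0 < mu setT)%E.
  by apply: lt_le_trans muB _; apply: le_measure; rewrite ?inE//.
rewrite muT leNgt; apply/negP => lt_A.
have [C [mC muC0 hC]] := ess_sup_ge mu (abse \o (EFin \o (fun z => u z.1 z.2))).
have : (mu B <= mu C)%E.
  apply: le_measure; rewrite ?inE//; move=> [r y] [/=]; rewrite in_itv/= => sr.
  rewrite -ball_normE/= => xy; apply: hC => /= /le_lt_trans /(_ lt_A).
  rewrite lte_fin ltNge => /negP; apply.
  by apply: ltW; apply: hA.
by move=> /(lt_le_trans muB); have -> : mu C = 0%E := muC0; rewrite ltxx.
Qed.

End essential_sup.

(** * Blow-up *)

Section blow_up.
Context {R : realType} {N : nat}.

Lemma C0_curve_gt_open (h : R -> 'rV[R]_N -> R) A s x : C0_curve h -> A < `|h s x| ->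
  exists2 d, 0 < d & forall r y, `|r - s| < d -> `|x - y| < d -> A < `|h r y|.
Proof.
move=> ch As; pose e := (`|h s x| - A) / 3.
have e0 : 0 < e by rewrite divr_gt0// subr_gt0.
have [d1 d10 hd1] := ch.2 s e e0.
have [d2 d20 hd2] := C0_unif_continuous (ch.1 s) e0.
exists (Num.min d1 d2); first by rewrite lt_min d10.
move=> r y; rewrite !lt_min => /andP[rs _] /andP[_ xy].
have h1 := hd1 _ rs y; have h2 := hd2 _ _ xy.
have h3 := lerB_dist (h s x) (h s y); have h4 := lerB_dist (h s y) (h r y).
have h5 : `|h s y - h r y| <= e by rewrite distrC.
have h6 : 3 * e = `|h s x| - A by rewrite /e; field.
by lra.
Qed.

Variables (u0 v0 w1 w2 : 'rV[R]_N -> R).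
Hypotheses (hu0 : C0 u0) (hv0 : C0 v0) (hw1 : C0 w1) (hw2 : C0 w2).
Variables (sigma gamma p q : R).
Hypotheses (hsigma : -1 < sigma) (hgamma : -1 < gamma) (hp : 1 < p) (hq : 1 < q).
Local Notation mild := (mild_solution u0 v0 w1 w2 sigma gamma p q).
Local Notation Tm := (Tmax u0 v0 w1 w2 sigma gamma p q).
Local Notation maximal := (maximal_solution u0 v0 w1 w2 sigma gamma p q).

(** A value exceeding A at time s keeps the essential supremum over (0, t) at least A
    for all t past s, hence for t close to T. *)
Lemma near_Loo_norm_ge (U V : R -> 'rV[R]_N -> R) (b : bool) T A s x : 0 < T ->
  (forall t, 0 < t -> t < T -> mild t U V) -> 0 <= s < T ->
  A < `|(if b then U else V) s x| ->
  \forall t \near T^'-, (A%:E <= Loo_norm t (if b then U else V))%E.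
Proof.
move=> T0 mUV /andP[s0 sT] As; pose tau := (s + T) / 2.
have st : s < tau by rewrite /tau; lra.
have tT : tau < T by rewrite /tau; lra.
have tau0 : 0 < tau by exact: le_lt_trans st.
have m := mUV _ tau0 tT.
have cp := C0_curve_pair b (ltW tau0) m.
have Ap : A < `|pair_curve tau U V b s x|.
  by rewrite /pair_curve clamp_id// s0 ltW.
have [d d0 hd] := C0_curve_gt_open cp Ap.
pose d' := Num.min d (tau - s).
have d'0 : 0 < d' by rewrite lt_min d0 subr_gt0.
have d't : s + d' <= tau by rewrite -lerBrDl ge_min lexx orbT.
near=> t; apply: (@Loo_norm_ge _ _ _ A s t d' x) => //.
  by rewrite (le_trans d't)// ltW//; near: t; exact: nbhs_left_gt.
move=> r y /andP[sr rd] xy.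
have rtau : 0 <= r <= tau.
  by apply/andP; split; [exact/ltW/(le_lt_trans s0)|exact/ltW/(lt_le_trans rd)].
have := hd r y; rewrite /pair_curve clamp_id//; apply.
  rewrite ger0_norm ?subr_ge0 ?(ltW sr)// ltrBlDl.
  by apply: lt_le_trans rd _; rewrite lerD2l ge_min lexx.
by apply: lt_le_trans xy _; rewrite ge_min lexx.
Unshelve. all: by end_near. Qed.

(** Otherwise U and V would be bounded on [0, Tmax) by some A, and continuation
    would produce a mild solution beyond Tmax. *)
Lemma blow_up (U V : R -> 'rV[R]_N -> R) : maximal U V -> (Tm < +oo)%E ->
  (Loo_norm t U + Loo_norm t V)%E @[t --> (fine Tm)^'-] --> +oo%E.
Proof.
move=> mx Tmoo; have Tm0 := Tmax_gt0 hu0 hv0 hw1 hw2 hsigma hgamma hp hq.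
have TmE : Tm = (fine Tm)%:E by rewrite fineK// gt0_fin_numE.
set T := fine Tm in TmE *.
have T0 : 0 < T by rewrite -lte_fin -TmE.
have mUV t : 0 < t -> t < T -> mild t U V.
  by move=> t0 tT; apply: mx => //; rewrite TmE lte_fin.
have Lge0 t (u : R -> 'rV[R]_N -> R) : (0 <= Loo_norm t u)%E by exact: Lnorm_ge0.
apply/cvgeyPge => A.
have [bA|] := pselect (forall t x, 0 <= t < T -> `|U t x| <= A /\ `|V t x| <= A).
  have [T' TT' [u' [v' m']]] :=
    continuation hu0 hv0 hw1 hw2 hsigma hgamma hp hq T0 mUV bA.
  have := mild_le_Tmax (lt_trans T0 TT') m'.
  by rewrite TmE lee_fin leNgt TT'.
move=> /existsNP[s /existsNP[x /not_implyP[sT /not_andP[]]]] /negP;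
  rewrite -ltNge => As.
- have nU := near_Loo_norm_ge (b := true) T0 mUV sT As.
  near=> t; have : (A%:E <= Loo_norm t U)%E by near: t; exact: nU.
  by move=> /le_trans; apply; exact: leeDl.
- have nV := near_Loo_norm_ge (b := false) T0 mUV sT As.
  near=> t; have : (A%:E <= Loo_norm t V)%E by near: t; exact: nV.
  by move=> /le_trans; apply; exact: leeDr.
Unshelve. all: by end_near. Qed.

End blow_up.

(** * Conservation of mass *)

Section mass.
Context {R : realType} {N : nat}.
Local Notation leb := (@lebesgue_measure R).
Local Notation mu := (@lebesgue_rV R N).
Implicit Types (f g : 'rV[R]_N -> R) (h : R -> 'rV[R]_N -> R).
Local Open Scope ereal_scope.

(** The integral with values in [0, +oo], so that finiteness of L^1 and L^r norms is
    a conclusion rather than a side condition. *)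
Definition mass f : \bar R := \int[mu]_x (f x)%:E.

Lemma mass_ge0 f : (forall x, 0 <= f x)%R -> 0 <= mass f.
Proof. by move=> f0; apply: integral_ge0 => x _; rewrite lee_fin. Qed.

Lemma heat_EFin t f x : C0 f -> (heat t f x)%:E =
  \int[mu]_z (heat_kernel 1 z * f (x + Num.sqrt t *: z))%:E.
Proof.
move=> f0; have [M _ fM] := C0_bounded f0.
rewrite /heat /gaussE /Rintegral fineK//.
apply: integrable_fin_num => //.
apply: (@integrable_gauss _ _ _ M) => //.
by apply: measurable_shift; exact: C0_continuous.
Qed.

(** By Tonelli and translation invariance. *)
Lemma mass_heat t f : C0 f -> (forall x, 0 <= f x)%R -> mass (heat t f) = mass f.
Proof.
move=> f0 f_ge0; have mf := continuous_measurable_rV (C0_continuous f0).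
rewrite /mass; under eq_integral do rewrite heat_EFin//.
pose g (w : 'rV[R]_N * 'rV[R]_N) :=
  (heat_kernel 1 w.2 * f (w.1 + Num.sqrt t *: w.2))%:E.
have g0 w : 0 <= g w by rewrite lee_fin mulr_ge0// ltW// heat_kernel_gt0.
have mg : measurable_fun setT g.
  apply/measurable_EFinP; apply: measurable_funM.
    apply: (@measurableT_comp _ _ _ _ _ _ (heat_kernel 1 : 'rV[R]_N -> R)) => //.
    exact: measurable_heat_kernel.
  apply: (@measurableT_comp _ _ _ _ _ _ f) => //.
  apply: measurable_fun_coordP => i; under eq_fun do rewrite !mxE.
  apply: measurable_funD.
    apply: (@measurableT_comp _ _ _ _ _ _ (fun x : 'rV[R]_N => x ord0 i)) => //.
    exact: measurable_coord.
  apply: measurable_funM => //.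
  apply: (@measurableT_comp _ _ _ _ _ _ (fun x : 'rV[R]_N => x ord0 i)) => //.
  exact: measurable_coord.
rewrite (fubini_tonelli (m1 := mu) (m2 := mu) g mg g0).
have inner z : \int[mu]_x g (x, z) = (heat_kernel 1 z)%:E * mass f.
  rewrite /g/=; under eq_integral do rewrite EFinM.
  rewrite ge0_integralZl//; last 3 first.
  - by apply/measurable_EFinP; apply: (@measurableT_comp _ _ _ _ _ _ f) => //;
      under eq_fun do rewrite addrC -[X in (_ + X)%R]scale1r; exact: measurable_affine_rV.
  - by move=> x _; rewrite lee_fin.
  - by rewrite lee_fin ltW// heat_kernel_gt0.
  congr (_ * _).
  have mEf : measurable_fun setT (EFin \o f) by exact/measurable_EFinP.
  have Ef0 x : 0 <= (EFin \o f) x by rewrite lee_fin.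
  have := ge0_integral_affine_rV (Num.sqrt t *: z) ltr01 mEf Ef0.
  rewrite expr1n mul1e; apply: etrans.
  by apply: eq_integral => x _ /=; rewrite scale1r addrC.
under eq_integral do rewrite inner.
rewrite ge0_integralZr//.
- by rewrite integral_heat_kernel1 mul1e.
- by apply/measurable_EFinP; exact: measurable_heat_kernel.
- by move=> z _; rewrite lee_fin ltW// heat_kernel_gt0.
- exact: mass_ge0.
Qed.

(** Tonelli, the inner integral being evaluated by mass conservation. *)
Lemma mass_duhamel k h t : weight k -> C0_curve h -> (forall s x, 0 <= h s x)%R ->
  mass (duhamel k h t) = \int[leb]_(s in `[0%R, t]) ((k s)%:E * mass (h s)).
Proof.
move=> wk ch h0; have [k0 mk ik] := wk.
have heat0 a s x : (0 <= heat a (h s) x)%R.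
  apply: Rintegral_ge0 => z _; rewrite mulr_ge0// ltW// heat_kernel_gt0//.
pose g (w : measurableTypeR R * 'rV[R]_N) :=
  (\1_`[0%R, t] w.1 * (k w.1 * heat (t - w.1) (h w.1) w.2))%:E.
have g0 w : 0 <= g w by rewrite lee_fin !mulr_ge0.
have mg : measurable_fun setT g.
  apply/measurable_EFinP; apply: measurable_funM.
    have mI : measurable (`[0%R, t]%classic : set (measurableTypeR R)) by exact: measurable_itv.
    by apply: (measurableT_comp (@measurable_indic _ (measurableTypeR R) R setT _ mI)).
  apply: measurable_funM.
    by apply: (@measurableT_comp _ _ _ _ _ _ (k : measurableTypeR R -> R)).
  apply: (continuous_measurable_prod (f := fun w => heat (t - w.1) (h w.1) w.2)).
  exact: (C0_curve_continuous2 (C0_curve_heat_back t ch)).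
transitivity (\int[mu]_x \int[leb]_s g (s, x)).
  apply: eq_integral => x _; rewrite /duhamel /Rintegral fineK; last first.
    by apply: integrable_fin_num => //; exact: integrable_duhamel.
  rewrite integral_mkcond; apply: eq_integral => s _.
  by rewrite /g/= patchE indicE; case: ifPn => _; rewrite ?mul1r ?mul0r.
rewrite -(fubini_tonelli (m1 := leb) (m2 := mu) g mg g0).
rewrite [RHS]integral_mkcond; apply: eq_integral => s _.
rewrite /g patchE/= indicE; case: ifPn => _; last first.
  by under eq_integral do rewrite mul0r; rewrite integral0.
under eq_integral do rewrite mul1r EFinM.
rewrite ge0_integralZl//.
- by congr (_ * _); rewrite -(mass_heat (t - s) (ch.1 s) (h0 s)).
- apply/measurable_EFinP; apply: continuous_measurable_rV.
  exact: C0_continuous (C0_heat _ (ch.1 s)).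
- by move=> x _; rewrite lee_fin.
- by rewrite lee_fin.
Qed.

Lemma massD f g (a b : R) : continuous f -> continuous g ->
  (forall x, 0 <= f x)%R -> (forall x, 0 <= g x)%R -> (0 <= a)%R -> (0 <= b)%R ->
  mass (fun x => a * f x + b * g x)%R = a%:E * mass f + b%:E * mass g.
Proof.
move=> cf cg f0 g0 a0 b0.
have mf := continuous_measurable_rV cf; have mg := continuous_measurable_rV cg.
rewrite /mass; under eq_integral do rewrite EFinD !EFinM.
rewrite ge0_integralD//.
- rewrite ge0_integralZl//; [|exact/measurable_EFinP|by move=> x _; rewrite lee_fin].
  by rewrite ge0_integralZl//; [exact/measurable_EFinP|move=> x _; rewrite lee_fin].
- by move=> x _; rewrite mule_ge0// lee_fin.
- by apply: measurable_funeM; exact/measurable_EFinP.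
- by move=> x _; rewrite mule_ge0// lee_fin.
- by apply: measurable_funeM; exact/measurable_EFinP.
Qed.

Lemma measurable_mass h (A : set (measurableTypeR R)) : C0_curve h ->
  (forall s x, 0 <= h s x)%R -> measurable_fun A (fun s => mass (h s)).
Proof.
move=> ch h0; apply: measurable_funTS.
pose g (w : measurableTypeR R * 'rV[R]_N) := (h w.1 w.2)%:E.
have mg : measurable_fun setT g.
  apply/measurable_EFinP.
  by apply: (continuous_measurable_prod (f := fun w => h w.1 w.2)); exact: C0_curve_continuous2.
have g0 w : 0 <= g w by rewrite lee_fin.
exact: (@measurable_fun_fubini_tonelli_F _ _ _ _ _ mu g mg g0).
Qed.

(** The time integral of mass_duhamel is split at t'. *)
Lemma mass_duhamel_split k h t t' T m : weight k -> C0_curve h ->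
  (forall s x, 0 <= h s x)%R -> (0 <= t')%R -> (t' <= t)%R -> (t <= T)%R ->
  (forall s, (0 <= s <= T)%R -> mass (h s) <= m%:E) ->
  mass (duhamel k h t') <= mass (duhamel k h t) <=
    mass (duhamel k h t') + (m * Rintegral leb `]t', t] k)%:E.
Proof.
move=> wk ch h0 t'0 t't tT hm; have [k0 mk ik] := wk.
have km0 s : 0 <= (k s)%:E * mass (h s).
  by rewrite mule_ge0 ?lee_fin//; exact: mass_ge0.
have mkm (A : set (measurableTypeR R)) : measurable_fun A (fun s => (k s)%:E * mass (h s)).
  apply: emeasurable_funM; last exact: measurable_mass.
  by apply/measurable_EFinP; exact: measurable_funTS.
have transport (a a' b b' c : \bar R) : a = a' -> b = b' ->
  b' <= a' <= b' + c -> b <= a <= b + c by move=> -> ->.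
apply: (transport _ _ _ _ _ (mass_duhamel t wk ch h0) (mass_duhamel t' wk ch h0)).
have -> : \int[leb]_(s in `[0%R, t]) ((k s)%:E * mass (h s)) =
    \int[leb]_(s in `[0%R, t']) ((k s)%:E * mass (h s)) +
    \int[leb]_(s in `]t', t]) ((k s)%:E * mass (h s)).
  rewrite (@itv_bndbnd_setU _ _ _ (BRight t')) ?bnd_simp// ge0_integral_setU//=.
  apply/disj_setPS => y [/=]; rewrite 2!in_itv/= => /andP[_ yt] /andP[].
  by rewrite ltNge yt.
rewrite leeDl ?integral_ge0//= leeD2l//.
have ikt : leb.-integrable `]t', t] (EFin \o k).
  apply: (@integrableS _ _ _ leb `[0%R, t]) => //.
  by apply: subset_itvr; rewrite bnd_simp.
rewrite EFinM /Rintegral fineK; last exact: integrable_fin_num.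
rewrite -ge0_integralZl//.
- apply: ge0_le_integral => //.
  + by apply: measurable_funeM; apply/measurable_EFinP; exact: measurable_funTS.
  + move=> s; rewrite /= in_itv/= => /andP[t's st].
    rewrite muleC lee_wpmul2r ?lee_fin// hm// (le_trans t'0 (ltW t's))/=.
    exact: le_trans st tT.
- by apply/measurable_EFinP; exact: measurable_funTS.
- by move=> s _; rewrite lee_fin.
- apply: le_trans (hm 0%R _); first exact: mass_ge0.
  by rewrite lexx/= (le_trans t'0)// (le_trans t't).
Qed.

End mass.

(** * Powers of averages *)

Section power_inequalities.
Context {R : realType}.
Implicit Types (a b c r : R).

Lemma powRS a r : 0 < a -> a `^ r = a * a `^ (r - 1).
Proof.
move=> a0; rewrite -{2}(powRr1 (ltW a0)) -powRD; last by apply/implyP => _; rewrite gt_eqF.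
by rewrite addrC subrK.
Qed.

Lemma powR_add3 a b c r : 0 <= a -> 0 <= b -> 0 <= c -> 0 <= r ->
  (a + b + c) `^ r <= 3 `^ r * (a `^ r + b `^ r + c `^ r).
Proof.
move=> a0 b0 c0 r0.
(* To be used with x the largest of the three numbers. *)
have step x : 0 <= x -> a <= x -> b <= x -> c <= x -> (a + b + c) `^ r <= 3 `^ r * x `^ r.
  move=> x0 ax bx cx; rewrite -powRM//; apply: ge0_ler_powR => //; rewrite ?nnegrE.
  - by rewrite !addr_ge0.
  - by rewrite mulr_ge0.
  - by lra.
have pa := powR_ge0 a r; have pb := powR_ge0 b r; have pc := powR_ge0 c r.
have p3 := powR_ge0 3 r.
case: (leP a b) => [ab|/ltW ba].
  case: (leP b c) => [bc|/ltW cb].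
    rewrite (le_trans (step c c0 (le_trans ab bc) bc (lexx _)))// ler_wpM2l//.
    by rewrite lerDr addr_ge0.
  rewrite (le_trans (step b b0 ab (lexx _) cb))// ler_wpM2l//.
  by rewrite addrAC lerDr addr_ge0.
case: (leP a c) => [ac|/ltW ca].
  rewrite (le_trans (step c c0 ac (le_trans ba ac) (lexx _)))// ler_wpM2l//.
  by rewrite lerDr addr_ge0.
rewrite (le_trans (step a a0 (lexx _) ba ca))// ler_wpM2l//.
by rewrite -addrA lerDl addr_ge0.
Qed.

(** An affine majorant of the identity in terms of the r-th power. It passes through
    any averaging operator; young_power then optimises over l. The pair plays the
    role of Jensen's inequality, with the constant 2^r instead of 1. *)
Lemma young_split a l r : 0 <= a -> 0 < l -> 1 <= r ->
  a <= l + (l `^ (r - 1))^-1 * a `^ r.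
Proof.
move=> a0 l0 r1; have pl : 0 < l `^ (r - 1) by rewrite powR_gt0.
have [al|la] := leP a l.
  by rewrite (le_trans al)// lerDl mulr_ge0 ?powR_ge0// invr_ge0 ltW.
have a_gt0 : 0 < a by exact: lt_trans la.
apply: (@le_trans _ _ ((l `^ (r - 1))^-1 * a `^ r)); last by rewrite lerDr ltW.
rewrite mulrC ler_pdivlMr//.
rewrite (powRS _ a_gt0) ler_wpM2l//; apply: ge0_ler_powR; rewrite ?nnegrE ?subr_ge0//.
  exact: ltW.
exact: ltW.
Qed.

Lemma young_power i j m r : 0 <= i -> 0 <= j -> 0 < m -> 1 <= r ->
  (forall l, 0 < l -> i <= l * m + (l `^ (r - 1))^-1 * j) ->
  i `^ r <= 2 `^ r * m `^ (r - 1) * j.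
Proof.
move=> i0 j0 m0 r1 H; have r0 : 0 < r by exact: lt_le_trans r1.
move: i0; rewrite le_eqVlt => /predU1P[<-|i0].
  by rewrite powR0 ?gt_eqF// !mulr_ge0// powR_ge0.
(* With this l, the term l * m absorbs exactly half of i. *)
pose l := i / (2 * m).
have l0 : 0 < l by rewrite divr_gt0// mulr_gt0.
have iE : i = 2 * (m * l) by rewrite /l; field; rewrite gt_eqF.
have pl : 0 < l `^ (r - 1) by rewrite powR_gt0.
have : l * m <= (l `^ (r - 1))^-1 * j.
  by have := H l l0; rewrite {1}iE; lra.
rewrite mulrC [leRHS]mulrC ler_pdivlMr// => mlj.
have ml0 : 0 <= m * l by rewrite mulr_ge0// ltW.
rewrite iE (powRM _ _ ml0)// (powRM _ (ltW m0) (ltW l0)).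
rewrite -[leRHS]mulrA ler_wpM2l ?powR_ge0// (powRS r m0) (powRS r l0).
have -> : m * m `^ (r - 1) * (l * l `^ (r - 1)) = m `^ (r - 1) * (m * l * l `^ (r - 1)) by ring.
by rewrite ler_wpM2l ?powR_ge0.
Qed.

End power_inequalities.

Section power_averages.
Context {R : realType} {N : nat}.
Local Notation leb := (@lebesgue_measure R).
Implicit Types (f g : 'rV[R]_N -> R) (k : R -> R) (h hr : R -> 'rV[R]_N -> R).

Lemma gaussE_affine (phi : 'rV[R]_N -> R) a b M : measurable_fun setT phi ->
  (forall z, `|phi z| <= M) -> gaussE (fun z => a + b * phi z) = a + b * gaussE phi.
Proof.
move=> mphi phiM.
have M0 : 0 <= M by exact: le_trans (phiM 0).
have bM z : `|- b * phi z| <= `|b| * M by rewrite normrM normrN ler_wpM2l.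
transitivity (gaussE (fun z => a - - b * phi z)).
  by congr gaussE; apply/funext => z; rewrite mulNr opprK.
have /= := @gaussEB R N (fun=> a) (fun z => - b * phi z) `|a| (`|b| * M).
move=> ->//; last exact: measurable_funM.
rewrite gaussE_cst /gaussE; under eq_Rintegral do rewrite mulrCA.
by rewrite RintegralZl ?mulNr ?opprK//; exact: integrable_gauss phiM.
Qed.

Lemma heat_affine_le f g a b t x : C0 f -> C0 g -> (forall y, f y <= a + b * g y) ->
  heat t f x <= a + b * heat t g x.
Proof.
move=> f0 g0 fg; have [M M0 fM] := C0_bounded f0; have [K K0 gK] := C0_bounded g0.
have mg := measurable_shift t x (C0_continuous g0).
rewrite /heat -(gaussE_affine a b mg (fun z => gK _)).
apply: (le_gaussE (M := M) (K := `|a| + `|b| * K)) => //.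
- exact: measurable_shift (C0_continuous f0).
- by apply: measurable_funD => //; exact: measurable_funM.
- by move=> z; rewrite (le_trans (ler_normD _ _))// lerD2l normrM ler_wpM2l.
Qed.

Lemma heat_ge0 f t (x : 'rV[R]_N) : (forall y, 0 <= f y) -> 0 <= heat t f x.
Proof. by move=> f0; apply: Rintegral_ge0 => z _; rewrite mulr_ge0// ltW// heat_kernel_gt0. Qed.

Lemma duhamel_ge0 k h t (x : 'rV[R]_N) : (forall s, 0 <= k s) ->
  (forall s y, 0 <= h s y) -> 0 <= duhamel k h t x.
Proof. by move=> k0 h0; apply: Rintegral_ge0 => s _; rewrite mulr_ge0// heat_ge0. Qed.

Lemma duhamel_affine_le k h hr a b t x : weight k -> C0_curve h -> C0_curve hr ->
  (forall s y, 0 <= s <= t -> h s y <= a + b * hr s y) ->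
  duhamel k h t x <= a * \int[leb]_(s in `[0, t]) k s + b * duhamel k hr t x.
Proof.
move=> wk ch chr hhr; have [k0 mk ik] := wk.
have i1 := integrable_duhamel t x t wk chr.
have i2 := ik t.
have j1 : leb.-integrable `[0, t] (EFin \o (fun s => a * k s)).
  by apply: (integrableZl _ a i2).
have j2 : leb.-integrable `[0, t] (EFin \o (fun s => b * (k s * heat (t - s) (hr s) x))).
  by apply: (integrableZl _ b i1).
rewrite /duhamel -RintegralZl// -RintegralZl// -RintegralD//.
apply: le_Rintegral => //.
- exact: integrable_duhamel.
- by apply: (integrableD _ j1 j2).
- move=> s; rewrite /= in_itv/= => st.
  have -> : a * k s + b * (k s * heat (t - s) (hr s) x) =
      k s * (a + b * heat (t - s) (hr s) x) by ring.
  rewrite ler_wpM2l//; apply: heat_affine_le (ch.1 s) (chr.1 s) _ => y.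
  exact: hhr.
Qed.

(** Jensen for the Gaussian average, up to the factor 2^r. *)
Lemma heat_power f g t x r : 1 <= r -> C0 f -> C0 g -> (forall y, 0 <= f y) ->
  (forall y, g y = f y `^ r) -> heat t f x `^ r <= 2 `^ r * heat t g x.
Proof.
move=> r1 f0 g0 f_ge0 gE.
have g_ge0 y : 0 <= g y by rewrite gE powR_ge0.
suff : heat t f x `^ r <= 2 `^ r * 1 `^ (r - 1) * heat t g x by rewrite powR1 mulr1.
apply: young_power => // [||l l0]; [exact: heat_ge0|exact: heat_ge0|].
rewrite mulr1; apply: heat_affine_le => // y; rewrite gE.
exact: young_split.
Qed.

(** Jensen for the average over [0, t] with weight k of total mass at most m, up to
    the factor 2^r. *)
Lemma duhamel_power k h hr t x r m : 1 <= r -> weight k -> C0_curve h -> C0_curve hr ->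
  (forall s y, 0 <= h s y) -> (forall s y, 0 <= hr s y) ->
  (forall s y, 0 <= s <= t -> hr s y = h s y `^ r) ->
  0 < m -> \int[leb]_(s in `[0, t]) k s <= m ->
  duhamel k h t x `^ r <= 2 `^ r * m `^ (r - 1) * duhamel k hr t x.
Proof.
move=> r1 wk ch chr h0 hr0 hrE m0 km; have [k0 mk ik] := wk.
apply: young_power => // [||l l0]; [exact: duhamel_ge0|exact: duhamel_ge0|].
apply: le_trans (duhamel_affine_le (a := l) (b := (l `^ (r - 1))^-1) x wk ch chr _) _.
  by move=> s y st; rewrite hrE//; exact: young_split.
by rewrite lerD2r ler_wpM2l// ltW.
Qed.

Lemma norm_heat_le_heat f g t x : C0 f -> C0 g -> (forall y, `|f y| <= g y) ->
  `|heat t f x| <= heat t g x.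
Proof.
move=> f0 g0 fg; have [M M0 fM] := C0_bounded f0; have [K K0 gK] := C0_bounded g0.
have mf := measurable_shift t x (C0_continuous f0).
have i1 := integrable_gauss mf (fun z => fM _).
have i2 := integrable_gauss (measurable_shift t x (C0_continuous g0)) (fun z => gK _).
rewrite /heat /gaussE (le_trans (le_normr_Rintegral _ i1))//.
apply: le_Rintegral => //; first exact: (integrable_abse i1).
move=> z _; rewrite normrM gtr0_norm ?heat_kernel_gt0// ler_wpM2l//.
by rewrite ltW// heat_kernel_gt0.
Qed.

Lemma norm_duhamel_le k h hr t x : weight k -> C0_curve h -> C0_curve hr ->
  (forall s y, 0 <= s <= t -> `|h s y| <= hr s y) ->
  `|duhamel k h t x| <= duhamel k hr t x.
Proof.
move=> wk ch cg hg; have [k0 mk ik] := wk.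
have i1 := integrable_duhamel t x t wk ch.
rewrite /duhamel (le_trans (le_normr_Rintegral _ i1))//.
apply: le_Rintegral => //; first exact: (integrable_abse i1).
  exact: integrable_duhamel.
move=> s; rewrite /= in_itv/= => st.
rewrite normrM ger0_norm// ler_wpM2l//.
by apply: norm_heat_le_heat (ch.1 s) (cg.1 s) _ => y; exact: hg.
Qed.

Lemma duhamelZ k h c t (x : 'rV[R]_N) : weight k -> C0_curve h ->
  duhamel k (fun s y => c * h s y) t x = c * duhamel k h t x.
Proof.
move=> wk ch; rewrite /duhamel -RintegralZl//; last exact: integrable_duhamel.
apply: eq_Rintegral => s _; rewrite mulrCA; congr (_ * _).
have [M M0 hM] := C0_bounded (ch.1 s).
have mh := measurable_shift (t - s) x (C0_continuous (ch.1 s)).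
have := gaussE_affine 0 c mh (fun z => hM _); rewrite add0r => <-.
by congr gaussE; apply/funext => z; rewrite add0r.
Qed.

End power_averages.

(** * Subsolutions of the linear Volterra equation *)

Section mass_limits.
Context {R : realType} {N : nat}.
Implicit Types (f g : 'rV[R]_N -> R).

Lemma massZ f (a : R) : continuous f -> (forall x, 0 <= f x) -> 0 <= a ->
  mass (fun x => a * f x) = (a%:E * mass f)%E.
Proof.
move=> cf f0 a0; rewrite /mass; under eq_integral do rewrite EFinM.
rewrite ge0_integralZl//; last by move=> x _; rewrite lee_fin.
by apply/measurable_EFinP; exact: continuous_measurable_rV.
Qed.

Lemma limn_einf_le (u : (\bar R)^nat) (m : \bar R) :
  (forall n, (u n <= m)%E) -> (limn_einf u <= m)%E.
Proof.
move=> um; rewrite limn_einf_lim; apply: lime_le; first exact: is_cvg_einfs.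
apply: nearW => n; apply: le_trans (um n).
by apply: ereal_inf_lbound; exists n => //=.
Qed.

(** The functions min(f, P n) converge to f pointwise, so that Fatou applies with the
    limit f itself. *)
Lemma mass_fatou f (P : nat -> 'rV[R]_N -> R) (c : R) (m : \bar R) : continuous f ->
  (forall n, continuous (P n)) -> (forall x, 0 <= f x) -> (forall n x, 0 <= P n x) ->
  (forall n x, f x <= P n x + c / 2 ^+ n) -> (forall n, (mass (P n) <= m)%E) ->
  (mass f <= m)%E.
Proof.
move=> cf cP f0 P0 fP Pm.
have mf := continuous_measurable_rV cf.
have mP n := continuous_measurable_rV (cP n).
pose g n x := (Num.min (f x) (P n x))%:E.
have mg n : measurable_fun setT (g n).
  by apply/measurable_EFinP; exact: measurable_minr.
have g0 n x : (0 <= g n x)%E by rewrite lee_fin le_min f0 P0.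
have gf x : limn_einf (g^~ x) = (f x)%:E.
  apply: (cvg_limn_einf_sup _).1; apply: cvg_EFin; first exact: nearW.
  apply/cvgrPdist_le => e e0; have [n cn] := geometric_small `|c| e0.
  exists n => // k /= nk.
  have ck : c / 2 ^+ k <= e.
    apply: le_trans cn; apply: (@le_trans _ _ (`|c| / 2 ^+ k)).
      by rewrite ler_wpM2r ?invr_ge0 ?exprn_ge0// ler_norm.
    rewrite ler_wpM2l// lef_pV2 ?posrE ?exprn_gt0//.
    by rewrite ler_eXn2l ?ltr1n.
  have := fP k x; case: (leP (f x) (P k x)) => h1 h2.
    by rewrite subrr normr0 ltW.
  by rewrite ger0_norm ?subr_ge0 ?(ltW h1)//; lra.
rewrite /mass; under eq_integral do rewrite -gf.
apply: le_trans (fatou _ _ _ _) _ => //.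
apply: limn_einf_le => n; apply: le_trans (Pm n).
apply: ge0_le_integral => //; first exact/measurable_EFinP.
by move=> x _; rewrite lee_fin ge_min lexx orbT.
Qed.

End mass_limits.

Section linear_gronwall.
Context {R : realType} {N : nat}.
Local Notation leb := (@lebesgue_measure R).
Variable L : R.
Hypothesis L0 : 0 < L.
Local Notation V := (duhamel (fun=> (1:R))).
Implicit Types (F u w y : bool -> R -> 'rV[R]_N -> R).

(** The linear nonlinearity, which makes the Picard theory available for linear
    comparison problems. *)
Definition linmap (_ : bool) (a : R) := L * a.

Lemma linmap_lipschitz b a a' : `|linmap b a - linmap b a'| <= L * `|a - a'|.
Proof. by rewrite /linmap -mulrBr normrM (gtr0_norm L0). Qed.

Lemma linmap0 b : linmap b 0 = 0. Proof. by rewrite /linmap mulr0. Qed.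

(** From max(a, b) = (a + b + |a - b|) / 2. *)
Lemma C0_curve_max (g h : R -> 'rV[R]_N -> R) : C0_curve g -> C0_curve h ->
  C0_curve (fun t x => Num.max (g t x) (h t x)).
Proof.
move=> cg ch.
have cabs : C0_curve (fun t x => `|1 * g t x + (-1) * h t x|).
  apply: (@C0_curve_lipschitz _ _ Num.norm 1); last 2 first.
  - exact: normr0.
  - exact: C0_curve_lin.
  by move=> a b; rewrite mul1r; exact: ler_dist_dist.
have -> : (fun t x => Num.max (g t x) (h t x)) = (fun t x =>
    1 * (1 / 2 * g t x + 1 / 2 * h t x) + 1 / 2 * `|1 * g t x + (-1) * h t x|).
  by apply/funext => t; apply/funext => x; rewrite maxr_absE !mul1r mulN1r; field.
exact: C0_curve_lin (C0_curve_lin _ _ cg ch) cabs.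
Qed.

(** One-sided Gronwall lemma, by iterating the inequality: the Duhamel operator is
    order preserving, and the contraction halves the error at each step. *)
Lemma subsolution_le_picard F y c T : (forall b, C0_curve (F b)) ->
  (forall b, C0_curve (y b)) -> 0 <= c ->
  (forall b s x, 0 <= s <= T -> y b s x <= c) ->
  (forall b s x, 0 <= s <= T -> 0 <= F b s x) ->
  (forall b t x, 0 <= t <= T -> y b t x <= F b t x + V (nonlin linmap y b) t x) ->
  forall n b t x, 0 <= t <= T ->
    y b t x <= picard linmap F n b t x + c / 2 ^+ n * expR (2 * L * t).
Proof.
move=> cF cy c0 yc F0 yF.
have cP n b := @C0_curve_picard R N linmap L linmap_lipschitz linmap0 F n b cF.
elim=> [|n IH] b t x tT; have /andP[t0 t_T] := tT.
  rewrite expr0 divr1 (le_trans (yc _ _ _ tT))//.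
  rewrite (@le_trans _ _ (c * expR (2 * L * t)))//.
    by rewrite ler_peMr// expR_ge1// mulr_ge0// mulr_ge0// ltW.
  by rewrite lerDr; exact: F0.
(* The contraction needs a two-sided bound. The maximum w of y and the n-th iterate
   lies above that iterate, and above it by no more than the error for y. *)
pose w b t x := Num.max (y b t x) (picard linmap F n b t x).
have cw b' : C0_curve (w b') by exact: C0_curve_max.
have cnl u b' : (forall b, C0_curve (u b)) -> C0_curve (nonlin linmap u b').
  exact: (C0_curve_nonlin linmap_lipschitz linmap0).
have yw : V (nonlin linmap y b) t x <= V (nonlin linmap w b) t x.
  apply: le_duhamel; [exact: weight_cst1|exact: cnl|exact: cnl|].
  by move=> s st y'; rewrite /nonlin /linmap ler_wpM2l ?(ltW L0)// le_max lexx.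
have c2n : 0 <= c / 2 ^+ n by rewrite divr_ge0// exprn_ge0.
have wP : `|V (nonlin linmap w b) t x - V (nonlin linmap (picard linmap F n) b) t x|
    <= c / 2 ^+ n / 2 * expR (2 * L * t).
  apply: (nonlin_contraction L0 linmap_lipschitz linmap0) => // b' s y' /andP[s0 st].
  have sT : 0 <= s <= T by rewrite s0 (le_trans st).
  have := IH b' s y' sT; rewrite /w.
  case: (leP (y b' s y') (picard linmap F n b' s y')) => h1 h2.
    by rewrite subrr normr0 mulr_ge0 ?expR_ge0.
  by rewrite ger0_norm ?subr_ge0 ?(ltW h1)// lerBlDl.
rewrite picardS (le_trans (yF b t x tT))// -addrA lerD2l (le_trans yw)//.
rewrite exprSr invfM mulrA.
have := le_trans (ler_norm _) wP.
by rewrite lerBlDl.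
Qed.

Lemma picard_ge0 F : (forall b s x, 0 <= F b s x) ->
  forall n b s x, 0 <= picard linmap F n b s x.
Proof.
move=> F0; elim=> [|n IH] b s x; first exact: F0.
rewrite picardS addr_ge0// duhamel_ge0// => s' y'.
by rewrite /nonlin /linmap mulr_ge0// ltW.
Qed.

(** The bound reproduces itself: with mass 2 l e^(2Ls) at time s, the Duhamel term has
    mass at most the integral of 2 l L e^(2Ls), that is at most l e^(2Lt), which leaves
    room for the mass l of F. *)
Lemma mass_picard_le F l T : (forall b, C0_curve (F b)) ->
  (forall b s x, 0 <= F b s x) -> 0 <= l ->
  (forall b s, 0 <= s <= T -> (mass (F b s) <= l%:E)%E) ->
  forall n b t, 0 <= t <= T ->
    (mass (picard linmap F n b t) <= (2 * l * expR (2 * L * t))%:E)%E.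
Proof.
move=> cF F0 l0 Fl.
have cP n b := @C0_curve_picard R N linmap L linmap_lipschitz linmap0 F n b cF.
have P0 := picard_ge0 F0.
have e1 t : 0 <= t -> 1 <= expR (2 * L * t).
  by move=> t0; rewrite expR_ge1// mulr_ge0// mulr_ge0// ltW.
elim=> [|n IH] b t tT; have /andP[t0 t_T] := tT.
  apply: le_trans (Fl b t tT) _; rewrite lee_fin.
  rewrite (@le_trans _ _ (2 * l))//; first by lra.
  by rewrite ler_peMr ?e1// mulr_ge0.
have cn : C0_curve (nonlin linmap (picard linmap F n) b).
  exact: (C0_curve_nonlin linmap_lipschitz linmap0).
have n0 s x : 0 <= nonlin linmap (picard linmap F n) b s x.
  by rewrite /nonlin /linmap mulr_ge0// ltW.
have cV := C0_curve_duhamel (weight_cst1 (R := R)) cn.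
have massV : (mass (V (nonlin linmap (picard linmap F n) b) t) <=
    (l * expR (2 * L * t))%:E)%E.
  apply: (@le_trans _ _
    (\int[leb]_(s in `[0%R, t]) (1 * (L * (2 * l) * expR (2 * L * s)))%:E)%E).
    have H := mass_duhamel t (weight_cst1 (R := R)) cn n0.
    apply: (@le_trans _ _ (\int[leb]_(s in `[0%R, t])
      (1%:E * mass (nonlin linmap (picard linmap F n) b s)))%E).
      by rewrite le_eqVlt; apply/orP; left; apply/eqP; exact: H.
    apply: ge0_le_integral => //.
    - by move=> s _; rewrite mul1e; exact: mass_ge0.
    - by apply: measurable_funeM; exact: measurable_mass.
    - by have /measurable_int := integrable_expR_scale (L * (2 * l)) (2 * L) t.
    - move=> s; rewrite /= in_itv/= => /andP[s0 st]; rewrite mul1e mul1r.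
      have sT : 0 <= s <= T by rewrite s0 (le_trans st).
      have cPs := C0_continuous ((cP n (~~ b)).1 s).
      have E := massZ cPs (P0 n (~~ b) s) (ltW L0).
      apply: (@le_trans _ _ (L%:E * mass (picard linmap F n (~~ b) s))%E).
        by rewrite le_eqVlt; apply/orP; left; apply/eqP; exact: E.
      rewrite -[X in (_ <= X%:E)%E]mulrA EFinM lee_pmul2l ?lte_fin//; exact: IH.
  have i1 := integrable_expR_scale (L * (2 * l)) (2 * L) t.
  rewrite -[leLHS]fineK; last exact: (integrable_fin_num _ i1).
  rewrite lee_fin; apply: le_trans (integral_expR_scale_le _ _ t0) _.
  - by rewrite mulr_ge0 ?mulr_ge0// ltW.
  - by rewrite mulr_gt0.
  - rewrite ler_wpM2r ?expR_ge0// le_eqVlt; apply/orP; left; apply/eqP.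
    by field; rewrite gt_eqF.
have cFt := C0_continuous ((cF b).1 t); have cVt := C0_continuous (cV.1 t).
have V0 x : 0 <= V (nonlin linmap (picard linmap F n) b) t x by exact: duhamel_ge0.
have E := massD cFt cVt (F0 b t) V0 ler01 ler01.
apply: (@le_trans _ _ (1%:E * mass (F b t) +
  1%:E * mass (V (nonlin linmap (picard linmap F n) b) t))%E).
  by rewrite le_eqVlt; apply/orP; left; apply/eqP; exact: E.
rewrite !mul1e (le_trans (leeD (Fl b t tT) massV))// -EFinD lee_fin.
have := e1 t t0; set e := expR _ => e_ge1.
have : l <= l * e by rewrite ler_peMr.
by lra.
Qed.

End linear_gronwall.

(** * A convergence theorem *)

Section scheffe.
Context {R : realType} {N : nat}.
Local Notation mu := (@lebesgue_rV R N).
Implicit Types (f g B : 'rV[R]_N -> R).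

Lemma integrable_mass f : continuous f -> (forall x, 0 <= f x) -> (mass f < +oo)%E ->
  mu.-integrable setT (EFin \o f).
Proof.
move=> cf f0 foo; apply/integrableP; split.
  by apply/measurable_EFinP; exact: continuous_measurable_rV.
by under eq_integral do rewrite /= ger0_norm//.
Qed.

(** Dominated convergence as d tends to 0. *)
Lemma mass_min_small B e : continuous B -> (forall x, 0 <= B x) ->
  (mass B < +oo)%E -> 0 < e ->
  exists2 d, 0 < d & (mass (fun x => Num.min d (B x)) <= e%:E)%E.
Proof.
move=> cB B0 Boo e0; have mB := continuous_measurable_rV cB.
pose f n x := (Num.min n.+1%:R^-1 (B x))%:E.
have mf n : measurable_fun setT (f n).
  by apply/measurable_EFinP; exact: measurable_minr.
have f0 n x : 0 <= Num.min n.+1%:R^-1 (B x) by rewrite le_min invr_ge0 ler0n B0.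
have /fine_cvgP[fin_f] : (\int[mu]_x f n x)%E @[n --> \oo] --> (0:R)%:E.
  rewrite (_ : 0%:E = \int[mu]_z (cst 0 z))%E; last by rewrite integral0.
  apply: (@dominated_cvg _ _ _ mu setT measurableT f (cst 0%E) (EFin \o B)) => //.
  - move=> x _; apply: cvg_EFin; first exact: nearW.
    apply/cvgrPdist_le => d d0; near=> n.
    rewrite /f /= sub0r normrN ger0_norm// ge_min; apply/orP; left.
    by rewrite ltW//; near: n; exact: (near_infty_natSinv_lt (PosNum d0)).
  - exact: integrable_mass.
  - by move=> n x _; rewrite /f/= lee_fin ger0_norm// ge_min lexx orbT.
move=> /cvgrPdist_le /(_ _ e0) fe.
have [n _ /(_ _ (leqnn n)) [h1 h2]] := filterI fin_f fe.
exists n.+1%:R^-1; first by rewrite invr_gt0.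
rewrite /mass -[leLHS]fineK// lee_fin (le_trans (ler_norm _))//.
by move: h2; rewrite /= sub0r normrN.
Unshelve. all: by end_near. Qed.

(** Scheffe-type argument: f is at most d where B0 is large, and at most
    K (2 B0 + (B1 - B0)) where B0 is small; the integrals of min(d, B0) and of
    B1 - B0 are both small. *)
Lemma scheffe_le f B0 B1 K d e : continuous f -> continuous B0 -> continuous B1 ->
  (forall x, 0 <= f x) -> (forall x, 0 <= B0 x) -> (forall x, 0 <= B1 x) ->
  (mass B0 < +oo)%E -> 0 < d -> 1 <= K ->
  (forall x, f x <= d) -> (forall x, f x <= K * (B0 x + B1 x)) ->
  (forall x, `|B1 x - B0 x| <= d) -> 0 <= e ->
  (mass (fun x => Num.min d (B0 x)) <= e%:E)%E ->
  (mass B1 <= mass B0 + e%:E)%E ->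
  (mass f <= (5 * K * e)%:E)%E.
Proof.
move=> cf cB0 cB1 f0 B0_0 B1_0 B0oo d0 K1 fd fB BB e0 me B1e.
have K0 : 0 < K by rewrite (lt_le_trans _ K1).
pose m x := Num.min d (B0 x).
have m0 x : 0 <= m x by rewrite /m le_min (ltW d0) B0_0.
have mm : measurable_fun setT m.
  by apply: measurable_minr => //; exact: continuous_measurable_rV.
have B1oo : (mass B1 < +oo)%E.
  by apply: le_lt_trans B1e _; rewrite lte_add_pinfty// ltry.
have iB0 := integrable_mass cB0 B0_0 B0oo.
have iB1 := integrable_mass cB1 B1_0 B1oo.
have im : mu.-integrable setT (EFin \o m).
  apply/integrableP; split; first exact/measurable_EFinP.
  under eq_integral do rewrite /= ger0_norm//.
  by apply: le_lt_trans me _; rewrite ltry.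
(* Where B0 x >= d, the bound f x <= d suffices, as K * (B1 x - B0 x) >= - K * d;
   elsewhere m x = B0 x and B0 + B1 = 2 B0 + (B1 - B0). *)
have pw x : f x <= 3 * K * m x + K * (B1 x - B0 x).
  have := fd x; have := fB x; have := BB x; rewrite ler_norml => /andP[b1 b2] h1 h2.
  have h3 := B1_0 x; have h4 := B0_0 x; rewrite /m.
  case: (leP d (B0 x)) => h5.
    have h6 : 0 <= (K - 1) * d by rewrite mulr_ge0 ?subr_ge0// ltW.
    have h7 : K * (- d) <= K * (B1 x - B0 x) by rewrite ler_wpM2l// ltW.
    nra.
  have h6 : 0 <= K * B0 x by rewrite mulr_ge0// ltW.
  nra.
pose h x := 3 * K * m x + K * (B1 x - B0 x).
have i1 : mu.-integrable setT (EFin \o (fun x => 3 * K * m x)).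
  by apply: (integrableZl _ (3 * K) im).
have i2 : mu.-integrable setT (EFin \o (fun x => B1 x - B0 x)).
  by apply: (integrableB _ iB1 iB0).
have i3 : mu.-integrable setT (EFin \o (fun x => K * (B1 x - B0 x))).
  by apply: (integrableZl _ K i2).
have ih : mu.-integrable setT (EFin \o h) by apply: (integrableD _ i1 i3).
have h0 x : 0 <= h x by exact: le_trans (pw x).
apply: (@le_trans _ _ (\int[mu]_x (h x)%:E)%E).
  apply: ge0_le_integral => //.
  - by move=> x _; rewrite lee_fin.
  - by apply/measurable_EFinP; exact: continuous_measurable_rV.
  - by have /measurable_int := ih.
  - by move=> x _; rewrite lee_fin; exact: pw.
rewrite -[leLHS]fineK; last exact: (integrable_fin_num _ ih).
rewrite lee_fin -/(Rintegral mu setT h) /h RintegralD// RintegralZl// RintegralZl// RintegralB//.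
have hm : \int[mu]_x m x <= e.
  rewrite -lee_fin /Rintegral fineK//; exact: (integrable_fin_num _ im).
have hB : \int[mu]_x B1 x - \int[mu]_x B0 x <= e.
  rewrite lerBlDl -lee_fin EFinD /Rintegral !fineK//.
    exact: (integrable_fin_num _ iB0).
  exact: (integrable_fin_num _ iB1).
have h1 : 3 * K * \int[mu]_x m x <= 3 * K * e.
  by rewrite ler_wpM2l// mulr_ge0// ltW.
have h2 : K * (\int[mu]_x B1 x - \int[mu]_x B0 x) <= K * e.
  by rewrite ler_wpM2l// ltW.
have h3 : 0 <= K * e by rewrite mulr_ge0// ltW.
by lra.
Qed.

End scheffe.

(** * Powers of solutions of the integral equation *)

Section three_terms.
Context {R : realType}.

Lemma powR_le3 (r u a1 a2 a3 b1 b2 b3 d1 d2 d3 : R) : 1 <= r -> 0 <= a1 -> 0 <= a2 -> 0 <= a3 ->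
  `|u| <= a1 + a2 + a3 -> a1 `^ r <= d1 * b1 -> a2 `^ r <= d2 * b2 -> a3 `^ r <= d3 * b3 ->
  `|u| `^ r <= 3 `^ r * d1 * b1 + 3 `^ r * d2 * b2 + 3 `^ r * d3 * b3.
Proof.
move=> r1 a10 a20 a30 ua h1 h2 h3; have r0 : 0 <= r by exact: le_trans r1.
apply: (@le_trans _ _ (3 `^ r * (a1 `^ r + a2 `^ r + a3 `^ r))).
  apply: le_trans (powR_add3 a10 a20 a30 r0).
  by apply: ge0_ler_powR => //; rewrite nnegrE// !addr_ge0.
by rewrite -!mulrA -!mulrDr ler_wpM2l ?powR_ge0// !lerD.
Qed.

End three_terms.

Section persistence.
Context {R : realType} {N : nat}.
Local Notation leb := (@lebesgue_measure R).
Local Notation V := (duhamel (fun=> (1:R))).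
Variables (T r M Kp : R).
Hypotheses (r1 : 1 <= r) (M0 : 0 < M) (Kp0 : 0 < Kp).
Variables (z nl : bool -> R -> 'rV[R]_N -> R) (init forc : bool -> 'rV[R]_N -> R).
Variable k : bool -> R -> R.
Hypotheses (cz : forall b, C0_curve (z b)) (zM : forall b t x, `|z b t x| <= M).
Hypotheses (C0init : forall b, C0 (init b)) (C0forc : forall b, C0 (forc b)).
Hypothesis wk : forall b, weight (k b).
Hypothesis cnl : forall b, C0_curve (nl b).
Hypothesis nlz : forall b s x, 0 <= s <= T -> `|nl b s x| <= Kp * `|z (~~ b) s x|.
Hypothesis eqz : forall b t x, 0 <= t <= T -> z b t x =
  heat t (init b) x + duhamel (k b) (fun=> forc b) t x + V (nl b) t x.

Let r0 : 0 < r. Proof. exact: lt_le_trans r1. Qed.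

(** The density whose mass is the r-th power of the L^r norm. *)
Definition power_of (f : 'rV[R]_N -> R) x := `|f x| `^ r.

Lemma power_of_ge0 f x : 0 <= power_of f x. Proof. exact: powR_ge0. Qed.

Lemma C0_curve_power h : C0_curve h -> (exists2 K, 0 < K & forall t x, `|h t x| <= K) ->
  C0_curve (fun t => power_of (h t)).
Proof.
move=> ch [K K0 hK].
have -> : (fun t => power_of (h t)) = (fun t x => trunc_pow K r (h t x)).
  by apply/funext => t; apply/funext => x; rewrite trunc_powE.
apply: (C0_curve_lipschitz (phi := trunc_pow K r) (L := r * K `^ (r - 1))) => //.
  by move=> a b; apply: trunc_pow_lipschitz => //; exact: ltW.
by apply: trunc_pow0 => //; exact: ltW.
Qed.

Lemma C0_power f : C0 f -> C0 (power_of f).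
Proof.
move=> f0; have [K K0 fK] := C0_bounded f0.
have h : exists2 K, 0 < K & forall (t : R) x, `|f x| <= K by exists K.
exact: (C0_curve_power (C0_curve_cst f0) h).1 0.
Qed.

Lemma C0_norm f : C0 f -> C0 (fun x : 'rV[R]_N => `|f x| : R).
Proof. by move=> f0; apply: (C0_comp (phi := Num.norm)) => //; [exact: norm_continuous|exact: normr0]. Qed.

Lemma C0_curve_norm (h : R -> 'rV[R]_N -> R) : C0_curve h -> C0_curve (fun t x => `|h t x|).
Proof.
move=> ch; apply: (@C0_curve_lipschitz _ _ Num.norm 1) => //; last exact: normr0.
by move=> a b; rewrite mul1r; exact: ler_dist_dist.
Qed.

Let y b t := power_of (z b t).

Let cy b : C0_curve (y b). Proof. by apply: C0_curve_power => //; exists M. Qed.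

Let mk b := \int[leb]_(s in `[0, T]) k b s + 1.
Let mk0 b : 0 < mk b.
Proof. by have [k0 _ _] := wk b; rewrite ltr_wpDl// Rintegral_ge0. Qed.
Let m1 := \int[leb]_(s in `[0, T]) (1:R) + 1.
Let m10 : 0 < m1. Proof. by rewrite ltr_wpDl// Rintegral_ge0. Qed.

Let c1 := 3 `^ r * 2 `^ r.
Let c2 b := 3 `^ r * (2 `^ r * mk b `^ (r - 1)).
Let L := 3 `^ r * (2 `^ r * m1 `^ (r - 1)) * Kp `^ r.

Let c10 : 0 <= c1. Proof. by rewrite mulr_ge0// powR_ge0. Qed.
Let c20 b : 0 <= c2 b. Proof. by rewrite !mulr_ge0// powR_ge0. Qed.
Let L0 : 0 < L. Proof. by rewrite !mulr_gt0// powR_gt0. Qed.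

Let F b t x := c1 * heat t (power_of (init b)) x +
  c2 b * duhamel (k b) (fun=> power_of (forc b)) t x.

Let cF b : C0_curve (F b).
Proof.
apply: C0_curve_lin; first exact: C0_curve_heat_cst (C0_power (C0init b)).
by apply: C0_curve_duhamel => //; exact: C0_curve_cst (C0_power (C0forc b)).
Qed.

Let F0 b t x : 0 <= F b t x.
Proof.
have [k0 _ _] := wk b.
by rewrite addr_ge0// mulr_ge0//; [apply: heat_ge0|apply: duhamel_ge0] => // *;
  exact: power_of_ge0.
Qed.

(** Young's inequality under the averages turns the integral equation for z into a
    linear integral inequality for |z|^r, the nonlinearity being controlled by
    Kp |z| because z is bounded. *)
Lemma power_subsolution b t x : 0 <= t <= T ->
  y b t x <= F b t x + V (nonlin (linmap L) y b) t x.
Proof.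
move=> tT; have /andP[t0 t_T] := tT; have [k0 _ _] := wk b.
have ci := C0init b; have cf := C0forc b.
pose A1 := heat t (fun x => `|init b x|) x.
pose A2 := duhamel (k b) (fun=> fun x => `|forc b x|) t x.
pose h := fun s x => Kp * `|z (~~ b) s x|.
pose hr := fun s x => Kp `^ r * y (~~ b) s x.
have ch : C0_curve h.
  have := C0_curve_lin Kp 0 (C0_curve_norm (cz (~~ b))) (C0_curve_norm (cz (~~ b))).
  by under [X in C0_curve X]eq_fun do under eq_fun do rewrite mul0r addr0.
have chr : C0_curve hr.
  have := C0_curve_lin (Kp `^ r) 0 (cy (~~ b)) (cy (~~ b)).
  by under [X in C0_curve X]eq_fun do under eq_fun do rewrite mul0r addr0.
pose A3 := V h t x.
have A10 : 0 <= A1 by exact: heat_ge0.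
have A20 : 0 <= A2 by exact: duhamel_ge0.
have A30 : 0 <= A3.
  by apply: duhamel_ge0 => // s x'; rewrite mulr_ge0// ltW.
have zA : `|z b t x| <= A1 + A2 + A3.
  have abs3 (u a1 a2 a3 b1 b2 b3 : R) : u = a1 + a2 + a3 -> `|a1| <= b1 -> `|a2| <= b2 ->
      `|a3| <= b3 -> `|u| <= b1 + b2 + b3.
    by move=> -> h1 h2 h3; rewrite !(le_trans (ler_normD _ _))// !lerD//
      (le_trans (ler_normD _ _))// lerD.
  apply: (abs3 _ _ _ _ _ _ _ (eqz b x tT)).
  - by apply: norm_heat_le_heat => //; exact: C0_norm.
  - apply: norm_duhamel_le => //; first exact: C0_curve_cst.
    exact: C0_curve_cst (C0_norm cf).
  - apply: norm_duhamel_le => //; first exact: weight_cst1.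
    by move=> s x' /andP[s0 st]; apply: nlz; rewrite s0 (le_trans st).
have p1 : A1 `^ r <= 2 `^ r * heat t (power_of (init b)) x.
  by apply: heat_power => //; [exact: C0_norm|exact: C0_power].
have p2 : A2 `^ r <= 2 `^ r * mk b `^ (r - 1) *
    duhamel (k b) (fun=> power_of (forc b)) t x.
  apply: duhamel_power => //.
  - exact: C0_curve_cst (C0_norm cf).
  - exact: C0_curve_cst (C0_power cf).
  - by move=> _ x'; exact: power_of_ge0.
  - by rewrite (le_trans (weight_integral_mono (wk b) t_T))// lerDl.
have p3 : A3 `^ r <= 2 `^ r * m1 `^ (r - 1) * V hr t x.
  apply: duhamel_power => //.
  - exact: weight_cst1.
  - by move=> s x'; rewrite mulr_ge0// ltW.
  - by move=> s x'; rewrite mulr_ge0 ?powR_ge0.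
  - by move=> s x' _; rewrite /hr /h powRM// ltW.
  - by rewrite (le_trans (weight_integral_mono weight_cst1 t_T))// lerDl.
have VL : V (nonlin (linmap L) y b) t x =
    3 `^ r * (2 `^ r * m1 `^ (r - 1)) * V hr t x.
  have E1 := duhamelZ L t x weight_cst1 (cy (~~ b)).
  have E2 := duhamelZ (Kp `^ r) t x weight_cst1 (cy (~~ b)).
  by apply: (etrans E1); rewrite /L -mulrA; congr (_ * _); exact: esym E2.
apply: le_trans (powR_le3 r1 A10 A20 A30 zA p1 p2 p3) _.
by rewrite lerD2l le_eqVlt; apply/orP; left; apply/eqP; exact: esym VL.
Qed.

Hypothesis init_Lr : forall b, (mass (power_of (init b)) < +oo)%E.
Hypothesis forc_Lr : forall b, (mass (power_of (forc b)) < +oo)%E.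

Let mass_fin (f : 'rV[R]_N -> R) : (mass (power_of f) < +oo)%E ->
  exists2 m, 0 <= m & mass (power_of f) = m%:E.
Proof.
have m0 : (0 <= mass (power_of f))%E by apply: mass_ge0 => x; exact: power_of_ge0.
case: (mass (power_of f)) m0 => [m|//|//]; rewrite lee_fin => m0 _.
by exists m.
Qed.

(** Uniform continuity of the mass in time, in the form of one-sided inequalities,
    which avoid subtracting extended reals and behave well under sums. *)
Definition mass_modulus (h : R -> 'rV[R]_N -> R) :=
  forall e, 0 < e -> exists2 d, 0 < d & forall s t, 0 <= s <= T -> 0 <= t <= T ->
    `|s - t| < d -> (mass (h s) <= mass (h t) + e%:E)%E.

(** By mass_duhamel_split, and because the weight has little mass on short intervals. *)
Lemma mass_modulus_duhamel kk h m : weight kk -> C0_curve h -> (forall s x, 0 <= h s x) ->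
  0 <= m -> (forall s, 0 <= s <= T -> (mass (h s) <= m%:E)%E) ->
  mass_modulus (duhamel kk h).
Proof.
move=> wkk ch h0 m0 hm e e0.
have m10' : 0 < m + 1 by rewrite ltr_wpDl.
have [d d0 hd] := weight_small T wkk (divr_gt0 e0 m10').
exists d => // s t /andP[s0 sT] /andP[t0 tT] st.
have [ts|/ltW st'] := leP t s.
  have /andP[_ h2] := mass_duhamel_split wkk ch h0 t0 ts sT hm.
  apply: le_trans h2 _; rewrite leeD2l// lee_fin.
  have := hd t s t0 ts sT; rewrite ger0_norm ?subr_ge0// in st.
  move=> /(_ st) hk; apply: (@le_trans _ _ (m * (e / (m + 1)))).
    by rewrite ler_wpM2l.
  by rewrite mulrCA ler_piMr ?(ltW e0)// ler_pdivrMr// mul1r lerDl.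
have /andP[h1 _] := mass_duhamel_split wkk ch h0 s0 st' tT hm.
by apply: le_trans h1 _; rewrite leeDl// lee_fin ltW.
Qed.

Lemma mass_modulus_lin h g a c : C0_curve h -> C0_curve g ->
  (forall s x, 0 <= h s x) -> (forall s x, 0 <= g s x) -> 0 <= a -> 0 <= c ->
  mass_modulus h -> mass_modulus g -> mass_modulus (fun t x => a * h t x + c * g t x).
Proof.
move=> ch cg h0 g0 a0 c0 hh hg e e0.
have d0 : 0 < a + c + 1 by rewrite ltr_wpDl// addr_ge0.
pose e' := e / (a + c + 1); have e'0 : 0 < e' by rewrite divr_gt0.
have [d1 d10 hd1] := hh e' e'0; have [d2 d20 hd2] := hg e' e'0.
exists (Num.min d1 d2); first by rewrite lt_min d10.
move=> s t sT tT; rewrite lt_min => /andP[st1 st2].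
have Es := massD (C0_continuous (ch.1 s)) (C0_continuous (cg.1 s)) (h0 s) (g0 s) a0 c0.
have Et := massD (C0_continuous (ch.1 t)) (C0_continuous (cg.1 t)) (h0 t) (g0 t) a0 c0.
have transport (A A' B B' : \bar R) : A = A' -> B = B' ->
  (A' <= B' + e%:E -> A <= B + e%:E)%E by move=> -> ->.
apply: (transport _ _ _ _ Es Et).
have i1 := hd1 s t sT tT st1; have i2 := hd2 s t sT tT st2.
have mht : (0 <= mass (h t))%E by exact: mass_ge0.
have mgt : (0 <= mass (g t))%E by exact: mass_ge0.
apply: (@le_trans _ _ (a%:E * (mass (h t) + e'%:E) + c%:E * (mass (g t) + e'%:E))%E).
  by apply: leeD; apply: lee_wpmul2l => //; rewrite lee_fin.
have distr (u : R) (A : \bar R) : (0 <= A)%E ->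
    (u%:E * (A + e'%:E) = u%:E * A + (u * e')%:E)%E.
  by move=> A0; rewrite ge0_muleDr// lee_fin ltW.
rewrite (distr a _ mht) (distr c _ mgt) addeACA leeD2l// -EFinD lee_fin -mulrDl.
by rewrite /e' mulrCA ler_piMr ?(ltW e0)// ler_pdivrMr// mul1r lerDl.
Qed.

Lemma mass_modulus_heat f : C0 f -> (forall x, 0 <= f x) -> mass_modulus (fun t => heat t f).
Proof.
move=> cf f0 e e0; exists 1 => // s t _ _ _.
have Es := mass_heat s cf f0; have Et := mass_heat t cf f0.
have transport (A B C : \bar R) : A = C -> B = C -> (A <= B + e%:E)%E.
  by move=> -> ->; rewrite leeDl// lee_fin ltW.
exact: transport Es Et.
Qed.

Lemma mass_duhamel_le kk (h : R -> 'rV[R]_N -> R) m t : weight kk -> C0_curve h -> (forall s x, 0 <= h s x) ->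
  0 <= m -> (forall s, 0 <= s <= T -> (mass (h s) <= m%:E)%E) -> 0 <= t <= T ->
  (mass (duhamel kk h t) <= (m * \int[leb]_(s in `[0, T]) kk s)%:E)%E.
Proof.
move=> wkk ch h0 m0 hm /andP[t0 tT]; have [k0 _ ik] := wkk.
have /andP[_ h2] := mass_duhamel_split wkk ch h0 (lexx 0) t0 tT hm.
apply: le_trans h2 _.
have -> : duhamel kk h 0 = fun=> 0 by apply/funext => x; rewrite duhamel_le0.
rewrite {1}/mass integral0 add0e lee_fin ler_wpM2l//.
rewrite Rintegral_itv_obnd_cbnd; first exact: weight_integral_mono.
by apply: (@integrableS _ _ _ leb `[0, t]) => //; apply: subset_itvr; rewrite bnd_simp.
Qed.

Let F_mass : exists2 l, 0 <= l & forall b s, 0 <= s <= T -> (mass (F b s) <= l%:E)%E.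
Proof.
have one b : exists2 l, 0 <= l & forall s, 0 <= s <= T -> (mass (F b s) <= l%:E)%E.
  have [mi mi0 Ei] := mass_fin (init_Lr b); have [mf mf0 Ef] := mass_fin (forc_Lr b).
  have [k0 _ _] := wk b.
  have ci := C0_power (C0init b); have cf := C0_curve_cst (C0_power (C0forc b)).
  exists (c1 * mi + c2 b * (mf * \int[leb]_(s in `[0, T]) k b s)).
    by rewrite addr_ge0// mulr_ge0// mulr_ge0// Rintegral_ge0.
  move=> s sT.
  have p0 (_ : R) x : 0 <= power_of (forc b) x by exact: power_of_ge0.
  have E : mass (F b s) = (c1%:E * mass (heat s (power_of (init b))) +
      (c2 b)%:E * mass (duhamel (k b) (fun=> power_of (forc b)) s))%E.
    apply: massD => //.
    - exact: C0_continuous (C0_heat s ci).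
    - exact: C0_continuous ((C0_curve_duhamel (wk b) cf).1 s).
    - by move=> x; apply: heat_ge0 => x'; exact: power_of_ge0.
    - by move=> x; exact: duhamel_ge0 k0 p0.
  rewrite E EFinD; apply: leeD.
    rewrite (EFinM c1 mi); apply: lee_wpmul2l; rewrite ?lee_fin// -Ei.
    have H := mass_heat s ci (fun x => power_of_ge0 _ x).
    by rewrite le_eqVlt; apply/orP; left; apply/eqP; exact: H.
  rewrite (EFinM (c2 b) (mf * _)); apply: lee_wpmul2l; rewrite ?lee_fin//.
  by apply: (mass_duhamel_le (wk b) cf p0 mf0 _ sT) => s' _; rewrite Ef.
have [l1 l10 h1] := one true; have [l2 l20 h2] := one false.
exists (l1 + l2); first exact: addr_ge0.
move=> b s sT; case: b.
  by rewrite (le_trans (h1 s sT))// lee_fin lerDl.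
by rewrite (le_trans (h2 s sT))// lee_fin lerDr.
Qed.

(** The L^r bound: iterating the integral inequality, the Picard iterates of the
    linear majorant problem stay bounded in L^1, and Fatou's lemma passes to
    |z|^r. *)
Lemma power_mass_bounded : exists2 m, 0 <= m &
  forall b t, 0 <= t <= T -> (mass (y b t) <= m%:E)%E.
Proof.
have [l l0 Fl] := F_mass; pose E := expR (2 * L * T).
exists (2 * l * E); first by rewrite mulr_ge0 ?expR_ge0// mulr_ge0.
move=> b t tT; have /andP[t0 t_T] := tT.
have Mr0 : 0 <= M `^ r by exact: powR_ge0.
have yM b' s x : 0 <= s <= T -> y b' s x <= M `^ r.
  by move=> _; apply: (ge0_ler_powR (ltW r0)); rewrite ?nnegrE// ltW.
have sub := subsolution_le_picard L0 cF cy Mr0 yM (fun b s x _ => F0 b s x) power_subsolution.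
have cP n := @C0_curve_picard R N (linmap L) L (@linmap_lipschitz R L L0) (@linmap0 R L) F n b cF.
apply: (@mass_fatou R N (y b t) (fun n => picard (linmap L) F n b t)
  (M `^ r * expR (2 * L * t))).
- exact: C0_continuous ((cy b).1 t).
- by move=> n; exact: C0_continuous ((cP n).1 t).
- by move=> x; exact: power_of_ge0.
- by move=> n x; exact: picard_ge0.
- by move=> n x; rewrite (le_trans (sub n b t x tT))// lerD2l mulrAC.
- move=> n; apply: le_trans (mass_picard_le L0 cF F0 l0 Fl n b tT) _.
  rewrite lee_fin ler_wpM2l ?mulr_ge0// ler_expR ler_wpM2l//.
  by rewrite mulr_ge0// ltW.
Qed.

Lemma power_mass_lty b t : 0 <= t <= T -> (mass (power_of (z b t)) < +oo)%E.
Proof.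
move=> tT; have [m m0 hm] := power_mass_bounded.
by apply: le_lt_trans (hm b t tT) _; rewrite ltry.
Qed.

(* A continuous function of time dominating |z|^r, whose mass is also continuous. *)
Let majorant b t x := 1 * F b t x + 1 * V (nonlin (linmap L) y b) t x.

Let cn b : C0_curve (nonlin (linmap L) y b).
Proof. exact: (C0_curve_nonlin (@linmap_lipschitz R L L0) (@linmap0 R L)). Qed.

Let n0 b s x : 0 <= nonlin (linmap L) y b s x.
Proof. by rewrite /nonlin /linmap mulr_ge0 ?(ltW L0)//; exact: power_of_ge0. Qed.

Let V0 b t x : 0 <= V (nonlin (linmap L) y b) t x.
Proof. exact: duhamel_ge0. Qed.

Let cmaj b : C0_curve (majorant b).
Proof. by apply: C0_curve_lin => //; apply: C0_curve_duhamel => //; exact: weight_cst1. Qed.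

Let maj0 b t x : 0 <= majorant b t x.
Proof. by rewrite /majorant !mul1r addr_ge0. Qed.

Let nl_mass : exists2 m, 0 <= m &
  forall b s, 0 <= s <= T -> (mass (nonlin (linmap L) y b s) <= m%:E)%E.
Proof.
have [m m0 hm] := power_mass_bounded; exists (L * m); first by rewrite mulr_ge0// ltW.
move=> b s sT.
have E : mass (nonlin (linmap L) y b s) = (L%:E * mass (y (~~ b) s))%E.
  apply: massZ; [exact: C0_continuous ((cy (~~ b)).1 s)|exact: power_of_ge0|exact: ltW].
by rewrite E (EFinM L m); apply: lee_wpmul2l; [rewrite lee_fin ltW|exact: hm].
Qed.

Let maj_modulus b : mass_modulus (majorant b).
Proof.
have [m m0 hm] := nl_mass; have [mf mf0 Ef] := mass_fin (forc_Lr b).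
have ci := C0_power (C0init b); have cf := C0_curve_cst (C0_power (C0forc b)).
have [k0 _ _] := wk b.
have hi : forall (s : R) x, 0 <= heat s (power_of (init b)) x.
  by move=> s x; apply: heat_ge0 => x'; exact: power_of_ge0.
have hd : forall (s : R) x, 0 <= duhamel (k b) (fun=> power_of (forc b)) s x.
  by move=> s x; apply: duhamel_ge0 => // _ x'; exact: power_of_ge0.
have pf : forall (s : R) x, 0 <= (fun=> power_of (forc b)) s x.
  by move=> s x; exact: power_of_ge0.
have w1 := weight_cst1 (R := R).
have mF : mass_modulus (F b).
  apply: mass_modulus_lin => //.
  - exact: C0_curve_heat_cst.
  - exact: C0_curve_duhamel.
  - by apply: mass_modulus_heat => //; exact: power_of_ge0.
  - by apply: (mass_modulus_duhamel (m := mf)) => // s _; rewrite Ef.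
exact: (mass_modulus_lin (cF b) (C0_curve_duhamel w1 (cn b)) (F0 b) (V0 b) ler01 ler01 mF
  (mass_modulus_duhamel w1 (cn b) (n0 b) m0 (hm b))).
Qed.

Let maj_mass b t : 0 <= t <= T -> (mass (majorant b t) < +oo)%E.
Proof.
move=> tT; have [m m0 hm] := nl_mass; have [l l0 Fl] := F_mass.
have w1 := weight_cst1 (R := R).
have cV := C0_curve_duhamel w1 (cn b).
have E := massD (C0_continuous ((cF b).1 t)) (C0_continuous (cV.1 t)) (F0 b t) (V0 b t)
  ler01 ler01.
have transport (A B : \bar R) : A = B -> (B < +oo -> A < +oo)%E by move=> ->.
apply: (transport _ _ E); rewrite !mul1e; apply: lte_add_pinfty.
  by apply: le_lt_trans (Fl b t tT) _; rewrite ltry.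
by apply: le_lt_trans (mass_duhamel_le w1 (cn b) (n0 b) m0 (hm b) tT) _; rewrite ltry.
Qed.

(** Continuity in L^r: |z(s) - z(t)|^r is uniformly small since z is continuous in
    C_0, and dominated by the majorant at the times s and t; scheffe_le applies. *)
Lemma power_mass_continuous b t e : 0 <= t <= T -> 0 < e -> exists2 d, 0 < d &
  forall s, 0 <= s <= T -> `|s - t| < d ->
    (mass (power_of (z b s \- z b t)%R) <= e%:E)%E.
Proof.
move=> tT e0; pose K := 3 `^ r.
have K1 : 1 <= K by rewrite -[1](powRr0 3) ler_powR// ?ltW//; lra.
have K0 : 0 < K by rewrite (lt_le_trans _ K1).
pose e' := e / (5 * K); have e'0 : 0 < e' by rewrite divr_gt0// mulr_gt0.
have cmt := C0_continuous ((cmaj b).1 t).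
have [d d0 hd] := mass_min_small cmt (maj0 b t) (maj_mass b tT) e'0.
have [d1 d10 hd1] := maj_modulus b e'0.
have [d2 d20 hd2] := (cmaj b).2 t d d0.
have dr0 : 0 < d `^ r^-1 by rewrite powR_gt0.
have [d3 d30 hd3] := (cz b).2 t _ dr0.
exists (Num.min d1 (Num.min d2 d3)); first by rewrite !lt_min d10 d20.
move=> s sT; rewrite !lt_min => /and3P[sd1 sd2 sd3].
have maj_y u x : 0 <= u <= T -> power_of (z b u) x <= majorant b u x.
  by move=> uT; have := power_subsolution b x uT; rewrite /majorant !mul1r.
have -> : e = 5 * K * e' by rewrite /e' mulrC divfK// mulf_neq0// gt_eqF.
have cf : continuous (power_of (z b s \- z b t)).
  apply: C0_continuous; apply: C0_power.
  have -> : z b s \- z b t = (fun x => 1 * z b s x + (-1) * z b t x).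
    by apply/funext => x /=; rewrite mul1r mulN1r.
  by apply: C0_lin; [exact: (cz b).1|exact: (cz b).1].
have fd x : power_of (z b s \- z b t) x <= d.
  have dE : (d `^ r^-1) `^ r = d by rewrite -powRrM mulVf ?gt_eqF// powRr1// ltW.
  rewrite -[leRHS]dE; apply: (ge0_ler_powR (ltW r0)); rewrite ?nnegrE; [exact: normr_ge0|exact: ltW|].
  exact: hd3.
have fB x : power_of (z b s \- z b t) x <= K * (majorant b t x + majorant b s x).
  apply: (@le_trans _ _ (K * (`|z b t x| `^ r + `|z b s x| `^ r + 0 `^ r))).
    apply: le_trans (powR_add3 (normr_ge0 _) (normr_ge0 _) (lexx 0) (ltW r0)).
    apply: (ge0_ler_powR (ltW r0)); rewrite ?nnegrE; [exact: normr_ge0| |].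
      by rewrite addr0 addr_ge0.
    by rewrite addr0 addrC ler_normB.
  rewrite powR0 ?gt_eqF// addr0 ler_wpM2l ?(ltW K0)//.
  by apply: lerD; exact: maj_y.
exact: (scheffe_le cf cmt (C0_continuous ((cmaj b).1 s)) (power_of_ge0 _) (maj0 b t)
  (maj0 b s) (maj_mass b tT) d0 K1 fd fB (hd2 s sd2) (ltW e'0) hd (hd1 s t sT tT sd1)).
Qed.

End persistence.

(** * Persistence of integrability *)

Section Lr_persistence.
Context {R : realType} {N : nat}.
Local Notation mu := (@lebesgue_rV R N).

Lemma cvge_fine0 (F : set_system R) (f : R -> \bar R) : Filter F ->
  (forall t, 0 <= f t)%E ->
  (forall e, 0 < e -> \forall t \near F, (f t <= e%:E)%E) -> f @ F --> 0%E.
Proof.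
move=> FF f0 fe; apply/fine_cvgP; split.
  near=> t; rewrite ge0_fin_numE//; apply: (@le_lt_trans _ _ 1%:E); last exact: ltry.
  by near: t; exact: fe.
apply/cvgrPdist_le => e e0; near=> t.
have : (f t <= e%:E)%E by near: t; exact: fe.
have := f0 t; rewrite sub0r normrN /=.
by case: (f t) => [a|//|//]; rewrite !lee_fin => a0 ae; rewrite ger0_norm.
Unshelve. all: by end_near. Qed.

Lemma Lnorm_mass r (f : 'rV[R]_N -> R) :
  ('N[mu]_(r%:E)[EFin \o f] = mass (power_of r f) `^ r^-1)%E.
Proof. by rewrite unlock. Qed.

Lemma Lnorm_le r (f : 'rV[R]_N -> R) e : 1 <= r -> 0 <= e ->
  (mass (power_of r f) <= (e `^ r)%:E)%E -> ('N[mu]_(r%:E)[EFin \o f] <= e%:E)%E.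
Proof.
move=> r1 e0 h; have r0 : 0 < r by rewrite (lt_le_trans _ r1).
rewrite Lnorm_mass//.
have -> : e%:E = ((e `^ r)%:E `^ r^-1)%E.
  by rewrite poweR_EFin -powRrM mulfV ?gt_eqF// powRr1.
apply: gt0_ler_poweR => //; rewrite ?in_itv/= ?leey ?andbT ?lee_fin ?powR_ge0//.
  by rewrite invr_ge0 ltW.
by apply: mass_ge0 => x; exact: power_of_ge0.
Qed.

Lemma mem_Lfun_mass r (f : 'rV[R]_N -> R) : 1 <= r -> continuous f ->
  (mass (power_of r f) < +oo)%E -> f \in Lfun mu r%:E.
Proof.
move=> r1 cf h; rewrite inE; apply/andP; split; rewrite inE/=.
  exact: continuous_measurable_rV.
by rewrite /finite_norm Lnorm_mass// poweR_lty.
Qed.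

Lemma Lfun_mass_lty r (f : 'rV[R]_N -> R) : 1 <= r -> f \in Lfun mu r%:E ->
  (mass (power_of r f) < +oo)%E.
Proof.
move=> r1 /(Lfun_integrable r1)/integrableP[_].
by under eq_integral do rewrite gee0_abs ?lee_fin ?powR_ge0//.
Qed.

Variables (u0 v0 w1 w2 : 'rV[R]_N -> R).
Hypotheses (hu0 : C0 u0) (hv0 : C0 v0) (hw1 : C0 w1) (hw2 : C0 w2).
Variables (sigma gamma p q r : R).
Hypotheses (hsigma : -1 < sigma) (hgamma : -1 < gamma) (hp : 1 < p) (hq : 1 < q).
Hypothesis r1 : 1 <= r.
Hypotheses (Lu0 : u0 \in Lfun mu r%:E) (Lv0 : v0 \in Lfun mu r%:E).
Hypotheses (Lw1 : w1 \in Lfun mu r%:E) (Lw2 : w2 \in Lfun mu r%:E).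
Local Notation mild := (mild_solution u0 v0 w1 w2 sigma gamma p q).

(** The bounds of the truncated equation on [0, T] put the solution in the scope of
    the abstract L^r estimates. *)
Lemma mild_Lr T U V b t : 0 < T -> mild T U V -> 0 <= t <= T ->
  let z := pair_curve T U V b in
  z t \in Lfun mu r%:E /\
  forall e, 0 < e -> exists2 d, 0 < d & forall s, 0 <= s <= T -> `|s - t| < d ->
    ('N[mu]_(r%:E)[EFin \o (z s \- z t)%R] <= e%:E)%E.
Proof.
move=> T0 m tT /=; pose z := pair_curve T U V.
have cz b' : C0_curve (z b') := C0_curve_pair b' (ltW T0) m.
have [M M0 hM] := mild_bounded (ltW T0) m.
have zM b' s x : `|z b' s x| <= M.
  have cs := clamp_itv s (ltW T0).
  by have := hM b' (clamp T s) x cs; rewrite /pair_curve (clamp_id cs).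
pose nl := nonlin (tpow p q M) z.
pose Kp := lipc p q M; have Kp0 : 0 < Kp := lipc_gt0 hp hq M.
have tl := tpow_lipschitz hp hq (ltW M0); have t0 := tpow0 hp hq (ltW M0).
have nlz b' s x : 0 <= s <= T -> `|nl b' s x| <= Kp * `|z (~~ b') s x|.
  by move=> _; have := tl b' (z (~~ b') s x) 0; rewrite t0 !subr0.
have cnl b' : C0_curve (nl b') by exact: (C0_curve_nonlin tl t0).
have eqz b' s x : 0 <= s <= T -> z b' s x = heat s (initial u0 v0 b') x
    + duhamel (fun s => s `^ forcing_expo sigma gamma b') (fun=> forcing w1 w2 b') s x
    + duhamel (fun=> 1) (nl b') s x.
  move=> sT.
  have := mild_volterra hu0 hv0 hw1 hw2 hp hq (ltW T0) (ltW M0) m hM b' sT x.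
  by rewrite /linear_part !mul1r.
have iL b' : (mass (power_of r (initial u0 v0 b')) < +oo)%E.
  by case: b'; exact: Lfun_mass_lty.
have fL b' : (mass (power_of r (forcing w1 w2 b')) < +oo)%E.
  by case: b'; exact: Lfun_mass_lty.
have ci := C0_initial hu0 hv0; have cf := C0_forcing hw1 hw2.
have wk := weight_forcing hsigma hgamma.
split.
  apply: mem_Lfun_mass => //; first exact: C0_continuous ((cz b).1 t).
  exact: (power_mass_lty r1 M0 Kp0 cz zM ci cf wk cnl nlz eqz iL fL b tT).
move=> e e0; have er0 : 0 < e `^ r by exact: powR_gt0.
have [d d0 hd] := power_mass_continuous r1 M0 Kp0 cz zM ci cf wk cnl nlz eqz iL fL b tT er0.
by exists d => // s sT st; apply: Lnorm_le => //; [exact: ltW|exact: hd].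
Qed.

Local Notation Tm := (Tmax u0 v0 w1 w2 sigma gamma p q).
Local Notation Im := (maximal_interval u0 v0 w1 w2 sigma gamma p q).

Lemma maximal_interval_mild U V t : maximal_solution u0 v0 w1 w2 sigma gamma p q U V ->
  Im t -> exists2 T, 0 <= t < T & mild T U V.
Proof.
move=> mx [t0 tTm]; have [T tT [T0 [u [v m]]]] := lt_Tmax_mild tTm.
exists T; first by rewrite t0.
by apply: mx => //; exact: (mild_lt_Tmax hu0 hv0 hw1 hw2 hsigma hgamma hp hq T0 m).
Qed.

(** Continuity at t is local, and a maximal solution is mild on some [0, T] with
    T > t. *)
Lemma maximal_continuous_C0 U V (b : bool) :
  maximal_solution u0 v0 w1 w2 sigma gamma p q U V ->
  continuous_C0 Im (if b then U else V).
Proof.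
move=> mx; split => [t It|].
  have [T /andP[t0 tT] [[cU _] [cV _] _]] := maximal_interval_mild mx It.
  by case: b; [apply: cU|apply: cV]; rewrite /= in_itv/= t0 ltW.
apply/within_uniform_continuousP => t It e e0.
have [T /andP[t0 tT] m] := maximal_interval_mild mx It.
have T0 : 0 < T by exact: le_lt_trans tT.
have [d d0 hd] := (C0_curve_pair b (ltW T0) m).2 t e e0.
exists (Num.min d (T - t)); first by rewrite lt_min d0 subr_gt0.
move=> s [s0 _]; rewrite lt_min => /andP[sd sT] x.
have s_T : 0 <= s <= T by rewrite s0; have := ler_norm (s - t); lra.
have t_T : 0 <= t <= T by rewrite t0 ltW.
by have := hd s sd x; rewrite /pair_curve !clamp_id.
Qed.

Lemma maximal_continuous_Lr U V (b : bool) :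
  maximal_solution u0 v0 w1 w2 sigma gamma p q U V ->
  continuous_Lr r Im (if b then U else V).
Proof.
move=> mx; split => t It; have [T /andP[t0 tT] m] := maximal_interval_mild mx It;
  have T0 : 0 < T by [exact: le_lt_trans tT|exact: le_lt_trans tT].
  have t_T : 0 <= t <= T by rewrite t0 ltW.
  by have [] := mild_Lr b T0 m t_T; rewrite /pair_curve clamp_id.
have t_T : 0 <= t <= T by rewrite t0 ltW.
apply: cvge_fine0 => [s|e e0]; first exact: Lnorm_ge0.
have [_ /(_ e e0)[d d0 hd]] := mild_Lr b T0 m t_T.
apply/nbhs_ballP; exists (Num.min d (T - t)) => /=; first by rewrite lt_min d0 subr_gt0.
move=> s; rewrite -ball_normE/= distrC lt_min => /andP[sd sT] [s0 _].
have s_T : 0 <= s <= T by rewrite s0; have := ler_norm (s - t); lra.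
by have := hd s s_T sd; rewrite /pair_curve !clamp_id.
Qed.

End Lr_persistence.

Theorem theorem1p2 (R : realType) (N : nat) (hN : (1 <= N)%N)
    (u0 v0 w1 w2 : 'rV[R]_N -> R)
    (hu0 : C0 u0) (hv0 : C0 v0) (hw1 : C0 w1) (hw2 : C0 w2)
    (sigma gamma p q : R)
    (hsigma : -1 < sigma) (hgamma : -1 < gamma) (hp : 1 < p) (hq : 1 < q) :
  let mild := mild_solution u0 v0 w1 w2 sigma gamma p q in
  let Tm := Tmax u0 v0 w1 w2 sigma gamma p q in
  let maximal := maximal_solution u0 v0 w1 w2 sigma gamma p q in
  let Im := maximal_interval u0 v0 w1 w2 sigma gamma p q in
  (* (i) *)
  (exists T : R, 0 < T /\
     exists u v, mild T u v /\
       forall u' v', mild T u' v' ->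
         forall t, 0 <= t <= T -> u' t = u t /\ v' t = v t) /\
  (* (ii) *)
  ((0 < Tm)%E /\
   (forall (T : R) u v, 0 < T -> mild T u v ->
      (T%:E < Tm)%E /\
      exists U V, maximal U V /\
        forall t, 0 <= t <= T -> U t = u t /\ V t = v t) /\
   (forall U V, maximal U V -> (Tm < +oo)%E ->
      (Loo_norm t U + Loo_norm t V)%E @[t --> (fine Tm)^'-] --> +oo%E)) /\
  (* (iii) *)
  (forall r : R, 1 <= r ->
     u0 \in Lfun (lebesgue_rV N) r%:E -> v0 \in Lfun (lebesgue_rV N) r%:E ->
     w1 \in Lfun (lebesgue_rV N) r%:E -> w2 \in Lfun (lebesgue_rV N) r%:E ->
     forall U V, maximal U V ->
       [/\ continuous_C0 Im U, continuous_Lr r Im U,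
           continuous_C0 Im V & continuous_Lr r Im V]).
Proof.
move=> mild Tm maximal Im.
split.
  have [T T0 [u [v m]]] := local_existence hu0 hv0 hw1 hw2 hsigma hgamma hp hq.
  exists T; split=> //; exists u, v; split=> // u' v' m' t tT.
  exact: (mild_unique hu0 hv0 hw1 hw2 hp hq m' m tT).
split.
  split; first exact: (Tmax_gt0 hu0 hv0 hw1 hw2 hsigma hgamma hp hq).
  split; last exact: (blow_up hu0 hv0 hw1 hw2 hsigma hgamma hp hq).
  move=> T u v T0 m.
  split; first exact: (mild_lt_Tmax hu0 hv0 hw1 hw2 hsigma hgamma hp hq T0 m).
  exact: (maximal_extension hu0 hv0 hw1 hw2 hsigma hgamma hp hq T0 m).
move=> r r1 Lu0 Lv0 Lw1 Lw2 U V mx.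
split.
- exact: (maximal_continuous_C0 hu0 hv0 hw1 hw2 hsigma hgamma hp hq true mx).
- exact: (maximal_continuous_Lr hu0 hv0 hw1 hw2 hsigma hgamma hp hq r1 Lu0 Lv0 Lw1 Lw2 true mx).
- exact: (maximal_continuous_C0 hu0 hv0 hw1 hw2 hsigma hgamma hp hq false mx).
- exact: (maximal_continuous_Lr hu0 hv0 hw1 hw2 hsigma hgamma hp hq r1 Lu0 Lv0 Lw1 Lw2 false mx).
Qed.
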